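(* Let $\mathcal G$ be a finite graph with couplings $J_{u,v}>0$ on its edges, $\beta>0$, and let $\mathcal M(\mathcal G)$ be the associated metric graph. Then the correlation functions of the extended $XY$ model converge to those of the corresponding Villain model on the metric graph: $$\lim_{N\to\infty}\langle\sigma_x\cdot\sigma_y\rangle^{XY,\mathcal M(\mathcal G)}_{\beta,N}=\langle\sigma_x\cdot\sigma_y\rangle^{\mathrm{Vill},\mathcal M(\mathcal G)}_\beta ,$$ where the convergence is uniform in $x,y$ ranging over the edges of $\mathcal M(\mathcal G)$.
   Context: $\mathcal M(\mathcal G)$ is the metric graph obtained by replacing each edge of $\mathcal G$ by a segment of length $1$. Spins are $\sigma_x=e^{i\theta_x}\in\mathbb S^1$ and $\sigma_x\cdot\sigma_y=\cos(\theta_x-\theta_y)$. Extended $XY$ model: for $N\ge1$, each edge $\{u,v\}$ of $\mathcal G$ is subdivided by $N-1$ equally spaced new sites, $u=x_0,x_1,\dots,x_N=v$, and the angles at all sites of the subdivided graph have joint density (w.r.t. Lebesgue measure) proportional to $$\prod_{\{u,v\}}\exp\Big(-\frac{\beta J_{u,v}N}{2}\sum_{j=1}^N\big|e^{i\theta_{x_j}}-e^{i\theta_{x_{j-1}}}\big|^2\Big).$$ The spin function is extended to all of $\mathcal M(\mathcal G)$ by linear interpolation of the angles between consecutive sites (along the shorter arc). $\langle\cdot\rangle^{XY,\mathcal M(\mathcal G)}_{\beta,N}$ is the corresponding expectation. Villain model on $\mathcal M(\mathcal G)$: the spins at the vertices of $\mathcal G$ have the Villain distribution, with density proportional to $\prod_{\{u,v\}}\sum_{m\in\mathbb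 Z}\exp\big(-\frac{\beta J_{u,v}}2(\theta_v-\theta_u+2\pi m)^2\big)$; given the vertex spins, the angle functions along the different edges are independent Brownian bridges on the circle, with variance $1/(\beta J_{u,v})$ per unit length on the edge $\{u,v\}$, conditioned to take the given values at the end points. That is, on each edge $(u,v)$ an integer $m$ is chosen with probability proportional to $\exp\big(-\frac{\beta J_{u,v}}2(\theta_v-\theta_u+2\pi m)^2\big)$, and then the lifted angle is a Brownian bridge on $[0,1]$ of that variance rate from $\theta_u$ to $\theta_v+2\pi m$. $\langle\cdot\rangle^{\mathrm{Vill},\mathcal M(\mathcal G)}_\beta$ is the corresponding expectation. *)

(* Defs.v *)
From HB Require Import structures.
From mathcomp Require Import all_boot all_order all_algebra.
From mathcomp Require Import all_classical all_reals all_analysis.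

Set Implicit Arguments.
Unset Strict Implicit.
Unset Printing Implicit Defensive.

Import Order.TTheory GRing.Theory Num.Theory.
Import numFieldNormedType.Exports.

Local Open Scope classical_set_scope.
Local Open Scope ring_scope.

(** A finite simple graph is an irreflexive symmetric relation [adj] on a
    finite type [V].  Every undirected edge {u, v} is represented exactly once,
    as the pair (u, v) in which u precedes v in the enumeration of [V]; all the
    densities below are invariant under reversing an edge, so this choice of
    orientation only serves to parametrize the edge by [0, 1]. *)
Definition edge (V : finType) (adj : rel V) : finType :=
  {p : V * V | adj p.1 p.2 && (enum_rank p.1 < enum_rank p.2)%N}.

Definition esrc (V : finType) (adj : rel V) (e : edge adj) : V := (val e).1.
Definition etgt (V : finType) (adj : rel V) (e : edge adj) : V := (val e).2.

(** (e, t) is the point of the edge e at distance t from [esrc e]. *)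
Definition metric_graph (R : realType) (V : finType) (adj : rel V) :
  set (edge adj * R) := [set x | 0 <= x.2 <= 1].
Arguments metric_graph {R V adj}.

(** [iterated op F] applies to [F], a function of the family (c i)_(i : I),
    the operator [op] (an integral or a sum) in each coordinate in turn.  Every
    coordinate is overwritten on the way, so the initial family 0 is
    irrelevant. *)
Section iterated.
Context (R : realType) (I : finType) (T : nmodType) (op : (T -> R) -> R).

Definition update (c : I -> T) (i : I) (x : T) : I -> T :=
  fun j => if j == i then x else c j.

Fixpoint iterated_seq (s : seq I) (F : (I -> T) -> R) (c : I -> T) : R :=
  if s is i :: s' then op (fun x => iterated_seq s' F (update c i x)) else F c.

Definition iterated (F : (I -> T) -> R) : R :=
  iterated_seq (enum I) F (fun=> 0).
End iterated.

(** Integral over the torus with respect to Lebesgue measure; the integrands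
    below are bounded, so by Fubini's theorem this is the integral against the
    product measure, in whatever order. *)
Definition torus_integral (R : realType) (I : finType) (F : (I -> R) -> R) : R :=
  iterated (fun g : R -> R => \int[lebesgue_measure]_(t in `[- pi, pi]) g t) F.

(** Sum of an absolutely summable family, as the difference of the sums of its
    positive and negative parts. *)
Definition int_sum (R : realType) (a : int -> R) : R :=
  fine (\esum_(m in [set: int]) (Num.max (a m) 0)%:E) -
  fine (\esum_(m in [set: int]) (Num.max (- a m) 0)%:E).

Definition multi_int_sum (R : realType) (I : finType) (F : (I -> int) -> R) : R :=
  iterated (@int_sum R) F.

(** For the angles [phi] of a spin configuration on the metric graph, the scalar
    product of the spins e^(i phi x) and e^(i phi y). *)
Definition spin_dot (R : realType) (X : Type) (x y : X) (phi : X -> R) : R :=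
  cos (phi x - phi y).

Section extended_XY.
Context (R : realType) (V : finType) (adj : rel V) (J : V -> V -> R) (beta : R).

(** The sites of the subdivided graph: the vertices, and N - 1 new sites on
    each edge. *)
Definition site (N : nat) : finType := (V + edge adj * 'I_N.-1)%type.

(** The site x_j, 0 <= j <= N, of the subdivided edge e. *)
Definition site_at (N : nat) (e : edge adj) (j : nat) : site N :=
  if j is j'.+1 then
    if insub j' is Some i then inr (e, i) else inl (etgt e)
  else inl (esrc e).

(** |e^(i a) - e^(i b)|^2 *)
Definition chord_sq (a b : R) : R :=
  (cos a - cos b) ^+ 2 + (sin a - sin b) ^+ 2.

Definition xy_weight (N : nat) (theta : site N -> R) : R :=
  \prod_(e : edge adj)
    expR (- (beta * J (esrc e) (etgt e) * N%:R / 2 *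
      \sum_(j < N)
         chord_sq (theta (site_at N e j.+1)) (theta (site_at N e j)))).

(** The representative of d modulo 2 pi in ]- pi, pi]. *)
Definition short_arc (d : R) : R :=
  d - 2 * pi * (Num.ceil ((d - pi) / (2 * pi)))%:~R.

Definition xy_angle (N : nat) (theta : site N -> R) (x : edge adj * R) : R :=
  let j := minn (Num.truncn (x.2 * N%:R)) N.-1 in
  let a := theta (site_at N x.1 j) in
  let b := theta (site_at N x.1 j.+1) in
  a + (x.2 * N%:R - j%:R) * short_arc (b - a).

Definition xy_expect (N : nat) (f : (edge adj * R -> R) -> R) : R :=
  torus_integral (fun theta : site N -> R => xy_weight theta * f (xy_angle theta))
  / torus_integral (@xy_weight N).

End extended_XY.

Section brownian_bridges.
Context (R : realType) (d : measure_display) (Omega : measurableType d).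
Context (P : probability Omega R).

(** [normal_prob] is parametrized by the standard deviation, and its value at
    0 is not the Dirac mass. *)
Definition normal_law (m v : R) (A : set R) : \bar R :=
  if v == 0 then \d_m A else normal_prob m (Num.sqrt v) A.

(** A Brownian bridge from 0 to 0 on [0, 1], of variance rate v: an almost
    surely continuous centered Gaussian process of covariance
    v (min(s, t) - s t). *)
Definition brownian_bridge (v : R) (W : R -> {RV P >-> R}) : Prop :=
  {ae P, forall w, {within `[0, 1], continuous (fun t : R => W t w)}} /\
  forall (n : nat) (t c : 'I_n -> R), (forall i, 0 <= t i <= 1) ->
  forall A : set R, measurable A ->
    P ((fun w => \sum_i c i * W (t i) w) @^-1` A) =
    normal_law 0
      (\sum_i \sum_j c i * c j * (v * (Num.min (t i) (t j) - t i * t j))) A.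

(** The sigma-algebra generated by the process restricted to [0, 1]. *)
Definition process_sigma (W : R -> {RV P >-> R}) : set (set Omega) :=
  <<s [set C | exists t (B : set R),
         [/\ 0 <= t <= 1, measurable B & C = W t @^-1` B]] >>.

Definition independent_processes (I : finType) (W : I -> R -> {RV P >-> R}) :
    Prop :=
  forall C : I -> set Omega, (forall i, process_sigma (W i) (C i)) ->
    fine (P (\bigcap_i C i)) = \prod_i fine (P (C i)).

End brownian_bridges.

Section villain.
Context (R : realType) (V : finType) (adj : rel V) (J : V -> V -> R) (beta : R).

Definition villain_term (e : edge adj) (theta : V -> R) (m : int) : R :=
  expR (- (beta * J (esrc e) (etgt e) / 2 *
    (theta (etgt e) - theta (esrc e) + 2 * pi * m%:~R) ^+ 2)).

Definition villain_edge_weight (e : edge adj) (theta : V -> R) : R :=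
  int_sum (villain_term e theta).

Definition villain_weight (theta : V -> R) : R :=
  \prod_(e : edge adj) villain_edge_weight e theta.

(** The probability, given the vertex angles, of the integers (m e)_e. *)
Definition winding_prob (theta : V -> R) (m : edge adj -> int) : R :=
  \prod_(e : edge adj)
    (villain_term e theta (m e) / villain_edge_weight e theta).

Context (d : measure_display) (Omega : measurableType d).
Context (P : probability Omega R) (W : edge adj -> R -> {RV P >-> R}).

Definition villain_bridges : Prop :=
  (forall e, brownian_bridge (beta * J (esrc e) (etgt e))^-1 (W e)) /\
  independent_processes W.

(** The lifted angle: on the edge e, the Brownian bridge from theta (esrc e) to
    theta (etgt e) + 2 pi m e. *)
Definition villain_angle (theta : V -> R) (m : edge adj -> int) (w : Omega)
    (x : edge adj * R) : R :=
  theta (esrc x.1) +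
  x.2 * (theta (etgt x.1) - theta (esrc x.1) + 2 * pi * (m x.1)%:~R) +
  W x.1 x.2 w.

Definition villain_expect (f : (edge adj * R -> R) -> R) : R :=
  torus_integral (fun theta : V -> R => villain_weight theta *
    multi_int_sum (fun m : edge adj -> int => winding_prob theta m *
      \int[P]_w f (villain_angle theta m w)))
  / torus_integral villain_weight.

End villain.

(* Main.v *)
(** With z = beta J N, one step of the extended XY chain on an edge is a
    convolution on the circle by exp (- z (1 - cos d)) / Z, whose Fourier
    coefficients lam z n are ratios of Bessel functions.  Integrations by parts
    give lam z n = 1 - n^2 / (2 z) + O(z^-2) and lam z (n + 2) <= lam z n / (1 + 2 / z),
    so (lam z n)^N tends to exp (- n^2 / (2 beta J)), dominated by a convergent
    series.  Integrating out the sites of an edge against cos (p x_j + q x_k + a)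
    produces a function of the two end angles whose Fourier coefficients in the
    last one are products of powers of the lam z n; their limits are the Fourier
    coefficients of the sum over the windings of the edge of the Gaussian weight
    times the expectation of the same observable of a Brownian bridge.  A
    function is bounded by the sum of its Fourier coefficients, so the edge
    weights converge uniformly in the end angles and in the positions of the
    sites, and so do the integrals over the vertex angles of their products.
    Replacing the interpolated angles by those of the nearest sites costs at
    most e + C_e (1 - cos d) for a step d, and the expectation of 1 - cos d
    tends to 0, being the case of two consecutive sites of the same limit. *)

Require Import Defs.
From HB Require Import structures.
From mathcomp Require Import all_boot all_order all_algebra.
From mathcomp Require Import all_classical all_reals all_analysis measurable_realfun.
From mathcomp Require Import ring lra zify.
Set Implicit Arguments.
Unset Strict Implicit.
Unset Printing Implicit Defensive.
Import Order.TTheory GRing.Theory Num.Theory.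
Import numFieldNormedType.Exports.
Local Open Scope classical_set_scope.
Local Open Scope ring_scope.

(** * Bounded measurable functions on the circle *)

(** Uniformity in the two points is the obstacle, and it is met by domination. The eigenvalues are
    nonnegative and nonincreasing in the modulus of the frequency, because exp (z (1 + cos d)) is a
    power series in 1 + cos d with nonnegative coefficients, and multiplication by 1 + cos d
    preserves nonnegative nonincreasing cosine coefficients. A product of powers of eigenvalues
    whose exponents add up to N is therefore at most the N-th power of a single one, wherever j and
    k sit on the edge. Only the pairs (p, q) = (0, 0), (1, 0), (1, - 1) occur: no observed point on
    the edge, one, or two; points on distinct edges are separated by a product formula for the
    cosine. The limit coefficients of the two models agree because a second moment is a variance
    plus a squared mean, for a variable with values n + p + q, n + q, n taken with probabilities t,
    s - t, 1 - s. The quotient passes to the limit since the Villain edge weights are bounded below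
    by positive constants. Functions of the angles are kept bounded and measurable, so that every
    exchange of integrals is an instance of Fubini's theorem. *)

Definition bmf (R : realType) d (T : measurableType d) (f : T -> R) : Prop :=
  measurable_fun setT f /\ exists B, forall x, `|f x| <= B.

Section bounded_measurable.
Context (R : realType) d (T : measurableType d).
Implicit Types f g : T -> R.

Lemma bmf_cst (a : R) : bmf (fun _ : T => a).
Proof. by split; [exact: measurable_cst|exists `|a|]. Qed.

Lemma eq_bmf f g : f =1 g -> bmf g -> bmf f.
Proof. by move=> /funext ->. Qed.

Lemma bmfD f g : bmf f -> bmf g -> bmf (fun x => f x + g x).
Proof.
move=> [mf [B Bf]] [mg [C Cg]]; split; first exact: measurable_funD.
by exists (B + C) => x; rewrite (le_trans (ler_normD _ _))// lerD.
Qed.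

Lemma bmfM f g : bmf f -> bmf g -> bmf (fun x => f x * g x).
Proof.
move=> [mf [B Bf]] [mg [C Cg]]; split; first exact: measurable_funM.
by exists (B * C) => x; rewrite normrM ler_pM.
Qed.

Lemma bmfZ a f : bmf f -> bmf (fun x => a * f x).
Proof. by move=> bf; apply: bmfM => //; exact: bmf_cst. Qed.

Lemma bmfN f : bmf f -> bmf (fun x => - f x).
Proof.
move=> /(bmfZ (-1)); congr bmf; apply/funext => x; rewrite mulN1r //.
Qed.

Lemma bmfB f g : bmf f -> bmf g -> bmf (fun x => f x - g x).
Proof. by move=> bf bg; apply: bmfD => //; exact: bmfN. Qed.

Lemma bmf_norm f : bmf f -> bmf (fun x => `|f x|).
Proof.
move=> [mf [B Bf]]; split; first exact: measurableT_comp.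
by exists B => x; rewrite normr_id.
Qed.

Lemma bmf_sum (I : Type) (s : seq I) (P : pred I) (F : I -> T -> R) :
  (forall i, P i -> bmf (F i)) -> bmf (fun x => \sum_(i <- s | P i) F i x).
Proof.
move=> bF; elim: s => [|i s IH].
  by apply: eq_bmf (bmf_cst 0) => x; rewrite big_nil.
case Pi: (P i); last by apply: eq_bmf IH => x; rewrite big_cons Pi.
by apply: eq_bmf (bmfD (bF _ Pi) IH) => x; rewrite big_cons Pi.
Qed.

Lemma bmf_prod (I : Type) (s : seq I) (P : pred I) (F : I -> T -> R) :
  (forall i, P i -> bmf (F i)) -> bmf (fun x => \prod_(i <- s | P i) F i x).
Proof.
move=> bF; elim: s => [|i s IH].
  by apply: eq_bmf (bmf_cst 1) => x; rewrite big_nil.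
case Pi: (P i); last by apply: eq_bmf IH => x; rewrite big_cons Pi.
by apply: eq_bmf (bmfM (bF _ Pi) IH) => x; rewrite big_cons Pi.
Qed.

Lemma bmfX n f : bmf f -> bmf (fun x => f x ^+ n).
Proof.
move=> bf; elim: n => [|n IH]; first by apply: eq_bmf (bmf_cst 1) => x; rewrite expr0.
by apply: eq_bmf (bmfM bf IH) => x; rewrite exprS.
Qed.

Lemma bmf_comp d' (T' : measurableType d') (h : T' -> T) f :
  measurable_fun setT h -> bmf f -> bmf (fun x => f (h x)).
Proof.
move=> mh [mf [B Bf]]; split; first exact: measurableT_comp.
by exists B.
Qed.

Lemma measurable_cos : measurable_fun setT (@cos R).
Proof. by apply: continuous_measurable_fun; exact: continuous_cos. Qed.

Lemma bmf_cos f : measurable_fun setT f -> bmf (fun x => cos (f x)).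
Proof.
move=> mf; split; first exact: measurableT_comp measurable_cos _.
by exists 1 => x; rewrite ler_norml cos_geN1 cos_le1.
Qed.

Lemma bmf_sin f : measurable_fun setT f -> bmf (fun x => sin (f x)).
Proof.
move=> mf; split.
  by apply: measurableT_comp => //; apply: continuous_measurable_fun; exact: continuous_sin.
by exists 1 => x; rewrite ler_norml sin_geN1 sin_le1.
Qed.

Lemma bmf_expR_le (B : R) f : measurable_fun setT f -> (forall x, f x <= B) ->
  bmf (fun x => expR (f x)).
Proof.
move=> mf fB; split; first exact: measurableT_comp.
by exists (expR B) => x; rewrite ger0_norm ?expR_ge0// ler_expR.
Qed.

(** The main source of integrability, on the circle as well as on the probability space: a bound and
    a finite measure suffice. *)
Lemma bmf_integrable (mu : {measure set T -> \bar R}) (D : set T) f :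
  measurable D -> (mu D < +oo)%E -> bmf f -> mu.-integrable D (EFin \o f).
Proof.
move=> mD muD [mf [B Bf]]; apply: measurable_bounded_integrable => //.
  exact: measurable_funTS.
exists B; split; first exact: num_real.
by move=> M BM x _; rewrite /= (le_trans (Bf x))// ltW.
Qed.
End bounded_measurable.
Arguments bmf_cst {R d T} a.

(** * Differentiation rules for explicit functions of a real variable *)

Section pointwise_derivatives.
Context (R : realType).
Implicit Types (f g : R -> R) (x a b : R).

Lemma der_cst x (c : R) : is_derive x 1 (fun _ : R => c) 0.
Proof. exact: is_derive_cst. Qed.

Lemma der_id x : is_derive x 1 (fun y : R => y) 1.
Proof. exact: is_derive_id. Qed.

Lemma derD f g x a b : is_derive x 1 f a -> is_derive x 1 g b ->
  is_derive x 1 (fun y => f y + g y) (a + b).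
Proof. exact: is_deriveD. Qed.

Lemma derN f x a : is_derive x 1 f a -> is_derive x 1 (fun y => - f y) (- a).
Proof. exact: is_deriveN. Qed.

Lemma derB f g x a b : is_derive x 1 f a -> is_derive x 1 g b ->
  is_derive x 1 (fun y => f y - g y) (a - b).
Proof. exact: is_deriveB. Qed.

Lemma derM f g x a b : is_derive x 1 f a -> is_derive x 1 g b ->
  is_derive x 1 (fun y => f y * g y) (f x * b + g x * a).
Proof. exact: is_deriveM. Qed.

Lemma der_comp f g x a b : is_derive (g x) 1 f a -> is_derive x 1 g b ->
  is_derive x 1 (fun y => f (g y)) (a * b).
Proof. exact: is_derive1_comp. Qed.

(** Lets a derivative be assembled by the rules first and its value be simplified by [ring] or
    [field] afterwards. *)
Lemma der_eq f x a b : is_derive x 1 f a -> a = b -> is_derive x 1 f b.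
Proof. by move=> ? <-. Qed.

Lemma der_affine (a b x : R) : is_derive x 1 (fun y : R => a * y + b) a.
Proof.
apply: der_eq (derD (derM (der_cst x a) (der_id x)) (der_cst x b)) _.
by rewrite mulr0 mulr1 !addr0.
Qed.

Lemma der_cos f x a : is_derive x 1 f a ->
  is_derive x 1 (fun y => cos (f y)) (- sin (f x) * a).
Proof. by move=> df; apply: (der_comp (f := cos)) df; exact: is_derive_cos. Qed.

Lemma der_sin f x a : is_derive x 1 f a ->
  is_derive x 1 (fun y => sin (f y)) (cos (f x) * a).
Proof. by move=> df; apply: (der_comp (f := sin)) df; exact: is_derive_sin. Qed.

Lemma der_expR f x a : is_derive x 1 f a ->
  is_derive x 1 (fun y => expR (f y)) (expR (f x) * a).
Proof. by move=> df; apply: (der_comp (f := expR)) df; exact: is_derive_expR. Qed.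

Lemma der_continuous f x a : is_derive x 1 f a -> {for x, continuous f}.
Proof.
by move=> df; apply: differentiable_continuous; apply/derivable1_diffP; have [] := df.
Qed.
End pointwise_derivatives.

(** * The integral over one period *)

Definition tint (R : realType) (g : R -> R) : R :=
  \int[lebesgue_measure]_(t in `[- pi, pi]) g t.

Section tint.
Context (R : realType).
Implicit Types f g : R -> R.
Local Notation mu := (@lebesgue_measure R).

Lemma torus_measure : mu `[- pi, pi]%classic = (2 * pi)%:E.
Proof.
rewrite lebesgue_measure_itv/= lte_fin ifT; last by have := pi_gt0 R; lra.
by rewrite -EFinB; congr EFin; lra.
Qed.

Lemma tint_integrable f : bmf f -> mu.-integrable `[- pi, pi] (EFin \o f).
Proof.
move=> bf; apply: (@bmf_integrable R _ (measurableTypeR R) mu) => //.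
by have := ltry (2 * pi : R); rewrite -torus_measure.
Qed.

Lemma tint_cst (a : R) : tint (fun=> a) = 2 * pi * a.
Proof.
transitivity (a * fine (mu `[- pi, pi])); first exact: Rintegral_cst.
by rewrite torus_measure /= mulrC.
Qed.

Lemma eq_tint f g : f =1 g -> tint f = tint g.
Proof. by move=> /funext ->. Qed.

Lemma tintZ a f : bmf f -> tint (fun x => a * f x) = a * tint f.
Proof. by move=> bf; rewrite /tint RintegralZl//; exact: tint_integrable. Qed.

Lemma tintZr a f : bmf f -> tint (fun x => f x * a) = tint f * a.
Proof. by move=> bf; rewrite /tint RintegralZr//; exact: tint_integrable. Qed.

Lemma tintD f g : bmf f -> bmf g -> tint (fun x => f x + g x) = tint f + tint g.
Proof. by move=> bf bg; rewrite /tint RintegralD//; exact: tint_integrable. Qed.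

Lemma tintB f g : bmf f -> bmf g -> tint (fun x => f x - g x) = tint f - tint g.
Proof. by move=> bf bg; rewrite /tint RintegralB//; exact: tint_integrable. Qed.

Lemma tint_sum (I : Type) (s : seq I) (F : I -> R -> R) :
  (forall i, bmf (F i)) ->
  tint (fun x => \sum_(i <- s) F i x) = \sum_(i <- s) tint (F i).
Proof.
move=> bF; elim: s => [|i s IH].
  by rewrite big_nil -[RHS](mulr0 (2 * pi)) -tint_cst; apply: eq_tint => x; rewrite big_nil.
rewrite big_cons -IH -tintD//; last by apply: bmf_sum.
by apply: eq_tint => x; rewrite big_cons.
Qed.

Lemma le_tint_in f g : bmf f -> bmf g ->
  (forall x, - pi <= x <= pi -> f x <= g x) -> tint f <= tint g.
Proof.
move=> bf bg fg; apply: le_Rintegral => //; try exact: tint_integrable.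
Qed.

Lemma le_tint f g : bmf f -> bmf g -> (forall x, f x <= g x) -> tint f <= tint g.
Proof. by move=> bf bg fg; apply: le_tint_in. Qed.

Lemma tint_ge0_in f : (forall x, - pi <= x <= pi -> 0 <= f x) -> 0 <= tint f.
Proof.
by move=> f0; apply: Rintegral_ge0 => x /=; rewrite in_itv/=; exact: f0.
Qed.

Lemma tint_ge0 f : (forall x, 0 <= f x) -> 0 <= tint f.
Proof. by move=> f0; apply: tint_ge0_in. Qed.

Lemma tint_norm f : bmf f -> `|tint f| <= tint (fun x => `|f x|).
Proof. by move=> bf; apply: le_normr_Rintegral => //; exact: tint_integrable. Qed.

Lemma tint_norm_le f g : bmf f -> bmf g -> (forall x, `|f x| <= g x) ->
  `|tint f| <= tint g.
Proof.
move=> bf bg fg; rewrite (le_trans (tint_norm bf))//; apply: le_tint => //.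
exact: bmf_norm.
Qed.

Lemma continuous_bmf f (B : R) : continuous f -> (forall x, `|f x| <= B) -> bmf f.
Proof.
by move=> cf fB; split; [exact: continuous_measurable_fun|exists B].
Qed.

End tint.

(** * Antiderivatives and periodic functions *)

Section periodic.
Context (R : realType).
Implicit Types (f g h F : R -> R) (m n : int).
Local Notation mu := (@lebesgue_measure R).

(** Differentiability is asked on the closed interval only, because the antiderivatives supplied by
    [antiderivative_local] are valid on a bounded interval. *)
Lemma FTC_local F f (a b : R) : a < b -> continuous f ->
  (forall x, a <= x <= b -> is_derive x (1 : R) F (f x)) ->
  \int[mu]_(x in `[a, b]) f x = F b - F a.
Proof.
move=> ab cf dF.
have cF x : a <= x <= b -> {for x, continuous F} by move=> /dF; exact: der_continuous.
rewrite /Rintegral (@continuous_FTC2 _ f F) //.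
- exact: continuous_subspaceT.
- split.
  + by move=> x; rewrite in_itv/= => /andP[ax xb]; have [] := dF x (introT andP (conj (ltW ax) (ltW xb))).
  + by apply: cvg_at_right_filter; apply: cF; rewrite lexx ltW.
  + by apply: cvg_at_left_filter; apply: cF; rewrite lexx ltW.
- by move=> x; rewrite in_itv/= => /andP[ax xb]; rewrite derive1E; have [_ ->] := dF x (introT andP (conj (ltW ax) (ltW xb))).
Qed.

Lemma tint_derive F f : continuous f -> (forall x : R, is_derive x (1 : R) F (f x)) ->
  tint f = F pi - F (- pi).
Proof. by move=> cf dF; apply: FTC_local => //; have := pi_gt0 R; lra. Qed.

Lemma cosD2pi_int x m : cos (x + 2 * pi * m%:~R) = cos x :> R.
Proof.
have cosn (k : nat) (y : R) : cos (y + 2 * pi * k%:R) = cos y.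
  rewrite -[in RHS](periodicn (@cosD2pi R) k).
  suff -> : y + 2 * pi * k%:R = y + pi *+ 2 *+ k by [].
  by rewrite -[pi *+ 2]mulr_natr -[_ *+ k]mulr_natr; ring.
case: m => k; first exact: cosn.
rewrite -(cosn k.+1) NegzE mulrNz.
by rewrite (_ : x + 2 * pi * - k.+1%:~R + 2 * pi * k.+1%:R = x)//; ring.
Qed.

Lemma sinD2pi_int x m : sin (x + 2 * pi * m%:~R) = sin x :> R.
Proof.
rewrite -!cosBpihalf.
rewrite (_ : x + 2 * pi * m%:~R - pi / 2 = (x - pi / 2) + 2 * pi * m%:~R); last ring.
exact: cosD2pi_int.
Qed.

Lemma continuous_cos_comp f : continuous f -> continuous (fun x => cos (f x)).
Proof. by move=> cf x; apply: continuous_comp; [exact: cf|exact: continuous_cos]. Qed.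

Lemma continuous_sin_comp f : continuous f -> continuous (fun x => sin (f x)).
Proof. by move=> cf x; apply: continuous_comp; [exact: cf|exact: continuous_sin]. Qed.

Lemma continuous_affine (a b : R) : continuous (fun x : R => a * x + b).
Proof. by move=> x; apply: cvgD; [apply: cvgM; [exact: cvg_cst|exact: cvg_id]|exact: cvg_cst]. Qed.

Lemma measurable_affine (a b : R) : measurable_fun setT (fun x : R => a * x + b).
Proof. by apply: continuous_measurable_fun; exact: continuous_affine. Qed.

Lemma bmf_cos_affine (a b : R) : bmf (fun x : R => cos (a * x + b)).
Proof. by apply: bmf_cos; exact: measurable_affine. Qed.

Lemma bmf_sin_affine (a b : R) : bmf (fun x : R => sin (a * x + b)).
Proof. by apply: bmf_sin; exact: measurable_affine. Qed.

Lemma tint_cos m (c : R) : m != 0 -> tint (fun x => cos (m%:~R * x + c)) = 0.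
Proof.
move=> m0; have m0' : m%:~R != 0 :> R by rewrite intr_eq0.
have dF (x : R) : is_derive x 1 (fun x => m%:~R^-1 * sin (m%:~R * x + c)) (cos (m%:~R * x + c)).
  apply: der_eq (derM (der_cst x _) (der_sin (der_affine _ _ _))) _.
  by rewrite mulr0 addr0 mulrCA mulVf// mulr1.
rewrite (tint_derive _ dF).
  rewrite -[X in _ * X - _](sinD2pi_int _ (- m)).
  rewrite (_ : m%:~R * pi + c + 2 * pi * (- m)%:~R = m%:~R * - pi + c) ?subrr//.
  by rewrite mulrNz; ring.
by apply: continuous_cos_comp; exact: continuous_affine.
Qed.

Lemma antiderivative_local f (L : R) : continuous f ->
  exists F, forall x, - L < x < L -> is_derive x (1 : R) F (f x).
Proof.
move=> cf; exists (fun x => \int[mu]_(t in `[- L, x]) f t) => x /andP[Lx xL].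
have fi : mu.-integrable `[- L, L] (EFin \o f).
  apply: continuous_compact_integrable; first exact: segment_compact.
  exact: continuous_subspaceT.
have [dF F1] := @continuous_FTC1_closed R f (- L) x L xL fi Lx (cf x).
apply: (DeriveDef dF); rewrite -F1 derive1E; reflexivity.
Qed.

(** The integral over a window of length 2 pi does not depend on the window: for an antiderivative
    F, the increment F (x + pi) - F (x - pi) has derivative 0 by periodicity. *)
Lemma tint_shift f (c : R) : continuous f -> (forall x, f (x + 2 * pi) = f x) ->
  tint (fun x => f (x + c)) = tint f.
Proof.
move=> cf pf; have pi0 := pi_gt0 R.
(* The radius is generous: all arguments of F below are at most [|c| + 2 * pi] in modulus. *)
have [F dF] := antiderivative_local (`|c| + 4 * pi) cf.
have cc : - `|c| <= c <= `|c| by rewrite -ler_norml.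
have dFs e x : `|e| <= `|c| + pi -> - pi <= x <= pi ->
    is_derive x (1 : R) (fun x => F (x + e)) (f (x + e)).
  rewrite ler_norml => e1 x1.
  apply: der_eq (der_comp (dF _ _) (derD (der_id x) (der_cst x e))) _; first lra.
  by rewrite addr0 mulr1.
have pie : - pi < pi :> R by lra.
have cfs : continuous (fun x => f (x + c)).
  by move=> x; apply: continuous_comp; [apply: cvgD; [exact: cvg_id|exact: cvg_cst]|exact: cf].
have -> : tint (fun x => f (x + c)) = F (pi + c) - F (- pi + c).
  by apply: (FTC_local (F := fun x => F (x + c)) pie cfs) => x x1; apply: dFs => //; lra.
have -> : tint f = F pi - F (- pi).
  by apply: (FTC_local pie cf) => x x1; apply: dF; lra.
pose D x := F (x + pi) - F (x - pi).
have dD x : - `|c| <= x <= `|c| -> is_derive x (1 : R) D 0.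
  move=> x1; have -> : 0 = f (x + pi) - f (x - pi).
    by rewrite (_ : x + pi = x - pi + 2 * pi) ?pf ?subrr//; ring.
  apply: derB.
  - apply: der_eq (der_comp (dF _ _) (derD (der_id x) (der_cst x pi))) _; first lra.
    by rewrite addr0 mulr1.
  - apply: der_eq (der_comp (dF _ _) (derD (der_id x) (der_cst x (- pi)))) _; first lra.
    by rewrite addr0 mulr1.
have Dcst x y : - `|c| <= x -> x < y -> y <= `|c| -> D x = D y.
  move=> cx xy yc; apply/eqP; rewrite eq_sym -subr_eq0.
  have <- : \int[mu]_(z in `[x, y]) (fun _ : R => 0 : R) z = D y - D x.
    apply: (FTC_local xy); first by move=> z; exact: cvg_cst.
    by move=> z z1; apply: dD; lra.
  by rewrite Rintegral_cst// mul0r.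
have -> : F (pi + c) - F (- pi + c) = D c by rewrite /D; congr (F _ - F _); ring.
have -> : F pi - F (- pi) = D 0 by rewrite /D add0r sub0r.
by have [c0|c0|->//] := ltgtP c 0; [apply: Dcst|apply/esym; apply: Dcst]; lra.
Qed.
End periodic.

(** * Fejer kernels *)

Section fejer.
Context (R : realType).
Implicit Types (h : R -> R) (a : nat -> R).

Let ccos (M : nat) (y : R) := \sum_(j < M) cos (j%:R * y).
Let ssin (M : nat) (y : R) := \sum_(j < M) sin (j%:R * y).

(** M times the classical Fejer kernel, that is the squared modulus of the sum of e^(i j y) for j <
    M, so its total mass is 2 pi M. As a double sum of cosines it gives Fourier coefficients
    directly when integrated against a function. *)
Definition fejer_kernel (M : nat) (y : R) :=
  \sum_(j < M) \sum_(k < M) cos ((j%:R - k%:R) * y).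

Lemma fejer_kernelE M y : fejer_kernel M y = ccos M y ^+ 2 + ssin M y ^+ 2.
Proof.
rewrite !expr2 /ccos /ssin !mulr_suml -big_split /=.
apply: eq_bigr => j _; rewrite !mulr_sumr -big_split /=.
by apply: eq_bigr => k _; rewrite mulrBl cosB.
Qed.

Lemma fejer_kernel_ge0 M y : 0 <= fejer_kernel M y.
Proof. by rewrite fejer_kernelE addr_ge0// sqr_ge0. Qed.

(** The closed form (1 - cos (M y)) / (1 - cos y) of the kernel, without the division. Against 1 -
    cos the kernel stays below 2 for all M, which is how its concentration at 0 is used. *)
Lemma fejer_kernel_onem M y : fejer_kernel M y * (1 - cos y) = 1 - cos (M%:R * y).
Proof.
(* [C] and [S] are the real and imaginary parts of the telescoping identity (1 - e^(i y)) sum e^(i j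
   y) = 1 - e^(i M y); squared moduli are then compared. *)
have C : ccos M y * (1 - cos y) + ssin M y * sin y = 1 - cos (M%:R * y).
  rewrite /ccos /ssin; elim: M => [|M IH].
    by rewrite !big_ord0 !mul0r cos0; lra.
  rewrite !big_ord_recr/= -(natr1 M) [(M%:R + 1) * y]mulrDl mul1r cosD.
  by move: IH; set A := \sum_(_ < _) _; set B := \sum_(_ < _) _; lra.
have S : ssin M y * (1 - cos y) - ccos M y * sin y = - sin (M%:R * y).
  rewrite /ccos /ssin; elim: M {C} => [|M IH].
    by rewrite !big_ord0 !mul0r sin0; lra.
  rewrite !big_ord_recr/= -(natr1 M) [(M%:R + 1) * y]mulrDl mul1r sinD.
  by move: IH; set A := \sum_(_ < _) _; set B := \sum_(_ < _) _; lra.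
have c1 := cos2Dsin2 y; have c2 := cos2Dsin2 (M%:R * y).
have : (ccos M y ^+ 2 + ssin M y ^+ 2) * ((1 - cos y) ^+ 2 + sin y ^+ 2) =
  (1 - cos (M%:R * y)) ^+ 2 + (- sin (M%:R * y)) ^+ 2 by rewrite -C -S; ring.
rewrite -fejer_kernelE.
have -> : (1 - cos y) ^+ 2 + sin y ^+ 2 = 2 * (1 - cos y).
  by rewrite sin2cos2; ring.
have -> : (1 - cos (M%:R * y)) ^+ 2 + (- sin (M%:R * y)) ^+ 2 = 2 * (1 - cos (M%:R * y)).
  by rewrite sqrrN sin2cos2; ring.
by move=> H; lra.
Qed.

Lemma continuous_sum (I : Type) (s : seq I) (F : I -> R -> R) :
  (forall i, continuous (F i)) -> continuous (fun x => \sum_(i <- s) F i x).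
Proof.
move=> cF; elim: s => [|i s IH].
  rewrite (_ : (fun _ => _) = cst 0); first by move=> x; exact: cvg_cst.
  by apply/funext => x; rewrite big_nil.
rewrite (_ : (fun _ => _) = (fun x => F i x + \sum_(i <- s) F i x)).
  by move=> x; apply: cvgD; [exact: cF|exact: IH].
by apply/funext => x; rewrite big_cons.
Qed.

Lemma continuous_fejer_kernel M : continuous (fejer_kernel M).
Proof.
apply: continuous_sum => j; apply: continuous_sum => k; apply: continuous_cos_comp.
by move=> x; apply: cvgM; [exact: cvg_cst|exact: cvg_id].
Qed.

Lemma bmf_fejer_kernel M : bmf (fejer_kernel M).
Proof.
apply: bmf_sum => j _; apply: bmf_sum => k _.
by apply: eq_bmf (bmf_cos_affine (j%:R - k%:R) 0) => x; rewrite addr0.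
Qed.

Lemma fejer_kernel_periodic M y : fejer_kernel M (y + 2 * pi) = fejer_kernel M y.
Proof.
apply: eq_bigr => j _; apply: eq_bigr => k _.
have -> : (j%:R - k%:R) * (y + 2 * pi) =
  (j%:R - k%:R) * y + 2 * pi * (j%:Z - k%:Z)%:~R :> R by rewrite intrB; ring.
by rewrite cosD2pi_int.
Qed.

Lemma tint_fejer_kernel M : tint (fejer_kernel M) = 2 * pi * M%:R.
Proof.
rewrite /fejer_kernel tint_sum; last first.
  move=> j; apply: bmf_sum => k _.
  by apply: eq_bmf (bmf_cos_affine (j%:R - k%:R) 0) => x; rewrite addr0.
transitivity (\sum_(j < M) (2 * pi : R)); last by rewrite sumr_const card_ord mulr_natr.
apply: eq_bigr => j _.
rewrite tint_sum; last first.
  by move=> k; apply: eq_bmf (bmf_cos_affine (j%:R - k%:R) 0) => x; rewrite addr0.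
rewrite (bigD1 j)//= subrr big1 ?addr0 => [|k kj].
  by rewrite -[RHS]mulr1 -tint_cst; apply: eq_tint => x; rewrite mul0r cos0.
rewrite -[RHS](@tint_cos R (j%:Z - k%:Z) 0); last first.
  by rewrite subr_eq0 eqz_nat eq_sym.
by apply: eq_tint => x; rewrite intrB addr0.
Qed.

(** In a row of the double sum each distance occurs at most twice, once to the left of j and once
    from j on; each side is a partial sum of [a]. *)
Lemma sum_distn_le a S M (j : 'I_M) : (forall n, 0 <= a n) ->
  (forall M, \sum_(n < M) a n <= S) ->
  \sum_(k < M) a `|j - k|%N <= 2 * S.
Proof.
move=> a0 aS.
rewrite -(big_mkord xpredT (fun k => a `|j - k|%N)) (big_cat_nat _ (ltnW (ltn_ord j)))//=.
have -> : 2 * S = S + S by rewrite mulr_natl.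
apply: lerD.
  rewrite big_nat_rev/= add0n big_mkord; apply: le_trans (aS j.+1).
  rewrite big_ord_recl; apply: ler_wpDl => //.
  apply: ler_sum => i _; rewrite /= /bump /= add1n.
  by rewrite distnEl ?subKn ?leq_subr// ltn_ord.
rewrite -{1}(add0n (j : nat)) big_addn big_mkord; apply: le_trans (aS (M - j)%N).
apply: ler_sum => i _; rewrite distnEr ?leq_addl// addnK//.
Qed.

(* Convolution with Fejer kernels recovers h, so h is bounded by the sum of the
   moduli of its Fourier coefficients without any inversion formula. *)
Lemma fejer_bound h a S : continuous h -> bmf h -> (forall x, h (x + 2 * pi) = h x) ->
  (forall x n, `|tint (fun y => h y * cos (n%:R * (y - x)))| <= a n) ->
  (forall M, \sum_(n < M) a n <= S) -> forall x, `|h x| <= S / pi.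
Proof.
move=> ch bh ph ha aS x.
have pi0 := pi_gt0 R.
have a0 n : 0 <= a n by rewrite (le_trans _ (ha 0 n)).
apply/ler_addgt0Pr => e e0.
have [B hB] := bh.2.
have B0 : 0 <= B by rewrite (le_trans _ (hB 0)).
have e20 : 0 < e / 2 by lra.
(* Continuity at [x] gives e / 2 near 0. Away from 0 the trivial bound 2 B is absorbed by a multiple
   of 1 - cos y, which is then at least 1 - cos d'; the kernel turns 1 - cos into a bounded
   function. *)
have [C C0 hC] : exists2 C : R, 0 <= C & forall y : R, - pi <= y <= pi ->
    `|h (y + x) - h x| <= e / 2 + C * (1 - cos y).
  have /cvgrPdist_le/(_ _ e20) := ch x.
  rewrite near_simpl => /nbhs_ballP[d /= d0 hd].
  pose d' := Num.min (d / 2) pi.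
  have d'0 : 0 < d' by rewrite lt_min; lra.
  have d'pi : d' <= pi by rewrite ge_min lexx orbT.
  have d'd : d' < d by rewrite gt_min; apply/orP; left; lra.
  have cd : 0 < 1 - cos d'.
    by rewrite subr_gt0 -[ltRHS]cos0 ltr_cos// in_itv/= ?lexx ?pi_ge0// ltW.
  have hcos y : 0 <= 1 - cos y by rewrite subr_ge0 cos_le1.
  exists (2 * B / (1 - cos d')); first by rewrite divr_ge0 ?mulr_ge0// ltW.
  move=> y ypi; have [yd|yd] := leP d' `|y|.
    have cy : 1 - cos d' <= 1 - cos y.
      rewrite lerD2l lerN2 -(cos_norm y).
      have yp : `|y| <= pi by rewrite ler_norml.
      move: yd; rewrite le_eqVlt => /predU1P[->//|yd].
      by rewrite ltW// ltr_cos// in_itv/= ?normr_ge0 ?yp// ltW.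
    apply: (@le_trans _ _ (2 * B)).
      by rewrite (le_trans (ler_normB _ _))//; have := hB (y + x); have := hB x; lra.
    rewrite mulrAC (le_trans _ (_ : 2 * B * ((1 - cos y) / (1 - cos d')) <= _))//.
      by rewrite ler_peMr ?mulr_ge0// ler_pdivlMr// mul1r.
    by rewrite mulrA; lra.
  rewrite distrC; apply: (@le_trans _ _ (e / 2)); last first.
    by rewrite lerDl mulr_ge0// divr_ge0 ?mulr_ge0// ltW.
  apply: hd; rewrite /ball /= opprD addrCA subrr addr0 normrN.
  exact: lt_trans yd d'd.
(* Chosen so that the error 2 pi (2 C) is at most half of the mass 2 pi (M + 1) times e; the other
   half is the e / 2 of [hC]. *)
have [M MC] : exists M : nat, 4 * C / e < M.+1%:R.
  by exists (Num.truncn (4 * C / e)); rewrite truncnS_gt.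
pose F := fejer_kernel M.+1.
have bF : bmf F := bmf_fejer_kernel _.
have cF : continuous F := @continuous_fejer_kernel _.
have bhs : bmf (fun y : R => h (y + x)).
  by apply: (bmf_comp (h := fun y : R => y + x)) => //; apply: eq_measurable_fun (measurable_affine 1 x) => y _; rewrite mul1r.
have bhs0 : bmf (fun y : R => h (y + x) - h x) by apply: bmfB => //; exact: bmf_cst.
have bFh : bmf (fun y : R => F y * h (y + x)) := bmfM bF bhs.
have bFc : bmf (fun y : R => F y * h x) := bmfM bF (bmf_cst (h x)).
have bFh0 : bmf (fun y : R => F y * (h (y + x) - h x)) := bmfM bF bhs0.
have dI : `|tint (fun y => F y * h (y + x)) - 2 * pi * M.+1%:R * h x| <=
    2 * pi * M.+1%:R * (e / 2) + 2 * pi * (2 * C).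
  have -> : tint (fun y => F y * h (y + x)) - 2 * pi * M.+1%:R * h x =
      tint (fun y => F y * (h (y + x) - h x)).
    rewrite -tint_fejer_kernel -tintZr// -(tintB bFh bFc).
    by apply: eq_tint => y; rewrite mulrBr.
  apply: le_trans (tint_norm bFh0) _.
  have -> : 2 * pi * M.+1%:R * (e / 2) + 2 * pi * (2 * C) =
      tint (fun y => F y * (e / 2) + 2 * C).
    rewrite (tintD (bmfM bF (bmf_cst _)) (bmf_cst _)) tintZr//.
    by rewrite tint_fejer_kernel tint_cst.
  apply: le_tint_in.
  - exact: bmf_norm.
  - exact: bmfD (bmfM bF (bmf_cst _)) (bmf_cst _).
  move=> y ypi; rewrite normrM ger0_norm ?fejer_kernel_ge0//.
  apply: le_trans (ler_wpM2l (fejer_kernel_ge0 _ _) (hC _ ypi)) _.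
  rewrite mulrDr lerD2l mulrCA [F y * _]fejer_kernel_onem.
  have := cos_geN1 (M.+1%:R * y); nra.
(* Up to normalization this is the Fejer mean of [h] at [x], a double sum of Fourier coefficients;
   each row is at most 2 S by [sum_distn_le]. *)
have nI : `|tint (fun y => F y * h (y + x))| <= M.+1%:R * (2 * S).
  have -> : tint (fun y => F y * h (y + x)) = tint (fun y => F (y - x) * h y).
    rewrite -(@tint_shift _ (fun y => F (y - x) * h y) x).
    - by apply: eq_tint => y; rewrite addrK.
    - move=> y; apply: cvgM; last exact: ch.
      by apply: continuous_comp; [apply: cvgB; [exact: cvg_id|exact: cvg_cst]|exact: cF].
    - by move=> y; rewrite ph addrAC /F fejer_kernel_periodic.
  have -> : tint (fun y => F (y - x) * h y) =
      \sum_(j < M.+1) \sum_(k < M.+1) tint (fun y => h y * cos ((j%:R - k%:R) * (y - x))).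
    have bt (j k : 'I_M.+1) : bmf (fun y => h y * cos ((j%:R - k%:R) * (y - x))).
      apply: bmfM => //; apply: eq_bmf (bmf_cos_affine (j%:R - k%:R) (- ((j%:R - k%:R) * x))) => y.
      by rewrite mulrBr.
    transitivity (tint (fun y => \sum_(j < M.+1) \sum_(k < M.+1) h y * cos ((j%:R - k%:R) * (y - x)))).
      apply: eq_tint => y; rewrite /F /fejer_kernel mulrC mulr_sumr.
      by apply: eq_bigr => j _; rewrite mulr_sumr.
    rewrite tint_sum; last by move=> j; apply: bmf_sum => k _; exact: bt.
    by apply: eq_bigr => j _; rewrite tint_sum// => k; exact: bt.
  apply: le_trans (ler_norm_sum _ _ _) _.
  have -> : M.+1%:R * (2 * S) = \sum_(j < M.+1) (2 * S) by rewrite sumr_const card_ord mulr_natl.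
  apply: ler_sum => j _.
  apply: le_trans (ler_norm_sum _ _ _) _.
  apply: le_trans (sum_distn_le j a0 aS); apply: ler_sum => k _.
  apply: le_trans (ha x _); rewrite le_eqVlt; apply/orP; left; apply/eqP.
  congr (`| _ |); apply: eq_tint => y; congr (_ * _).
  have [jk|/ltnW jk] := leqP j k.
    rewrite distnEr// natrB// -cosN; congr (cos _); ring.
  by rewrite distnEl// natrB.
set I := tint _ in dI nI.
have M0 : 0 < M.+1%:R :> R by rewrite ltr0n.
have CM : 4 * C <= e * M.+1%:R by rewrite [e * _]mulrC -ler_pdivrMr//; exact: ltW.
have P0 : 0 < 2 * pi * M.+1%:R :> R by rewrite !mulr_gt0.
rewrite -(ler_pM2l P0).
have -> : 2 * pi * M.+1%:R * (S / pi + e) = M.+1%:R * (2 * S) + 2 * pi * M.+1%:R * e.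
  by field; lra.
have -> : 2 * pi * M.+1%:R * `|h x| = `|2 * pi * M.+1%:R * h x|.
  by rewrite normrM (gtr0_norm P0).
have : `|2 * pi * M.+1%:R * h x| <= `|I| + `|I - 2 * pi * M.+1%:R * h x|.
  by rewrite (le_trans _ (ler_normB _ _))// opprB addrC subrK.
have : pi * (4 * C) <= pi * (e * M.+1%:R) by rewrite ler_pM2l.
move: dI nI; set u := `|_ - _|; set v := `|I|; set w := `|_ * _|; set m := M.+1%:R.
by move=> *; lra.
Qed.
End fejer.

(** * The kernel of the XY model on the circle *)

Section cosine_coefficients.
Context (R : realType).
Implicit Types (g : R -> R).

Definition dec_coef g : Prop := forall n : nat,
  0 <= tint (fun d => g d * cos (n.+1%:R * d)) <= tint (fun d => g d * cos (n%:R * d)).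

Lemma bmf_cosn (n : R) : bmf (fun d : R => cos (n * d)).
Proof. by apply: eq_bmf (bmf_cos_affine n 0) => d; rewrite addr0. Qed.

Lemma bmf_cosx : bmf (@cos R).
Proof. by apply: eq_bmf (bmf_cosn 1) => d; rewrite mul1r. Qed.

Lemma bmf_sinn (n : R) : bmf (fun d : R => sin (n * d)).
Proof. by apply: eq_bmf (bmf_sin_affine n 0) => d; rewrite addr0. Qed.

Lemma bmf_sinx : bmf (@sin R).
Proof. by apply: eq_bmf (bmf_sinn 1) => d; rewrite mul1r. Qed.

Lemma tint_cosn (n : nat) : (0 < n)%N -> tint (fun d : R => cos (n%:R * d)) = 0.
Proof.
move=> n0; rewrite -[RHS](@tint_cos R n%:Z 0).
  by apply: eq_tint => d; rewrite addr0.
by rewrite -lt0n.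
Qed.

Lemma dec_coef1 : dec_coef (fun=> 1).
Proof.
move=> n; have E m : tint (fun d : R => 1 * cos (m%:R * d)) = tint (fun d => cos (m%:R * d)).
  by apply: eq_tint => d; rewrite mul1r.
rewrite !E tint_cosn// lexx/=; case: n => [|n]; last by rewrite tint_cosn.
rewrite (eq_tint (g := fun=> 1)); last by move=> d; rewrite mul0r cos0.
by rewrite tint_cst mulr1 mulr_ge0// pi_ge0.
Qed.

Lemma dec_coefZ a g : 0 <= a -> bmf g -> dec_coef g -> dec_coef (fun d => a * g d).
Proof.
move=> a0 bg dg n.
have E m : tint (fun d : R => a * g d * cos (m%:R * d)) = a * tint (fun d => g d * cos (m%:R * d)).
  by rewrite -tintZ; [apply: eq_tint => d; rewrite mulrA|exact: bmfM bg (bmf_cosn _)].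
by have /andP[h1 h2] := dg n; rewrite !E mulr_ge0//= ler_wpM2l.
Qed.

Lemma dec_coefD g1 g2 : bmf g1 -> bmf g2 -> dec_coef g1 -> dec_coef g2 ->
  dec_coef (fun d => g1 d + g2 d).
Proof.
move=> b1 b2 d1 d2 n.
have E m : tint (fun d : R => (g1 d + g2 d) * cos (m%:R * d)) =
    tint (fun d => g1 d * cos (m%:R * d)) + tint (fun d => g2 d * cos (m%:R * d)).
  rewrite -tintD; [|exact: bmfM b1 (bmf_cosn _)|exact: bmfM b2 (bmf_cosn _)].
  by apply: eq_tint => d; rewrite mulrDl.
by have /andP[h1 h2] := d1 n; have /andP[h3 h4] := d2 n; rewrite !E addr_ge0//= lerD.
Qed.

(** With c the coefficients of [g], the new ones are c n + (c (n - 1) + c (n + 1)) / 2, a local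
    average that preserves sign and monotonicity. *)
Lemma dec_coef_onep_cos g : bmf g -> dec_coef g -> dec_coef (fun d => g d * (1 + cos d)).
Proof.
move=> bg dg.
pose c m := tint (fun d : R => g d * cos (m%:R * d)).
have bgc m : bmf (fun d => g d * cos (m * d)) := bmfM bg (bmf_cosn m).
have ES m : tint (fun d : R => g d * (1 + cos d) * cos (m.+1%:R * d)) =
    c m.+1 + 2^-1 * c m + 2^-1 * c m.+2.
  rewrite /c -!tintZ// -!tintD//; try by apply: bmfZ.
    apply: eq_tint => d; rewrite -!(natr1 _.+1) -!(natr1 m) !mulrDl !mul1r.
    rewrite ![cos (_ + _ + _)]cosD !cosD !sinD.
    by have c2 := cos2sin2 d; field: c2.
  by apply: bmfD => //; exact: bmfZ.
(* At frequency 0 the neighbours - 1 and 1 have the same coefficient, so the average reduces to c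
   1. *)
have E0 : tint (fun d : R => g d * (1 + cos d) * cos (0%:R * d)) = c 0 + c 1.
  rewrite /c -tintD//; apply: eq_tint => d; rewrite mul0r cos0 mul1r; ring.
have cd n : 0 <= c n.+1 <= c n := dg n.
have c0 n : 0 <= c n by have /andP[h1 h2] := cd n; exact: le_trans h2.
move=> n; rewrite ES; apply/andP; split.
  by rewrite !addr_ge0// mulr_ge0// invr_ge0.
case: n => [|n]; first by rewrite E0; have := cd 0%N; have := cd 1%N; lra.
by rewrite ES; have := cd n; have := cd n.+1; have := cd n.+2; lra.
Qed.

Lemma dec_coef_lim g : bmf g ->
  (forall e, 0 < e -> exists g', [/\ bmf g', dec_coef g' &
     forall d, `|g d - g' d| <= e]) -> dec_coef g.
Proof.
move=> bg H n; have pi0 := pi_gt0 R.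
have bgc (f : R -> R) (m : R) : bmf f -> bmf (fun d => f d * cos (m * d)) by move=> bf; exact: bmfM bf (bmf_cosn m).
have close e g' : bmf g' -> (forall d, `|g d - g' d| <= e) -> forall m : nat,
    `|tint (fun d => g d * cos (m%:R * d)) - tint (fun d => g' d * cos (m%:R * d))| <= 2 * pi * e.
  move=> bg' gg' m; rewrite -tintB; [|exact: bgc|exact: bgc].
  rewrite -tint_cst; apply: tint_norm_le; [by apply: bmfB; exact: bgc|exact: bmf_cst|].
  move=> d; rewrite -mulrBl normrM (le_trans _ (gg' d))// ler_piMr//.
  by rewrite ler_norml cos_geN1 cos_le1.
apply/andP; split; apply/ler_addgt0Pr => e e0.
  have e'0 : 0 < e / (2 * pi) by rewrite divr_gt0// mulr_gt0.
  have [g' [bg' dg' gg']] := H _ e'0.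
  have := close _ _ bg' gg' n.+1; rewrite ler_norml.
  have -> : 2 * pi * (e / (2 * pi)) = e by field; lra.
  by have := dg' n; lra.
have e'0 : 0 < e / (4 * pi) by rewrite divr_gt0// mulr_gt0.
have [g' [bg' dg' gg']] := H _ e'0.
have := close _ _ bg' gg' n.+1; have := close _ _ bg' gg' n; rewrite !ler_norml.
have -> : 2 * pi * (e / (4 * pi)) = e / 2 by field; lra.
by have := dg' n; lra.
Qed.

(** The terms are nonnegative and nondecreasing in y, so the remainder at y is at most the remainder
    at z. *)
Lemma expR_series_unif (z e : R) : 0 <= z -> 0 < e -> exists M : nat,
  forall y, 0 <= y <= z -> `|expR y - \sum_(k < M) y ^+ k / k`!%:R| <= e.
Proof.
move=> z0 e0.
have /cvgrPdist_le/(_ _ e0) : series (exp_coeff z) @ \oo --> expR z.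
  exact: is_cvg_series_exp_coeff.
move=> [M _ HM]; exists M => y /andP[y0 yz].
have SE t : \sum_(k < M) t ^+ k / k`!%:R = series (exp_coeff t) M.
  by rewrite /series/= big_mkord.
have tail t (N : nat) : (M <= N)%N -> series (exp_coeff t) N - series (exp_coeff t) M =
    \sum_(M <= k < N) t ^+ k / k`!%:R.
  by move=> MN; rewrite sub_series_geq.
have lim_ge t a : (\forall N \near \oo, a <= series (exp_coeff t) N) -> a <= expR t.
  by move=> H; apply: limr_ge => //; exact: is_cvg_series_exp_coeff.
have lim_le t a : (\forall N \near \oo, series (exp_coeff t) N <= a) -> expR t <= a.
  by move=> H; apply: limr_le => //; exact: is_cvg_series_exp_coeff.
rewrite SE ger0_norm; last first.
  rewrite subr_ge0; apply: lim_ge; near=> N.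
  rewrite -subr_ge0 tail; last by near: N; exact: nbhs_infty_ge.
  by apply: sumr_ge0 => k _; rewrite divr_ge0// exprn_ge0.
rewrite lerBlDr.
have zM : expR z <= e + series (exp_coeff z) M.
  by have := HM M (leqnn _); rewrite /= => /(le_trans (ler_norm _)); rewrite lerBlDr.
apply: lim_le; near=> N; rewrite -lerBlDr.
have MN : (M <= N)%N by near: N; exact: nbhs_infty_ge.
rewrite tail//; apply: (@le_trans _ _ (\sum_(M <= k < N) z ^+ k / k`!%:R)).
  by apply: ler_sum => k _; rewrite ler_wpM2r ?invr_ge0// lerXn2r.
rewrite -tail// lerBlDr; apply: le_trans zM.
apply: lim_ge; near=> N'.
rewrite -subr_ge0 sub_series_geq; last by near: N'; exact: nbhs_infty_ge.
by apply: sumr_ge0 => k _; rewrite exp_coeff_ge0.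
Unshelve. all: by end_near. Qed.

Lemma onep_cos_bounds (d : R) : 0 <= 1 + cos d <= 2.
Proof. by have := cos_geN1 d; have := cos_le1 d; lra. Qed.

(** The partial sums of the exponential series are nonnegative combinations of powers of 1 + cos,
    and their convergence is uniform since 1 + cos stays in [0, 2]. *)
Lemma dec_coef_exp (z : R) : 0 <= z -> dec_coef (fun d => expR (z * (1 + cos d))).
Proof.
move=> z0.
have b1c : bmf (fun d : R => 1 + cos d) := bmfD (bmf_cst 1) bmf_cosx.
apply: dec_coef_lim.
  apply: (bmf_expR_le (B := z * 2)); first exact: (bmfZ _ b1c).1.
  by move=> d; rewrite ler_wpM2l//; have /andP[] := onep_cos_bounds d.
move=> e e0.
have [M HM] := expR_series_unif (mulr_ge0 z0 (ler0n R 2)) e0.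
exists (fun d => \sum_(k < M) (z ^+ k / k`!%:R) * (1 + cos d) ^+ k).
have bX k : bmf (fun d : R => (1 + cos d) ^+ k) by exact: bmfX.
have dX k : dec_coef (fun d : R => (1 + cos d) ^+ k).
  elim: k => [|k IH].
    rewrite (_ : (fun _ => _) = fun=> 1); first exact: dec_coef1.
    by apply/funext => d; rewrite expr0.
  rewrite (_ : (fun _ => _) = fun d => (1 + cos d) ^+ k * (1 + cos d)).
    exact: dec_coef_onep_cos.
  by apply/funext => d; rewrite exprSr.
split.
- by apply: bmf_sum => k _; exact: bmfZ.
- elim: M {HM} => [|M IH].
    rewrite (_ : (fun _ => _) = fun d => 0 * 1); last first.
      by apply/funext => d; rewrite big_ord0 mul0r.
    by apply: dec_coefZ => //; [exact: bmf_cst|exact: dec_coef1].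
  rewrite (_ : (fun _ => _) = (fun d => \sum_(k < M) (z ^+ k / k`!%:R) * (1 + cos d) ^+ k +
     (z ^+ M / M`!%:R) * (1 + cos d) ^+ M)); last first.
    by apply/funext => d; rewrite big_ord_recr.
  apply: dec_coefD => //.
  + by apply: bmf_sum => k _; exact: bmfZ.
  + exact: bmfZ.
  + by apply: dec_coefZ => //; rewrite divr_ge0// exprn_ge0.
- move=> d; have zd : 0 <= z * (1 + cos d) <= z * 2.
    by have /andP[h1 h2] := onep_cos_bounds d; rewrite mulr_ge0//= ler_wpM2l.
  have := HM _ zd; congr (`|_ - _| <= _); apply: eq_bigr => k _.
  by rewrite exprMn mulrAC.
Qed.
End cosine_coefficients.

(** * The eigenvalues of the kernel: recurrence, monotonicity, decay, first-order expansion *)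

Section xy_kernel.
Context (R : realType).

(** For an antiderivative F of an odd function, F x - F (- x) has derivative 0, so its increment
    over the period, twice the integral, vanishes. *)
Lemma tint_odd (f : R -> R) : continuous f -> (forall x, f (- x) = - f x) -> tint f = 0.
Proof.
move=> cf of_; have pi0 := pi_gt0 R.
have [F dF] := antiderivative_local (2 * pi) cf.
have pie : - pi < pi :> R by lra.
have E : tint f = F pi - F (- pi).
  by apply: (FTC_local pie cf) => x x1; apply: dF; lra.
have : tint (fun _ : R => 0 : R) = (F pi - F (- pi)) - (F (- pi) - F (- - pi)).
  apply: (FTC_local (F := fun x => F x - F (- x)) pie); first by move=> z; exact: cvg_cst.
  move=> x x1; apply: der_eq (derB (dF x _) (der_comp (dF (- x) _) (derN (der_id x)))) _; try lra.
  by rewrite of_; lra.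
by rewrite opprK tint_cst mulr0 E => H; lra.
Qed.

Definition xyk (z d : R) : R := expR (- (z * (1 - cos d))).
Definition xymass (z : R) : R := tint (xyk z).
Definition xyK (z d : R) : R := xyk z d / xymass z.
Definition lam (z : R) (n : int) : R := tint (fun d => xyK z d * cos (n%:~R * d)).

Context (z : R) (z0 : 0 < z).

Lemma onem_cos_ge0 (d : R) : 0 <= 1 - cos d.
Proof. by rewrite subr_ge0 cos_le1. Qed.

Lemma onem_cos_le2 (d : R) : 1 - cos d <= 2.
Proof. by have := cos_geN1 d; lra. Qed.

Lemma xyk_gt0 d : 0 < xyk z d. Proof. exact: expR_gt0. Qed.

Lemma continuous_xyk : continuous (xyk z).
Proof.
move=> d; apply: (@continuous_comp _ _ _ (fun d => - (z * (1 - cos d))) expR).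
  apply: cvgN; apply: cvgM; first exact: cvg_cst.
  by apply: cvgB; [exact: cvg_cst|exact: continuous_cos].
exact: continuous_expR.
Qed.

Lemma xyk_le1 d : xyk z d <= 1.
Proof. by rewrite -expR0 ler_expR oppr_le0 mulr_ge0 ?onem_cos_ge0// ltW. Qed.

Lemma bmf_xyk : bmf (xyk z).
Proof.
apply: (continuous_bmf (B := 1)); first exact: continuous_xyk.
by move=> d; rewrite gtr0_norm ?xyk_gt0// xyk_le1.
Qed.

Lemma xymass_gt0 : 0 < xymass z.
Proof.
apply: (@lt_le_trans _ _ (tint (fun _ : R => expR (- (z * 2))))).
  by rewrite tint_cst !mulr_gt0 ?pi_gt0// expR_gt0.
apply: le_tint => [||d]; [exact: bmf_cst|exact: bmf_xyk|].
by rewrite ler_expR lerN2 ler_pM2l// onem_cos_le2.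
Qed.

Lemma xyK_gt0 d : 0 < xyK z d.
Proof. by rewrite divr_gt0 ?xyk_gt0 ?xymass_gt0. Qed.

Lemma xyK_ge0 d : 0 <= xyK z d. Proof. exact: ltW (xyK_gt0 d). Qed.

Lemma continuous_xyK : continuous (xyK z).
Proof. by move=> d; apply: cvgM; [exact: continuous_xyk|exact: cvg_cst]. Qed.

Lemma bmf_xyK : bmf (xyK z).
Proof. exact: bmfM bmf_xyk (bmf_cst _). Qed.

Lemma xyK_periodic d : xyK z (d + 2 * pi) = xyK z d.
Proof. by rewrite /xyK /xyk -[2 * pi](mulr1 (2 * pi)) (cosD2pi_int d 1). Qed.

Lemma xyKN d : xyK z (- d) = xyK z d.
Proof. by rewrite /xyK /xyk cosN. Qed.

Lemma tint_xyK : tint (xyK z) = 1.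
Proof. by rewrite /xyK tintZr ?divff ?gt_eqF ?xymass_gt0//; exact: bmf_xyk. Qed.

Lemma tint_xyK_sin (n : R) : tint (fun d => xyK z d * sin (n * d)) = 0.
Proof.
apply: tint_odd => [x|x]; last by rewrite xyKN mulrN sinN mulrN.
apply: cvgM; first exact: continuous_xyK.
by apply: continuous_sin_comp => y; apply: cvgM; [exact: cvg_cst|exact: cvg_id].
Qed.

(** The kernel is even, so after the shift by x the sine half of the addition formula integrates to
    0 and cosines are eigenfunctions. *)
Lemma lam_eigen (n : int) (x c : R) :
  tint (fun y => xyK z (y - x) * cos (n%:~R * y + c)) = lam z n * cos (n%:~R * x + c).
Proof.
rewrite -(@tint_shift _ (fun y => xyK z (y - x) * cos (n%:~R * y + c)) x); first last.
- move=> y; rewrite addrAC xyK_periodic; congr (_ * _).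
  rewrite -[RHS](cosD2pi_int _ n); congr (cos _); ring.
- move=> y; apply: cvgM.
    by apply: (@continuous_comp _ _ _ (fun y => y - x) (xyK z)); [apply: cvgB; [exact: cvg_id|exact: cvg_cst]|exact: continuous_xyK].
  exact: (continuous_cos_comp (@continuous_affine _ _ _)).
transitivity (tint (fun y => xyK z y * cos (n%:~R * y) * cos (n%:~R * x + c) -
   xyK z y * sin (n%:~R * y) * sin (n%:~R * x + c))).
  apply: eq_tint => y; rewrite addrK.
  have -> : n%:~R * (y + x) + c = n%:~R * y + (n%:~R * x + c) by ring.
  by rewrite cosD; ring.
have bc := bmfM bmf_xyK (bmf_cosn n%:~R); have bs := bmfM bmf_xyK (bmf_sinn n%:~R).
rewrite tintB ?tintZr ?tint_xyK_sin ?mul0r ?subr0//; exact: bmfM (bmf_cst _).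
Qed.

(** The kernel has logarithmic derivative - z sin, and the boundary terms cancel because it is even
    and G agrees at the two ends. The recurrence and the moment identities below are all
    instances. *)
Lemma xy_ibp (G dG : R -> R) : continuous dG -> bmf dG -> bmf G ->
  (forall x : R, is_derive x 1 G (dG x)) -> G (- pi) = G pi ->
  tint (fun d => xyK z d * dG d) = z * tint (fun d => xyK z d * (G d * sin d)).
Proof.
move=> cdG bdG bG dGd Gpi.
have cG : continuous G by move=> x; exact: der_continuous (dGd x).
have dk (x : R) : is_derive x 1 (xyK z) (- z * (xyK z x * sin x)).
  rewrite /xyK /xyk.
  apply: der_eq (derM (der_expR (derN (derM (der_cst x z) (derB (der_cst x 1) (der_cos (der_id x)))))) (der_cst x (xymass z)^-1)) _.
  by ring.
have bKG : bmf (fun d => xyK z d * (G d * sin d)) := bmfM bmf_xyK (bmfM bG (@bmf_sinx R)).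
rewrite -tintZ//; apply/eqP; rewrite -subr_eq0 -tintB; [|exact: bmfM bmf_xyK bdG|exact: bmfZ].
have dKG (x : R) : is_derive x 1 (fun d => xyK z d * G d)
    (xyK z x * dG x - z * (xyK z x * (G x * sin x))).
  by apply: der_eq (derM (dk x) (dGd x)) _; ring.
rewrite (tint_derive _ dKG); first by rewrite Gpi xyKN subrr.
move=> x; apply: cvgB.
  by apply: cvgM; [exact: continuous_xyK|exact: cdG].
apply: cvgM; first exact: cvg_cst.
apply: cvgM; first exact: continuous_xyK.
by apply: cvgM; [exact: cG|exact: continuous_sin].
Qed.

Lemma lam0 : lam z 0 = 1.
Proof. by rewrite -tint_xyK; apply: eq_tint => d; rewrite mul0r cos0 mulr1. Qed.

Lemma lamN n : lam z (- n) = lam z n.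
Proof. by apply: eq_tint => d; rewrite mulrNz mulNr cosN. Qed.

Lemma lam_abs n : lam z n = lam z `|n|%N.
Proof. by case: n => // n; rewrite NegzE lamN. Qed.

(** Up to the positive factor exp (- 2 z) / mass, the kernel is exp (z (1 + cos d)), to which
    [dec_coef_exp] applies. *)
Lemma lam_dec (n : nat) : 0 <= lam z n.+1 <= lam z n.
Proof.
have b : bmf (fun d : R => expR (z * (1 + cos d))).
  apply: (bmf_expR_le (B := z * 2)); first exact: (bmfZ _ (bmfD (bmf_cst 1) (@bmf_cosx R))).1.
  by move=> d; rewrite ler_wpM2l ?(ltW z0)//; have /andP[] := onep_cos_bounds d.
have a0 : 0 <= expR (- (2 * z)) / xymass z.
  by rewrite divr_ge0 ?expR_ge0// ltW// xymass_gt0.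
have := dec_coefZ a0 b (dec_coef_exp (ltW z0)) n.
have E m : tint (fun d : R => expR (- (2 * z)) / xymass z * expR (z * (1 + cos d)) * cos (m%:R * d)) = lam z m.
  apply: eq_tint => d; congr (_ * _); rewrite mulrAC -expRD; congr (expR _ / _); ring.
by rewrite !E.
Qed.

Lemma lam_nat_ge0 (n : nat) : 0 <= lam z n.
Proof. by have /andP[h1 h2] := lam_dec n; exact: le_trans h2. Qed.

Lemma lam_ge0 n : 0 <= lam z n.
Proof. by rewrite lam_abs lam_nat_ge0. Qed.

Lemma lam_nonincr (m n : nat) : (m <= n)%N -> lam z n <= lam z m.
Proof.
move=> /subnK <-; elim: (n - m)%N => [|k IH]; first by rewrite add0n.
by rewrite addSn (le_trans _ IH)//; have /andP[] := lam_dec (k + m).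
Qed.

Lemma lam_le1 n : lam z n <= 1.
Proof. by rewrite lam_abs -lam0 lam_nonincr. Qed.

(** The three-term recurrence of the modified Bessel functions, obtained from [xy_ibp] with G = sin
    (n d). *)
Lemma lam_rec (n : int) : 2 * n%:~R * lam z n = z * (lam z (n - 1) - lam z (n + 1)).
Proof.
have nz := sinD2pi_int 0 n.
have H := @xy_ibp (fun d => sin (n%:~R * d)) (fun d => n%:~R * cos (n%:~R * d)).
rewrite -mulrA -tintZ; last exact: bmfM bmf_xyK (bmf_cosn _).
rewrite (eq_tint (g := fun d => xyK z d * (n%:~R * cos (n%:~R * d)))); last by move=> d; rewrite mulrCA.
have bl m := bmfM bmf_xyK (bmf_cosn m%:~R).
have dS (x : R) : is_derive x 1 (fun d : R => sin (n%:~R * d)) (n%:~R * cos (n%:~R * x)).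
  apply: der_eq (der_sin (derM (der_cst x _) (der_id x))) _.
  by rewrite mulr0 addr0 mulr1 mulrC.
rewrite (H _ _ _ dS).
- rewrite /lam -tintB// mulrCA; congr (_ * _).
  rewrite -tintZ; last exact: bmfM bmf_xyK (bmfM (bmf_sinn _) (@bmf_sinx R)).
  apply: eq_tint => d; rewrite intrB intrD mulr1z (mulrBl d) (mulrDl _ _ d) mul1r cosB cosD; ring.
- by move=> x; apply: cvgM; [exact: cvg_cst|apply: continuous_cos_comp => y; apply: cvgM; [exact: cvg_cst|exact: cvg_id]].
- exact: bmfZ (bmf_cosn _).
- exact: bmf_sinn.
- rewrite -[LHS](sinD2pi_int _ n); congr (sin _); ring.
Qed.

(** In the recurrence at n + 1 the factor n + 1 is bounded below by 1 and lam (n + 1) by lam (n +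
    2). The rate 2 / z is of order 1 / N, hence of order 1 after N steps. *)
Lemma lam_decay (n : nat) : lam z n.+2 * (1 + 2 / z) <= lam z n.
Proof.
have e1 : n.+1%:Z - 1 = n%:Z by rewrite -addn1 PoszD addrK.
have e2 : n.+1%:Z + 1 = n.+2%:Z by rewrite -PoszD addn1.
have := lam_rec n.+1%:Z; rewrite e1 e2.
move=> H; have /andP[h1 h2] := lam_dec n.+1.
have : 2 * lam z n.+2 <= z * (lam z n - lam z n.+2).
  rewrite -H -mulrA ler_pM2l// (le_trans h2)// ler_peMl ?lam_nat_ge0//.
  by rewrite ler1n.
have -> : lam z n.+2 * (1 + 2 / z) = lam z n.+2 + (2 * lam z n.+2) / z by field; rewrite gt_eqF.
move=> h; rewrite -lerBrDl ler_pdivrMr//. lra.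
Qed.

(** With e k the k-th moment of 1 - cos, [xy_ibp] for G = sin times (1 - cos)^k links e k, e (k +
    1), e (k + 2). The case k = 0 gives e 1 up to e 2; the next two cases serve to show that e 2 is
    of order z^-2. *)
Lemma lam1_bound : `|lam z 1 - (1 - 1 / (2 * z))| <= 10 / z ^+ 2.
Proof.
pose u (d : R) := 1 - cos d.
have bu : bmf u := bmfB (bmf_cst 1) (@bmf_cosx R).
have cu : continuous u by move=> x; apply: cvgB; [exact: cvg_cst|exact: continuous_cos].
have du (x : R) : is_derive x 1 u (sin x).
  by apply: der_eq (derB (der_cst x 1) (der_cos (der_id x))) _; ring.
pose e k := tint (fun d => xyK z d * u d ^+ k).
have bK k : bmf (fun d => xyK z d * u d ^+ k) := bmfM bmf_xyK (bmfX k bu).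
have e0 : e 0%N = 1 by rewrite -tint_xyK; apply: eq_tint => d; rewrite expr0 mulr1.
have ege k : 0 <= e k.
  by apply: tint_ge0 => d; rewrite mulr_ge0 ?xyK_ge0// exprn_ge0// onem_cos_ge0.
have cX k : continuous (fun d => u d ^+ k) by move=> x; apply: (@continuous_comp _ _ _ u (fun y => y ^+ k)); [exact: cu|exact: exprn_continuous].
have comb (a b : R) k l : tint (fun d => xyK z d * (a * u d ^+ k + b * u d ^+ l)) = a * e k + b * e l.
  rewrite /e -!tintZ// -tintD; [|exact: bmfZ|exact: bmfZ].
  by apply: eq_tint => d; ring.
have s2 (d : R) : sin d ^+ 2 = u d * (2 - u d) by rewrite sin2cos2 /u; ring.
have bG k : bmf (fun d : R => sin d * u d ^+ k) := bmfM (@bmf_sinx R) (bmfX k bu).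
have Gpi k : sin (- pi) * u (- pi) ^+ k = sin pi * u pi ^+ k :> R by rewrite sinN sinpi oppr0 !mul0r.
have ccomb (a b : R) k l : continuous (fun d => a * u d ^+ k + b * u d ^+ l).
  by move=> x; apply: cvgD; (apply: cvgM; [exact: cvg_cst|exact: cX]).
have bcomb (a b : R) k l : bmf (fun d => a * u d ^+ k + b * u d ^+ l).
  by apply: bmfD; apply: bmfZ; exact: bmfX.
have I0 : 1 * e 0%N + -1 * e 1%N = z * (2 * e 1%N + -1 * e 2%N).
  have dG (x : R) : is_derive x 1 (fun d => sin d * u d ^+ 0) (1 * u x ^+ 0 + -1 * u x ^+ 1).
    by apply: der_eq (derM (der_sin (der_id x)) (der_cst x 1)) _; rewrite /u; ring.
  rewrite -!comb (xy_ibp _ _ _ dG) //.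
  by congr (_ * _); apply: eq_tint => d; rewrite expr0 mulr1 -expr2 s2; ring.
have I1 : 3 * e 1%N + -2 * e 2%N = z * (2 * e 2%N + -1 * e 3%N).
  have dG (x : R) : is_derive x 1 (fun d => sin d * u d ^+ 1) (3 * u x ^+ 1 + -2 * u x ^+ 2).
    apply: der_eq (derM (der_sin (der_id x)) (du x)) _.
    by have h := sin2cos2 x; rewrite /u /=; ring: h.
  rewrite -!comb (xy_ibp _ _ _ dG) //.
  by congr (_ * _); apply: eq_tint => d; have h := s2 d; ring: h.
have I2 : 5 * e 2%N + -3 * e 3%N = z * (2 * e 3%N + -1 * e 4%N).
  have dG (x : R) : is_derive x 1 (fun d => sin d * u d ^+ 2) (5 * u x ^+ 2 + -3 * u x ^+ 3).
    apply: der_eq (derM (der_sin (der_id x)) (derM (du x) (du x))) _.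
    by have h := sin2cos2 x; rewrite /u /=; ring: h.
  rewrite -!comb (xy_ibp _ _ _ dG) //.
  by congr (_ * _); apply: eq_tint => d; have h := s2 d; ring: h.
have pos k : 0 <= 2 * e k + -1 * e k.+1.
  rewrite -comb; apply: tint_ge0 => d; rewrite mulr_ge0 ?xyK_ge0//.
  rewrite (_ : _ + _ = u d ^+ k * (2 - u d)); last by rewrite exprS; ring.
  by rewrite mulr_ge0 ?exprn_ge0 ?onem_cos_ge0// subr_ge0 onem_cos_le2.
have lam1 : lam z 1 = 1 - e 1%N.
  have <- : 1 * e 0%N + -1 * e 1%N = 1 - e 1%N by rewrite e0; ring.
  rewrite -comb; apply: eq_tint => d; congr (_ * _).
  have -> : 1%:~R * d = d by rewrite mulr1z mul1r.
  by rewrite /u; ring.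
have p1 := pos 1%N; have p2 := pos 2%N; have p3 := pos 3%N.
have q1 := ege 1%N; have q2 := ege 2%N; have q3 := ege 3%N.
(* Each bound reads a sign off the right-hand side of one identity, starting from the highest
   moment; the conclusions are z e 1 <= 2 and z^2 e 2 <= 18. *)
have h3 : 3 * e 3%N <= 5 * e 2%N by have := mulr_ge0 (ltW z0) p3; rewrite -I2; lra.
have h2 : 2 * e 2%N <= 3 * e 1%N by have := mulr_ge0 (ltW z0) p2; rewrite -I1; lra.
have h1 : z * e 1%N <= 2.
  have : z * (e 1%N / 2) <= z * (2 * e 1%N + -1 * e 2%N) by rewrite ler_pM2l//; lra.
  by rewrite -I0 e0; lra.
have h4 : z * e 2%N <= 9 * e 1%N.
  have : z * (e 2%N / 3) <= z * (2 * e 2%N + -1 * e 3%N) by rewrite ler_pM2l//; lra.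
  by rewrite -I1; lra.
have h5 : z * (z * e 2%N) <= 18.
  by have : z * (z * e 2%N) <= z * (9 * e 1%N) by [rewrite ler_pM2l|]; lra.
have z2 : 0 < z ^+ 2 by rewrite exprn_gt0.
(* Times z^2 the error equals (z e 1 - z^2 e 2) / 2 by [I0], a number between - 9 and 1; the
   constant 10 leaves room. *)
rewrite lam1 ler_pdivlMr// -(ger0_norm (ltW z2)) -normrM.
rewrite (_ : _ * z ^+ 2 = (z * e 1%N - z * (z * e 2%N)) / 2).
  by rewrite ler_norml; have := mulr_ge0 (ltW z0) (mulr_ge0 (ltW z0) q2); have := mulr_ge0 (ltW z0) q1; lra.
rewrite e0 in I0.
have -> : (1 - e 1%N - (1 - 1 / (2 * z))) * z ^+ 2 = z / 2 - z * (z * e 1%N) by field; rewrite gt_eqF.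
have : z * (1 * 1 + -1 * e 1%N) = z * (z * (2 * e 1%N + -1 * e 2%N)) by rewrite I0.
lra.
Qed.
End xy_kernel.

(** * Limits and uniform bounds for powers of the eigenvalues *)

Section eigenvalue_asymptotics.
Context (R : realType).

Lemma expRN_lip (x y : R) : 0 <= x -> 0 <= y -> `|expR (- x) - expR (- y)| <= `|x - y|.
Proof.
wlog xy : x y / x <= y.
  move=> H x0 y0; have [xy|/ltW xy] := leP x y; first exact: H.
  by rewrite distrC [leRHS]distrC; apply: H.
move=> x0 y0; rewrite [leRHS]distrC !ger0_norm ?subr_ge0 ?ler_expR ?lerN2//.
have -> : expR (- x) - expR (- y) = expR (- x) * (1 - expR (- (y - x))).
  by rewrite mulrBr mulr1 -expRD; congr (_ - expR _); ring.
apply: (@le_trans _ _ (1 - expR (- (y - x)))).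
  rewrite ler_piMl//; first by rewrite subr_ge0 -expR0 ler_expR; lra.
  by rewrite -expR0 ler_expR; lra.
by have := expR_ge1Dx (- (y - x)); lra.
Qed.

(** The upper half follows from exp (- x) (1 + x) <= 1 and (1 - x + x^2) (1 + x) = 1 + x^3 >= 1. *)
Lemma expRN_taylor (x : R) : 0 <= x -> `|expR (- x) - (1 - x)| <= x ^+ 2.
Proof.
move=> x0; rewrite ger0_norm; last by have := expR_ge1Dx (- x); lra.
have h : expR (- x) * (1 + x) <= 1.
  rewrite -[leRHS](expRxMexpNx_1 x) mulrC ler_wpM2r ?expR_ge0//.
  exact: expR_ge1Dx.
have : expR (- x) <= 1 - x + x ^+ 2.
  have x1 : 0 < 1 + x by lra.
  rewrite -(ler_pM2r x1) (le_trans h)//.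
  have : 0 <= x ^+ 3 by rewrite exprn_ge0.
  by rewrite (_ : (1 - x + x ^+ 2) * (1 + x) = 1 + x ^+ 3); [lra|ring].
lra.
Qed.

Lemma pow_dist (a b : R) n : 0 <= a <= 1 -> 0 <= b <= 1 ->
  `|a ^+ n - b ^+ n| <= n%:R * `|a - b|.
Proof.
move=> /andP[a0 a1] /andP[b0 b1]; elim: n => [|n IH].
  by rewrite !expr0 subrr normr0 mul0r.
have -> : a ^+ n.+1 - b ^+ n.+1 = a * (a ^+ n - b ^+ n) + (a - b) * b ^+ n.
  by rewrite !exprS; ring.
rewrite (le_trans (ler_normD _ _))// -natr1 [leRHS]mulrDl mul1r !normrM.
apply: lerD.
  by rewrite (le_trans _ IH)// ler_piMl// ger0_norm.
by rewrite ler_piMr// ger0_norm ?exprn_ge0// exprn_ile1.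
Qed.

(** Two-step induction along [lam_rec] from the frequencies 0 and 1; the leading terms match because
    (n + 2)^2 = n^2 + 4 (n + 1). *)
Lemma lam_asymp (n : nat) : exists2 C : R, 0 <= C & forall z, 1 <= z ->
  `|lam z n - (1 - n%:R ^+ 2 / (2 * z))| <= C / z ^+ 2.
Proof.
pose P n := exists2 C : R, 0 <= C & forall z, 1 <= z ->
  `|lam z n%:Z - (1 - n%:R ^+ 2 / (2 * z))| <= C / z ^+ 2.
suff : P n /\ P n.+1 by case.
elim: n => [|n [[C C0 HC] [D D0 HD]]].
  split.
    exists 0 => // z z1; rewrite lam0; last lra.
    by rewrite expr0n/= !mul0r subr0 subrr normr0.
  by exists 10 => // z z1; rewrite expr1n; apply: lam1_bound; lra.
split; first by exists D.
exists (C + 2 * n.+1%:R * (D + n.+1%:R ^+ 2)).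
  by rewrite addr_ge0// !mulr_ge0// addr_ge0// sqr_ge0.
move=> z z1; have z0 : 0 < z by lra.
have e1 : n.+1%:Z - 1 = n%:Z by rewrite -addn1 PoszD addrK.
have e2 : n.+1%:Z + 1 = n.+2%:Z by rewrite -PoszD addn1.
have := lam_rec z0 n.+1%:Z; rewrite e1 e2 => rec.
have -> : lam z n.+2%:Z = lam z n%:Z - 2 * n.+1%:R / z * lam z n.+1%:Z.
  have : (z * lam z n.+2) / z = (z * lam z n - 2 * n.+1%:R * lam z n.+1) / z.
    by congr (_ / z); move: rec; lra.
  rewrite [z * _]mulrC mulfK ?gt_eqF// => ->.
  by field; rewrite gt_eqF.
have -> : lam z n - 2 * n.+1%:R / z * lam z n.+1 - (1 - n.+2%:R ^+ 2 / (2 * z)) =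
   (lam z n - (1 - n%:R ^+ 2 / (2 * z))) -
   2 * n.+1%:R / z * (lam z n.+1 - (1 - n.+1%:R ^+ 2 / (2 * z)) - n.+1%:R ^+ 2 / (2 * z)).
  by rewrite -(natr1 n.+1) -(natr1 n); field; rewrite gt_eqF.
apply: le_trans (ler_normB _ _) _.
rewrite [leRHS]mulrDl; apply: lerD; first exact: HC.
rewrite normrM [`|2 * _ / _|]ger0_norm; last by rewrite divr_ge0 ?mulr_ge0// ltW.
have -> : 2 * n.+1%:R * (D + n.+1%:R ^+ 2) / z ^+ 2 = 2 * n.+1%:R / z * ((D + n.+1%:R ^+ 2) / z).
  by field; rewrite gt_eqF.
apply: ler_wpM2l; first by rewrite divr_ge0 ?mulr_ge0// ltW.
apply: le_trans (ler_normB _ _) _; rewrite [leRHS]mulrDl; apply: lerD.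
  apply: le_trans (HD z z1) _; rewrite ler_wpM2l// lef_pV2 ?posrE ?exprn_gt0//.
  by rewrite expr2 ler_peMr// ltW.
rewrite ger0_norm; last by rewrite divr_ge0 ?sqr_ge0 ?mulr_ge0// ltW.
by rewrite ler_wpM2l ?sqr_ge0// lef_pV2 ?posrE ?mulr_gt0//; lra.
Qed.

Context (kap : R) (kap0 : 0 < kap).

Lemma near_mul_ge (a b : R) : 0 < a -> exists N0, forall N, (N0 <= N)%N -> b <= a * N%:R.
Proof.
move=> a0; exists (Num.truncn (b / a)).+1 => N NN.
rewrite mulrC -ler_pdivrMr//; apply: le_trans (ltW (truncnS_gt _)) _.
by rewrite ler_nat.
Qed.

(** An error of order N^-2 for one step remains of order 1 / N after at most N steps. *)
Lemma lam_gap (n : nat) : exists2 C : R, 0 <= C & exists N0 : nat, forall N, (N0 <= N)%N ->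
  `|lam (kap * N%:R) n - expR (- (n%:R ^+ 2 / (2 * kap * N%:R)))| <= C / N%:R ^+ 2.
Proof.
have [C C0 HC] := lam_asymp n.
exists (C / kap ^+ 2 + (n%:R ^+ 2 / (2 * kap)) ^+ 2).
  by rewrite addr_ge0 ?sqr_ge0// divr_ge0// sqr_ge0.
have [N0 HN0] := near_mul_ge 1 kap0.
exists N0 => N /HN0 N1.
have N0' : 0 < N%:R :> R.
  by rewrite -(ltr_pM2l kap0) mulr0; lra.
set x := n%:R ^+ 2 / (2 * kap * N%:R).
have x0 : 0 <= x by rewrite divr_ge0 ?sqr_ge0// !mulr_ge0// ltW.
have -> : lam (kap * N%:R) n - expR (- x) =
  (lam (kap * N%:R) n - (1 - n%:R ^+ 2 / (2 * (kap * N%:R)))) - (expR (- x) - (1 - x)).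
  by rewrite /x mulrA; ring.
apply: le_trans (ler_normB _ _) _; rewrite [leRHS]mulrDl; apply: lerD.
  apply: le_trans (HC _ N1) _.
  by rewrite exprMn invfM mulrA.
apply: le_trans (expRN_taylor x0) _.
by rewrite /x invfM mulrA exprMn exprVn.
Qed.

(** The tolerance 2 is set by the middle segment of an edge: [k - j] approximates (s - t) N with the
    errors of two sites, each at most 1. *)
Lemma lam_pow_cvg (n : int) (e : R) : 0 < e -> exists N0 : nat, forall N, (N0 <= N)%N ->
  forall (j : nat) (t : R), (j <= N)%N -> 0 <= t -> `|t * N%:R - j%:R| <= 2 ->
  `|lam (kap * N%:R) n ^+ j - expR (- (n%:~R ^+ 2 * t / (2 * kap)))| <= e.
Proof.
move=> e0; pose m := `|n|%N.
have nm : n%:~R ^+ 2 = m%:R ^+ 2 :> R.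
  by rewrite /m; case: (n) => k //; rewrite NegzE mulrNz sqrrN.
have [C C0 [N1 HC]] := lam_gap m.
have k20 : 0 < 2 * kap by rewrite mulr_gt0.
pose c := m%:R ^+ 2 / (2 * kap).
have c0 : 0 <= c by rewrite divr_ge0 ?sqr_ge0// ltW.
have [N2 HN2] := near_mul_ge (C + 2 * c) e0.
exists (maxn 1 (maxn N1 N2)) => N; rewrite !geq_max => /and3P[N0 NN1 NN2] j t jN t0 tj.
have Np : 0 < N%:R :> R by rewrite ltr0n.
have z0 : 0 < kap * N%:R by rewrite mulr_gt0.
rewrite lam_abs// -/m nm.
pose a := lam (kap * N%:R) m; pose b := expR (- (c / N%:R)).
have b01 : 0 <= b <= 1 by rewrite expR_ge0 -expR0 ler_expR oppr_le0 divr_ge0// ltW.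
have a01 : 0 <= a <= 1 by rewrite lam_ge0// lam_le1.
have ab : `|a - b| <= C / N%:R ^+ 2.
  rewrite /b (_ : c / N%:R = m%:R ^+ 2 / (2 * kap * N%:R)); first exact: HC.
  by rewrite /c -mulrA -invfM.
have abj : `|a ^+ j - b ^+ j| <= C / N%:R.
  apply: le_trans (pow_dist j a01 b01) _.
  apply: (@le_trans _ _ (N%:R * (C / N%:R ^+ 2))).
    by apply: ler_pM => //; rewrite ler_nat.
  by rewrite le_eqVlt; apply/orP; left; apply/eqP; field; rewrite gt_eqF.
have bt : `|b ^+ j - expR (- (c * t))| <= 2 * c / N%:R.
  rewrite /b -expRM_natl.
  have -> : j%:R * - (c / N%:R) = - (c * (j%:R / N%:R)) by ring.
  apply: le_trans (expRN_lip _ _) _.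
  - by rewrite mulr_ge0// divr_ge0.
  - by rewrite mulr_ge0.
  have -> : 2 * c / N%:R = c * (2 / N%:R) by ring.
  rewrite -mulrBr normrM (ger0_norm c0) ler_wpM2l//.
  rewrite distrC ler_pdivlMr// -[X in _ * X](gtr0_norm Np) -normrM.
  by rewrite mulrBl divfK ?gt_eqF.
have -> : m%:R ^+ 2 * t / (2 * kap) = c * t by rewrite /c mulrAC.
have -> : a ^+ j - expR (- (c * t)) = (a ^+ j - b ^+ j) + (b ^+ j - expR (- (c * t))) by ring.
apply: le_trans (ler_normD _ _) _; apply: le_trans (lerD abj bt) _.
by rewrite -mulrDl ler_pdivrMr//; exact: HN2.
Qed.

Definition decay_rate : R := (1 + 2 / kap)^-1.

Lemma decay_rate_bounds : 0 < decay_rate < 1.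
Proof.
have h : 0 < 2 / kap by rewrite divr_gt0.
by rewrite /decay_rate invr_gt0 invf_lt1; lra.
Qed.

(** [lam_decay] is applied n./2 times, and Bernoulli's inequality (1 + y)^N >= 1 + N y with y = 2 /
    (kap N) makes the N-th power of the rate independent of N. *)
Lemma lam_pow_le (n N : nat) : (0 < N)%N ->
  lam (kap * N%:R) n ^+ N <= decay_rate ^+ n./2.
Proof.
move=> N0; have Np : 0 < N%:R :> R by rewrite ltr0n.
have z0 : 0 < kap * N%:R by rewrite mulr_gt0.
have k0 : 0 < 1 + 2 / kap by have := divr_gt0 (ltr0n R 2) kap0; lra.
pose rho := (1 + 2 / (kap * N%:R))^-1.
have h : 0 <= 2 / (kap * N%:R) by rewrite divr_ge0// ltW.
have rho0 : 0 <= rho by rewrite invr_ge0; lra.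
have step m : lam (kap * N%:R) m.+2 <= lam (kap * N%:R) m * rho.
  by rewrite ler_pdivlMr; [exact: lam_decay|lra].
have pw k m : (k <= m./2)%N -> lam (kap * N%:R) m <= rho ^+ k.
  elim: k m => [|k IH] m; first by rewrite expr0 lam_le1.
  case: m => [|[|m]]//=; rewrite ltnS => /IH H.
  by apply: le_trans (step m) _; rewrite exprSr ler_wpM2r.
have rhoN : rho ^+ N <= decay_rate.
  rewrite /rho /decay_rate exprVn lef_pV2 ?posrE ?exprn_gt0//; last lra.
  have -> : 2 / kap = 2 / (kap * N%:R) * N%:R by field; rewrite !gt_eqF.
  move: h; move: (2 / (kap * N%:R)) => y y0; clear -y0.
  elim: N => [|N IH]; first by rewrite mulr0 addr0 expr0.
  rewrite exprS -natr1; apply: (@le_trans _ _ ((1 + y) * (1 + y * N%:R))).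
    have : 0 <= y * (y * N%:R) by rewrite !mulr_ge0.
    by lra.
  by rewrite ler_wpM2l//; lra.
apply: (@le_trans _ _ ((rho ^+ n./2) ^+ N)).
  by rewrite lerXn2r ?nnegrE ?lam_ge0 ?exprn_ge0// pw.
by rewrite -exprM mulnC exprM lerXn2r ?nnegrE ?exprn_ge0// ltW//; have /andP[] := decay_rate_bounds.
Qed.

(** The limit coefficients obey the same geometric bound: exp (2 / kap) >= 1 + 2 / kap, and 4 (m./2)
    <= m^2. *)
Lemma gauss_le (m : nat) (x : R) : m%:R ^+ 2 <= x -> expR (- (x / (2 * kap))) <= decay_rate ^+ m./2.
Proof.
move=> mx; have h : 0 < 2 / kap by rewrite divr_gt0.
rewrite /decay_rate exprVn expRN lef_pV2 ?posrE ?expR_gt0 ?exprn_gt0//; last lra.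
apply: (@le_trans _ _ (expR (2 / kap) ^+ m./2)).
  by rewrite lerXn2r ?nnegrE ?expR_ge0 ?expR_ge1Dx//; lra.
rewrite -expRM_natl ler_expR.
have -> : x / (2 * kap) = (x / 4) * (2 / kap) by field; rewrite gt_eqF.
rewrite ler_pM2r// ler_pdivlMr//; apply: le_trans mx.
rewrite -natrX -(natrM _ _ 4) ler_nat.
case: m => [|[|m]]//; rewrite -{2}(odd_double_half m.+2).
set k := _./2; have : (0 < k)%N by [].
by move: (odd _) => o; rewrite -muln2; case: o => /=; nia.
Qed.

End eigenvalue_asymptotics.

(** * Dominated convergence for series, uniformly in parameters *)

Section dominated_sums.
Context (R : realType).

(** The admissible parameters may depend on N, as the sites do. The dominating tail beyond M0 costs
    e / 2, and the M0 first terms are made small one by one. *)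
Lemma sum_dominated_unif (X : Type) (valid : nat -> X -> Prop) (D : nat -> R)
    (S : R) (f : nat -> X -> nat -> R) :
  (forall n, 0 <= D n) -> (forall M, \sum_(n < M) D n <= S) ->
  (forall N x n, valid N x -> `|f N x n| <= D n) ->
  (forall n (e : R), 0 < e -> exists N0, forall N, (N0 <= N)%N -> forall x, valid N x -> `|f N x n| <= e) ->
  forall e : R, 0 < e -> exists N0, forall N, (N0 <= N)%N -> forall x, valid N x ->
    forall M, \sum_(n < M) `|f N x n| <= e.
Proof.
move=> D0 DS fD fc e e0.
have Dle (M M' : nat) : (M <= M')%N -> \sum_(n < M) D n <= \sum_(n < M') D n.
  move=> MM; rewrite -!(big_mkord xpredT) (big_cat_nat _ MM)//= lerDl.
  by apply: sumr_ge0.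
have [M0 HM0] : exists M0 : nat, forall M, (M0 <= M)%N -> \sum_(M0 <= n < M) D n <= e / 2.
  (* Only bounded partial sums are known: an index whose partial sum is within e / 2 of the supremum
     has a small tail. *)
  pose u (M : nat) := \sum_(n < M) D n.
  have hs : has_sup (range u).
    split; first by exists (u 0%N), 0%N.
    by exists S => _ [M _ <-]; exact: DS.
  have e2 : 0 < e / 2 by lra.
  have [_ [M0 _ <-] h] := sup_adherent e2 hs.
  exists M0 => M MM; have : u M <= sup (range u).
    by apply: ub_le_sup; [exact: hs.2|exists M].
  rewrite /u -!(big_mkord xpredT D) in h *; rewrite (big_cat_nat _ MM)//=; lra.
have e' : 0 < e / (2 * M0.+1%:R) by rewrite divr_gt0// mulr_gt0.
have [N0 HN0] : exists N0, forall N, (N0 <= N)%N -> forall x, valid N x ->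
    forall n, (n < M0)%N -> `|f N x n| <= e / (2 * M0.+1%:R).
  elim: M0 {HM0} (e / _) e' => [|M0 IH] d d0; first by exists 0%N.
  have [N1 H1] := IH d d0; have [N2 H2] := fc M0 d d0.
  exists (maxn N1 N2) => N; rewrite geq_max => /andP[h1 h2] x vx n.
  by rewrite ltnS leq_eqVlt => /predU1P[->|h]; [exact: H2|exact: H1].
exists N0 => N NN x vx M.
apply: (@le_trans _ _ (\sum_(n < maxn M0 M) `|f N x n|)).
  rewrite -!(big_mkord xpredT (fun n => `|f N x n|)) (big_cat_nat _ (leq_maxr M0 M))//= lerDl.
  by apply: sumr_ge0.
rewrite -(big_mkord xpredT (fun n => `|f N x n|)) (big_cat_nat _ (leq_maxl M0 M))//=.
have -> : e = e / 2 + e / 2 by lra.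
apply: lerD; last first.
  apply: le_trans (HM0 _ (leq_maxl _ _)); apply: ler_sum => n _; exact: fD.
apply: (@le_trans _ _ (\sum_(0 <= n < M0) e / (2 * M0.+1%:R))).
  rewrite !big_mkord; apply: ler_sum => n _; exact: HN0.
rewrite big_mkord sumr_const card_ord -[_ *+ M0]mulr_natr.
have Mp : 0 < M0.+1%:R :> R by rewrite ltr0n.
rewrite -mulrA ler_pM2l// invfM -mulrA ler_piMr ?invr_ge0//.
by rewrite mulrC ler_pdivrMr// mul1r ler_nat.
Qed.

Lemma geom_half_sum (r : R) M : 0 < r < 1 -> \sum_(n < M) r ^+ n./2 <= 2 / (1 - r).
Proof.
move=> /andP[r0 r1].
have geo K : \sum_(n < K) r ^+ n <= 1 / (1 - r).
  rewrite ler_pdivlMr; last lra.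
  have -> : (\sum_(n < K) r ^+ n) * (1 - r) = 1 - r ^+ K.
    elim: K => [|K IH]; first by rewrite big_ord0 mul0r expr0 subrr.
    by rewrite big_ord_recr/= mulrDl IH exprS; ring.
  by rewrite gerBl exprn_ge0// ltW.
apply: (@le_trans _ _ (\sum_(n < M.*2) r ^+ n./2)).
  have MM : (M <= M.*2)%N by rewrite -addnn leq_addl.
  rewrite -!(big_mkord xpredT (fun n => r ^+ n./2)) (big_cat_nat _ MM)//= lerDl.
  by apply: sumr_ge0 => n _; rewrite exprn_ge0// ltW.
have -> : \sum_(n < M.*2) r ^+ n./2 = 2 * \sum_(n < M) r ^+ n.
  elim: M => [|M IH]; first by rewrite !big_ord0 mulr0.
  rewrite doubleS !big_ord_recr/= IH doubleK -[uphalf _]/(M.*2.+1./2) /= uphalf_double; ring.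
by have := geo M; lra.
Qed.

(** Truncated subtraction sends the first c indices to 0, which accounts for the extra c copies of g
    0. *)
Lemma shifted_sum_le (g : nat -> R) (S : R) c M : (forall n, 0 <= g n) ->
  (forall M, \sum_(n < M) g n <= S) ->
  \sum_(n < M) g (n - c)%N <= c%:R * g 0%N + S.
Proof.
move=> g0 gS; elim: c M => [|c IH] M.
  by rewrite mul0r add0r (le_trans _ (gS M))// ler_sum// => i _; rewrite subn0.
case: M => [|M].
  by rewrite big_ord0 addr_ge0 ?mulr_ge0// (le_trans _ (gS 0%N))// big_ord0.
rewrite big_ord_recl/= sub0n -natr1 mulrDl mul1r.
rewrite (eq_bigr (fun i : 'I_M => g (i - c)%N)); last by move=> i _; rewrite /bump /= add1n subSS.
by have := IH M; lra.
Qed.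

End dominated_sums.

(** * Fourier coefficients of the weight of an edge and their limits *)

Section coefficient_convergence.
Context (R : realType) (kap : R) (kap0 : 0 < kap) (p q : int).

(** Integrated from its end, the path carries the frequency n down to site k, n + q down to site j,
    and n + p + q below; every step contributes one eigenvalue. *)
Definition xy_coef (N j k : nat) (n : int) : R :=
  lam (kap * N%:R) (n + p + q) ^+ j * lam (kap * N%:R) (n + q) ^+ (k - j) *
  lam (kap * N%:R) n ^+ (N - k).

Definition vil_coef (t s : R) (n : int) : R :=
  expR (- (((n + p + q)%:~R ^+ 2 * t + (n + q)%:~R ^+ 2 * (s - t) +
     n%:~R ^+ 2 * (1 - s)) / (2 * kap))).

Record site_data := SiteData { sd_j : nat; sd_k : nat; sd_t : R; sd_s : R }.

(** The tolerance 1 admits both ends of the small segment that contains the point. *)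
Definition site_valid (N : nat) (x : site_data) : Prop :=
  [/\ (0 < N)%N, (sd_j x <= sd_k x <= N)%N, 0 <= sd_t x <= sd_s x /\ sd_s x <= 1,
      `|sd_t x * N%:R - (sd_j x)%:R| <= 1 & `|sd_s x * N%:R - (sd_k x)%:R| <= 1].

Lemma coef_cvg (n : int) (e : R) : 0 < e -> exists N0, forall N, (N0 <= N)%N ->
  forall x, site_valid N x ->
  `|xy_coef N (sd_j x) (sd_k x) n - vil_coef (sd_t x) (sd_s x) n| <= e.
Proof.
move=> e0; have e3 : 0 < e / 3 by lra.
have [N1 H1] := lam_pow_cvg kap0 (n + p + q) e3.
have [N2 H2] := lam_pow_cvg kap0 (n + q) e3.
have [N3 H3] := lam_pow_cvg kap0 n e3.
exists (maxn N1 (maxn N2 N3)) => N; rewrite !geq_max => /and3P[h1 h2 h3].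
move=> [j k t s] [/= N0 /andP[jk kN] [/andP[t0 ts] s1] tj sk].
have z0 : 0 < kap * N%:R by rewrite mulr_gt0// ltr0n.
have a1 := H1 N h1 j t (leq_trans jk kN) t0 (le_trans tj (ler1n _ 2)).
have a2 : _ := H2 N h2 (k - j)%N (s - t) (leq_trans (leq_subr _ _) kN).
have {}a2 : `|lam (kap * N%:R) (n + q) ^+ (k - j) - expR (- ((n + q)%:~R ^+ 2 * (s - t) / (2 * kap)))| <= e / 3.
  apply: a2; first lra.
  rewrite natrB// (_ : _ - _ = (s * N%:R - k%:R) - (t * N%:R - j%:R)); last ring.
  by apply: le_trans (ler_normB _ _) _; rewrite (_ : 2 = 1 + 1) ?lerD.
have {H3} a3 : `|lam (kap * N%:R) n ^+ (N - k) - expR (- (n%:~R ^+ 2 * (1 - s) / (2 * kap)))| <= e / 3.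
  apply: H3 => //; [exact: leq_subr|lra|].
  rewrite natrB// (_ : _ - _ = k%:R - s * N%:R); last ring.
  by rewrite distrC (le_trans sk)// ler1n.
have b01 (x y : R) : 0 <= x -> 0 <= y -> 0 <= expR (- (x * y / (2 * kap))) <= 1.
  by move=> x0 y0; rewrite expR_ge0 -expR0 ler_expR oppr_le0 divr_ge0// mulr_ge0// ltW.
have c01 (m : int) i : 0 <= lam (kap * N%:R) m ^+ i <= 1.
  by rewrite exprn_ge0 ?lam_ge0// exprn_ile1 ?lam_ge0 ?lam_le1.
rewrite /xy_coef /= (_ : vil_coef t s n = expR (- ((n + p + q)%:~R ^+ 2 * t / (2 * kap))) *
  expR (- ((n + q)%:~R ^+ 2 * (s - t) / (2 * kap))) * expR (- (n%:~R ^+ 2 * (1 - s) / (2 * kap)))); last first.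
  by rewrite -!expRD /vil_coef; congr expR; ring.
have st0 : 0 <= s - t by lra.
have os0 : 0 <= 1 - s by lra.
move: (c01 (n + p + q) j) (c01 (n + q) (k - j)%N) (c01 n (N - k)%N) a1 a2 a3.
move: (b01 _ _ (sqr_ge0 (n + p + q)%:~R) t0) (b01 _ _ (sqr_ge0 (n + q)%:~R) st0) (b01 _ _ (sqr_ge0 n%:~R) os0).
move: (lam _ (n + p + q) ^+ j) => A1; move: (lam _ (n + q) ^+ (k - j)) => A2.
move: (lam _ n ^+ (N - k)) => A3.
move: (expR (- ((n + p + q)%:~R ^+ 2 * t / (2 * kap)))) => B1.
move: (expR (- ((n + q)%:~R ^+ 2 * (s - t) / (2 * kap)))) => B2.
move: (expR (- (n%:~R ^+ 2 * (1 - s) / (2 * kap)))) => B3.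
move=> /andP[y3' y3''] /andP[y2' y2''] /andP[y1' y1''] /andP[x1 x1'] /andP[x2 x2'] /andP[x3 x3'] a1 a2 a3.
have -> : A1 * A2 * A3 - B1 * B2 * B3 = (A1 - B1) * (A2 * A3) + (A2 - B2) * (B1 * A3) + (A3 - B3) * (B1 * B2) by ring.
have -> : e = e / 3 + e / 3 + e / 3 by lra.
have le1 (a b c : R) : 0 <= b <= 1 -> 0 <= c <= 1 -> `|a * (b * c)| <= `|a|.
  move=> /andP[b0 b1] /andP[c0 c1]; rewrite normrM ler_piMr// ger0_norm ?mulr_ge0//.
  by rewrite mulr_ile1.
apply: le_trans (ler_normD _ _) _; apply: lerD.
  apply: le_trans (ler_normD _ _) _; apply: lerD.
    by apply: le_trans a1; apply: le1; apply/andP.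
  by apply: le_trans a2; apply: le1; apply/andP.
by apply: le_trans a3; apply: le1; apply/andP.
Qed.

(** All three frequencies have modulus at least |n| - |p| - |q|. As the exponents add up to N, and
    the lengths t, s - t, 1 - s to 1, both coefficients are bounded as if this were the frequency on
    the whole edge. *)
Lemma coef_dom (n : int) N x : site_valid N x ->
  `|xy_coef N (sd_j x) (sd_k x) n - vil_coef (sd_t x) (sd_s x) n| <=
  decay_rate kap ^+ (`|n| - (`|p| + `|q|))./2.
Proof.
case: x => j k t s [/= N0 /andP[jk kN] [/andP[t0 ts] s1] tj sk].
have z0 : 0 < kap * N%:R by rewrite mulr_gt0// ltr0n.
set m := (_ - _)%N; set D := _ ^+ _.
have lamle (i : int) : (m <= `|i|)%N -> lam (kap * N%:R) i <= lam (kap * N%:R) m.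
  by move=> mi; rewrite lam_abs// lam_nonincr.
have m1 : (m <= `|(n + p + q)%R|)%N by rewrite /m; lia.
have m2 : (m <= `|(n + q)%R|)%N by rewrite /m; lia.
have m3 : (m <= `|n|)%N by rewrite /m; lia.
have a0 : 0 <= xy_coef N j k n by rewrite !mulr_ge0// exprn_ge0// lam_ge0.
have aD : xy_coef N j k n <= D.
  apply: le_trans (lam_pow_le kap0 m N0).
  have -> : N = (j + (k - j) + (N - k))%N :> nat by lia.
  rewrite !exprD (_ : (j + (k - j) + (N - k))%N = N); last lia.
  have pw i l : (m <= `|i|)%N -> lam (kap * N%:R) i ^+ l <= lam (kap * N%:R) m ^+ l.
    by move=> mi; rewrite lerXn2r ?nnegrE ?lam_ge0 ?lamle.
  by rewrite !ler_pM ?mulr_ge0 ?exprn_ge0 ?lam_ge0 ?pw.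
have sqle (i : int) : (m <= `|i|)%N -> m%:R ^+ 2 <= i%:~R ^+ 2 :> R.
  move=> mi; have -> : i%:~R ^+ 2 = `|i|%N%:R ^+ 2 :> R.
    by case: (i) => l //; rewrite NegzE mulrNz sqrrN.
  by rewrite lerXn2r ?nnegrE// ler_nat.
have bD : vil_coef t s n <= D.
  apply: gauss_le => //.
  have -> : m%:R ^+ 2 = m%:R ^+ 2 * t + m%:R ^+ 2 * (s - t) + m%:R ^+ 2 * (1 - s) :> R by ring.
  by rewrite !lerD// ler_wpM2r ?sqle//; lra.
have b0 : 0 <= vil_coef t s n by exact: expR_ge0.
by rewrite ler_norml; lra.
Qed.

(** The frequencies n and - n are grouped because a cosine coefficient of the edge function involves
    both; frequency 0 is counted twice, harmlessly. *)
Lemma coef_sum_cvg (e : R) : 0 < e -> exists N0, forall N, (N0 <= N)%N ->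
  forall x, site_valid N x -> forall M,
  \sum_(n < M) (`|xy_coef N (sd_j x) (sd_k x) n%:Z - vil_coef (sd_t x) (sd_s x) n%:Z| +
    `|xy_coef N (sd_j x) (sd_k x) (- n%:Z) - vil_coef (sd_t x) (sd_s x) (- n%:Z)|) <= e.
Proof.
move=> e0.
pose f N x (n : nat) := (`|xy_coef N (sd_j x) (sd_k x) n%:Z - vil_coef (sd_t x) (sd_s x) n%:Z| +
    `|xy_coef N (sd_j x) (sd_k x) (- n%:Z) - vil_coef (sd_t x) (sd_s x) (- n%:Z)|).
pose c := (`|p| + `|q|)%N.
pose g (n : nat) := decay_rate kap ^+ n./2 + decay_rate kap ^+ n./2.
have /andP[r0 r1] := decay_rate_bounds kap0.
have g0 n : 0 <= g n by rewrite addr_ge0// exprn_ge0// ltW.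
have gS M : \sum_(n < M) g n <= 4 / (1 - decay_rate kap).
  have := geom_half_sum M (decay_rate_bounds kap0).
  by rewrite /g big_split/=; lra.
have [||||N0 H] := @sum_dominated_unif R site_data site_valid (fun n => g (n - c)%N)
   (c%:R * g 0%N + 4 / (1 - decay_rate kap)) f _ _ _ _ e e0.
- by move=> n; exact: g0.
- by move=> M; exact: shifted_sum_le.
- move=> N x n vx; rewrite /f ger0_norm ?addr_ge0//; apply: lerD.
    exact: (coef_dom n%:Z vx).
  by have := coef_dom (- n%:Z) vx; rewrite abszN.
- move=> n e1 e10; have e2 : 0 < e1 / 2 by lra.
  have [N1 H1] := coef_cvg n%:Z e2; have [N2 H2] := coef_cvg (- n%:Z) e2.
  exists (maxn N1 N2) => N; rewrite geq_max => /andP[h1 h2] x vx.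
  by rewrite /f ger0_norm ?addr_ge0//; have := H1 N h1 x vx; have := H2 N h2 x vx; lra.
exists N0 => N NN x vx M; apply: le_trans (H N NN x vx M).
by apply: ler_sum => n _; exact: ler_norm.
Qed.

End coefficient_convergence.

(** * Iterated integrals *)

Section parametric_integral.
Context (R : realType).
Local Notation mu := (@lebesgue_measure R).
Local Notation D := (`[- pi, pi]%classic : set R).

(** Tonelli's theorem is applied over the whole line, so the restriction to the period becomes an
    indicator. *)
Lemma tint_posE (h : R -> R) : bmf h -> (forall x, 0 <= h x) ->
  ((tint h)%:E = \int[mu]_y (h y * \1_D y)%:E)%E.
Proof.
move=> bh h0.
have hE : (\int[mu]_(y in D) (h y)%:E)%E = (\int[mu]_y (h y * \1_D y)%:E)%E.
  rewrite integral_mkcond; apply: eq_integral => y _; rewrite patchE indicE.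
  by case: (y \in D); rewrite ?mulr1 ?mulr0.
rewrite -hE /tint /Rintegral fineK//.
exact: integrable_fin_num (tint_integrable bh).
Qed.

Section param.
Context d (T : measurableType d) (f : T * R -> R).
Hypothesis bf : bmf f.

Let bf' : @bmf R _ (T * measurableTypeR R)%type f := bf.

Lemma bmf_sectionl (x : T) : bmf (fun y : R => f (x, y)).
Proof. by apply: (bmf_comp (h := fun y : R => (x, y))) bf; exact: measurable_fun_pair. Qed.

Lemma bmf_tint_param : bmf (fun x => tint (fun y => f (x, y))).
Proof.
have [mf [B fB]] := bf'; have pi0 := pi_gt0 R.
have B0 : 0 <= B by rewrite (le_trans _ (fB (point, 0))).
split; last first.
  exists (2 * pi * B) => x; rewrite -tint_cst.
  by apply: tint_norm_le; [exact: bmf_sectionl|exact: bmf_cst|move=> y; exact: fB].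
(* Adding the bound B makes the integrand nonnegative, as Tonelli requires; the constant 2 pi B is
   subtracted afterwards. *)
pose g (z : T * measurableTypeR R) := ((f z + B) * \1_D z.2)%:E.
have g0 z : (0 <= g z)%E.
  rewrite lee_fin mulr_ge0//; have := fB z; rewrite ler_norml; lra.
have mg : measurable_fun setT g.
  apply/measurable_EFinP; apply: measurable_funM; first by apply: measurable_funD.
  have mi : measurable_fun setT (\1_D : measurableTypeR R -> R) by exact: measurable_indic.
  exact: (measurableT_comp mi measurable_snd).
have mF := measurable_fun_fubini_tonelli_F (m2 := mu) g mg g0.
have E : (fun x => tint (fun y => f (x, y))) = fun x => fine (\int[mu]_y g (x, y)) - 2 * pi * B.
  apply/funext => x; rewrite -tint_cst.
  have bx := bmf_sectionl x.
  have h0 y : 0 <= f (x, y) + B by have := fB (x, y); rewrite ler_norml; lra.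
  have bh : bmf (fun y => f (x, y) + B) := bmfD bx (bmf_cst B).
  rewrite -(tint_posE bh h0) /= (tintD bx (bmf_cst B)); ring.
rewrite E; apply: measurable_funB; last exact: measurable_cst.
exact: (measurableT_comp (fine_measurable (@measurableT _ _)) mF).
Qed.
End param.

Lemma tint_swap (f : R * R -> R) : bmf f ->
  tint (fun x => tint (fun y => f (x, y))) = tint (fun y => tint (fun x => f (x, y))).
Proof.
move=> bf; have bf' : @bmf R _ (measurableTypeR R * measurableTypeR R)%type f := bf.
have [mf [B fB]] := bf'.
have bsw : bmf (fun z : R * R => f (z.2, z.1)).
  by apply: (bmf_comp (h := fun z : R * R => (z.2, z.1))) bf; exact: measurable_fun_pair.
have bl x : bmf (fun y => f (x, y)) := bmf_sectionl bf x.
have br y : bmf (fun x => f (x, y)) := bmf_sectionl bsw y.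
have bil : bmf (fun x => tint (fun y => f (x, y))) := bmf_tint_param bf.
have bir : bmf (fun y => tint (fun x => f (x, y))) := bmf_tint_param bsw.
(* The same shift by B reduces the exchange of signed integrals to the nonnegative case. *)
pose h z := f z + B.
have h0 z : 0 <= h z by have := fB z; rewrite /h ler_norml; lra.
have blh x : bmf (fun y => h (x, y)) := bmfD (bl x) (bmf_cst B).
have brh y : bmf (fun x => h (x, y)) := bmfD (br y) (bmf_cst B).
have El x : tint (fun y => h (x, y)) = tint (fun y => f (x, y)) + 2 * pi * B.
  by rewrite /h (tintD (bl x) (bmf_cst B)) tint_cst.
have Er y : tint (fun x => h (x, y)) = tint (fun x => f (x, y)) + 2 * pi * B.
  by rewrite /h (tintD (br y) (bmf_cst B)) tint_cst.
suff : tint (fun x => tint (fun y => h (x, y))) = tint (fun y => tint (fun x => h (x, y))).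
  rewrite (eq_tint El) (eq_tint Er).
  by rewrite (tintD bil (bmf_cst _)) (tintD bir (bmf_cst _)) => /addIr.
have bihl : bmf (fun x => tint (fun y => h (x, y))) by rewrite (funext El); exact: bmfD bil (bmf_cst _).
have bihr : bmf (fun y => tint (fun x => h (x, y))) by rewrite (funext Er); exact: bmfD bir (bmf_cst _).
apply: EFin_inj.
rewrite (tint_posE bihl); last by move=> x; exact: tint_ge0.
rewrite (tint_posE bihr); last by move=> x; exact: tint_ge0.
pose H (z : measurableTypeR R * measurableTypeR R) := (h z * \1_D z.2 * \1_D z.1)%:E.
have H0 z : (0 <= H z)%E by rewrite lee_fin !mulr_ge0.
have mH : measurable_fun setT H.
  have mi : measurable_fun setT (\1_D : measurableTypeR R -> R) by exact: measurable_indic.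
  apply/measurable_EFinP; apply: measurable_funM; last exact: (measurableT_comp mi measurable_fst).
  apply: measurable_funM; last exact: (measurableT_comp mi measurable_snd).
  by apply: measurable_funD.
have nn (x : R) : 0 <= (\1_D x : R) by rewrite indicE.
transitivity (\int[mu]_x \int[mu]_y H (x, y))%E.
  apply: eq_integral => x _; rewrite EFinM (tint_posE (blh x) _)//.
  rewrite muleC -ge0_integralZl//=.
  - by apply: eq_integral => y _; rewrite -EFinM mulrC.
  - by apply/measurable_EFinP; apply: measurable_funM; [exact: (blh x).1|exact: measurable_indic].
  - by move=> y _; rewrite lee_fin mulr_ge0.
rewrite (@fubini_tonelli _ _ _ _ R mu mu H mH H0).
apply: eq_integral => y _; rewrite EFinM (tint_posE (brh y) _)//.
rewrite muleC -ge0_integralZl//=.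
- by apply: eq_integral => x _; rewrite /H -EFinM; congr EFin; rewrite /=; ring.
- by apply/measurable_EFinP; apply: measurable_funM; [exact: (brh y).1|exact: measurable_indic].
- by move=> x _; rewrite lee_fin mulr_ge0.
Qed.
End parametric_integral.

Section configurations.
Context (R : realType) (I : finType).
Implicit Types (F G A : (I -> R) -> R) (s : seq I) (c : I -> R).

Definition cylinders : set (set (I -> R)) :=
  [set C | exists i (B : set R), measurable B /\ C = (fun c => c i) @^-1` B].

(** An alias of [I -> R] that carries the sigma-algebra of the coordinates, so that measurability of
    an integral in the remaining angles makes sense. *)
Definition conf : Type := g_sigma_algebraType cylinders.
HB.instance Definition _ := Measurable.on conf.

Definition cbm (F : (I -> R) -> R) : Prop := bmf (F : conf -> R).

Lemma measurable_coord (i : I) : measurable_fun setT (fun c : conf => c i).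
Proof.
move=> _ B mB; rewrite setTI; apply: sub_sigma_algebra.
by exists i, B.
Qed.

(** Joint measurability in the configuration and the new angle is what lets the two-variable Fubini
    lemmas act on one coordinate at a time. *)
Lemma measurable_update (i : I) :
  measurable_fun setT (fun z : conf * R => update z.1 i z.2 : conf).
Proof.
apply: (@measurability _ _ _ conf _ _ cylinders) => // _ [_ [j [B [mB ->]]] <-].
rewrite setTI /preimage /update /=; case: eqP => [ji|ji].
  have : measurable_fun setT (fun z : conf * R => z.2) by exact: measurable_snd.
  by move=> /(_ measurableT B mB); rewrite setTI.
have : measurable_fun setT (fun z : conf * R => z.1 j).
  exact: (measurableT_comp (measurable_coord j) measurable_fst).
by move=> /(_ measurableT B mB); rewrite setTI.
Qed.

Local Notation it := (iterated_seq (@tint R)).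

Lemma cbm_section i c F : cbm F -> bmf (fun x => F (update c i x)).
Proof.
move=> bF; apply: (bmf_sectionl (f := fun z : conf * R => F (update z.1 i z.2)) _ c).
exact: (bmf_comp (measurable_update i) bF).
Qed.

Lemma cbm_tint i F : cbm F -> cbm (fun c => tint (fun x => F (update c i x))).
Proof.
move=> bF; apply: (bmf_tint_param (f := fun z : conf * R => F (update z.1 i z.2))).
exact: (bmf_comp (measurable_update i) bF).
Qed.

Lemma cbm_it s F : cbm F -> cbm (it s F).
Proof. by move=> bF; elim: s => //= i s IH; exact: cbm_tint. Qed.

Lemma eq_it s F G : F =1 G -> it s F =1 it s G.
Proof. by move=> /funext ->. Qed.

Lemma itD s F G c : cbm F -> cbm G -> it s (fun c => F c + G c) c = it s F c + it s G c.
Proof.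
move=> bF bG; elim: s c => //= i s IH c; rewrite -tintD; last 2 first.
- exact: (cbm_section i c (cbm_it s bF)).
- exact: (cbm_section i c (cbm_it s bG)).
by apply: eq_tint => x; exact: IH.
Qed.

Lemma itZ s a F c : cbm F -> it s (fun c => a * F c) c = a * it s F c.
Proof.
move=> bF; elim: s c => //= i s IH c; rewrite -tintZ.
  by apply: eq_tint => x; exact: IH.
exact: (cbm_section i c (cbm_it s bF)).
Qed.

Lemma itB s F G c : cbm F -> cbm G -> it s (fun c => F c - G c) c = it s F c - it s G c.
Proof.
move=> bF bG; rewrite -mulN1r -itZ// -itD//; last exact: bmfZ.
by apply: eq_it => c'; rewrite mulN1r.
Qed.

Lemma it_ge0 s F c : (forall c, 0 <= F c) -> 0 <= it s F c.
Proof. by move=> F0; elim: s c => //= i s IH c; apply: tint_ge0. Qed.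

Lemma le_it s F G c : cbm F -> cbm G -> (forall c, F c <= G c) -> it s F c <= it s G c.
Proof.
move=> bF bG FG; rewrite -subr_ge0 -itB//; apply: it_ge0 => c'.
by rewrite subr_ge0.
Qed.

Lemma it_norm_le s F G c : cbm F -> cbm G -> (forall c, `|F c| <= G c) ->
  `|it s F c| <= it s G c.
Proof.
move=> bF bG FG; rewrite ler_norml; apply/andP; split.
  rewrite -mulN1r -itZ//; apply: le_it => //; first exact: bmfZ.
  by move=> c'; have := FG c'; rewrite ler_norml; lra.
by apply: le_it => // c'; have := FG c'; rewrite ler_norml; lra.
Qed.

Lemma it_cst s a c : it s (fun=> a) c = (2 * pi) ^+ size s * a.
Proof.
elim: s c => [|i s IH] c /=; first by rewrite expr0 mul1r.
by rewrite (eq_tint (fun x => IH _)) tint_cst exprS mulrA.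
Qed.

Lemma it_cat (op : (R -> R) -> R) s1 s2 F c :
  iterated_seq op (s1 ++ s2) F c = iterated_seq op s1 (iterated_seq op s2 F) c.
Proof.
elim: s1 c => //= i s IH c; congr op; apply/funext => x; exact: IH.
Qed.

Lemma updateC c i j x y : i != j ->
  update (update c i x) j y = update (update c j y) i x.
Proof.
move=> ij; apply/funext => k; rewrite /update.
by case: eqP => // ->; rewrite eq_sym (negPf ij).
Qed.

Lemma updateK c i x y : update (update c i x) i y = update c i y.
Proof. by apply/funext => k; rewrite /update; case: eqP. Qed.

Lemma update_id c i : update c i (c i) = c.
Proof. by apply/funext => k; rewrite /update; case: eqP => // ->. Qed.

Lemma update_at c i x : update c i x i = x.
Proof. by rewrite /update eqxx. Qed.

Lemma update_neq c i j x : j != i -> update c i x j = c j.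
Proof. by rewrite /update => /negPf ->. Qed.

Definition indep i F := forall c x, F (update c i x) = F c.

Lemma it_indep s F i : i \in s \/ indep i F -> indep i (it s F).
Proof.
elim: s => [[]//|j s IH] /= H c x; apply: eq_tint => y.
have [->|ij] := eqVneq i j; first by rewrite updateK.
rewrite (updateC _ _ _ ij); apply: IH.
by case: H; [rewrite inE (negPf ij); left|right].
Qed.

Lemma it_pull s A F c : cbm F -> (forall i, i \in s -> indep i A) ->
  it s (fun c => A c * F c) c = A c * it s F c.
Proof.
move=> bF; elim: s c => //= i s IH c iA.
rewrite -tintZ; last exact: (cbm_section i c (cbm_it s bF)).
apply: eq_tint => x; rewrite IH; first by rewrite (iA i) ?mem_head.
by move=> j js; apply: iA; rewrite inE js orbT.
Qed.

Lemma it_swap i j s F c : i != j -> cbm F ->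
  it (i :: j :: s) F c = it (j :: i :: s) F c.
Proof.
move=> ij bF /=; have bs : cbm (it s F) by exact: cbm_it.
pose f (z : R * R) := it s F (update (update c i z.1) j z.2).
have -> : tint (fun x => tint (fun y => it s F (update (update c i x) j y))) =
   tint (fun x => tint (fun y => f (x, y))) by [].
rewrite tint_swap; first by apply: eq_tint => y; apply: eq_tint => x; rewrite /f /= (updateC _ _ _ ij).
apply: (bmf_comp (h := fun z : R * R => update (update c i z.1) j z.2 : conf)) bs.
pose h2 (z : R * R) : conf * R := (update c i z.1, z.2).
have mh2 : measurable_fun setT h2.
  apply: measurable_fun_pair => //.
  pose h1 (z : R * R) : conf * R := (c, z.1).
  apply: (measurableT_comp (measurable_update i) (_ : measurable_fun setT h1)).
  exact: measurable_fun_pair.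
exact: (measurableT_comp (measurable_update j) mh2).
Qed.

(** Serves to move the end angle of an edge from outside its interior sites to the innermost
    position, the order of a path. *)
Lemma it_rot i s F c : i \notin s -> cbm F -> it (i :: s) F c = it (rcons s i) F c.
Proof.
move=> + bF; elim: s c => //= j s IH c; rewrite inE negb_or => /andP[ij si].
have := it_swap s c ij bF => /= ->.
by apply: eq_tint => x; exact: IH.
Qed.
End configurations.

(** * Integrating out the sites of an edge *)

Section lipschitz.
Context (R : realType).

Lemma cos_lip (x y : R) : `|cos x - cos y| <= `|x - y|.
Proof.
wlog xy : x y / x <= y.
  move=> H; have [xy|/ltW xy] := leP x y; first exact: H.
  by rewrite distrC [leRHS]distrC; apply: H.
have dc (u : R) : u \in `]x, y[ -> is_derive u 1 (@cos R) (- sin u).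
  by move=> _; exact: is_derive_cos.
have cc : {within `[x, y], continuous (@cos R)}.
  by apply: continuous_subspaceT; exact: continuous_cos.
have [u _ E] := MVT_segment xy dc cc.
rewrite distrC E normrM normrN distrC ler_piMl//.
by rewrite ler_norml sin_geN1 sin_le1.
Qed.

Lemma xyK_lip (z : R) : 0 < z -> exists2 L, 0 <= L & forall x y, `|xyK z x - xyK z y| <= L * `|x - y|.
Proof.
move=> z0; have m0 := xymass_gt0 z0; exists (z / xymass z).
  by rewrite divr_ge0 ?ltW.
move=> x y; rewrite /xyK -mulrBl normrM (gtr0_norm (_ : 0 < (xymass z)^-1)) ?invr_gt0//.
rewrite mulrAC ler_pM2r ?invr_gt0//.
apply: le_trans (expRN_lip _ _) _.
- by rewrite mulr_ge0 ?onem_cos_ge0// ltW.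
- by rewrite mulr_ge0 ?onem_cos_ge0// ltW.
rewrite -mulrBr normrM (gtr0_norm z0) ler_pM2l// distrC.
by rewrite (_ : _ - _ = cos x - cos y); [exact: cos_lip|ring].
Qed.

Lemma lip_continuous (f : R -> R) (L : R) : (forall x y, `|f x - f y| <= L * `|x - y|) -> continuous f.
Proof.
move=> H x; apply/cvgrPdist_le => /= e e0.
have L1 : 0 < `|L| + 1 by rewrite ltr_wpDl.
near=> y; apply: le_trans (H _ _) _.
apply: (@le_trans _ _ ((`|L| + 1) * `|x - y|)).
  by rewrite ler_wpM2r// (le_trans (ler_norm _))// lerDl.
rewrite mulrC -ler_pdivlMr//; near: y.
by apply: cvgr_dist_le; [exact: cvg_id|rewrite divr_gt0].
Unshelve. all: by end_near. Qed.
End lipschitz.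

Section regular.
Context (R : realType) (I : finType).
Implicit Types (F G : (I -> R) -> R) (s : seq I) (c : I -> R).
Local Notation it := (iterated_seq (@tint R)).

(** A Lipschitz constant common to all coordinates survives integration with an explicit factor,
    which makes the edge function continuous in its end angle, as [fejer_bound] demands. *)
Definition regular F := [/\ cbm F,
  exists L : R, forall c i x y, `|F (update c i x) - F (update c i y)| <= L * `|x - y| &
  forall c i x, F (update c i (x + 2 * pi)) = F (update c i x)].

Lemma regularM F G : regular F -> regular G -> regular (fun c => F c * G c).
Proof.
move=> [bF [L HL] pF] [bG [M HM] pG]; split; [exact: bmfM| |by move=> *; rewrite pF pG].
have [B FB] := bF.2; have [B' GB] := bG.2.
exists (B * M + B' * L) => c i x y.
have -> : F (update c i x) * G (update c i x) - F (update c i y) * G (update c i y) =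
  F (update c i x) * (G (update c i x) - G (update c i y)) +
  G (update c i y) * (F (update c i x) - F (update c i y)) by ring.
apply: le_trans (ler_normD _ _) _; rewrite !normrM mulrDl -!mulrA.
by apply: lerD; apply: ler_pM.
Qed.

Lemma regular_cst a : regular (fun=> a).
Proof.
split; [exact: bmf_cst| |by []].
by exists 0 => c i x y; rewrite subrr normr0 mul0r.
Qed.

Lemma regular_kernel z i j : 0 < z -> i != j -> regular (fun c => xyK z (c i - c j)).
Proof.
move=> z0 ij; have [L L0 HL] := xyK_lip z0; split.
- apply: (bmf_comp (h := fun c : conf R I => c i - c j)) (bmf_xyK z0).
  by apply: measurable_funB; exact: measurable_coord.
- exists L => c k x y; rewrite /update.
  have [ik|ik] := eqVneq i k; have [jk|jk] := eqVneq j k.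
  + by move: ij; rewrite ik jk eqxx.
  + by apply: le_trans (HL _ _) _; rewrite (_ : _ - _ = x - y)//; ring.
  + by apply: le_trans (HL _ _) _; rewrite (_ : _ - _ = - (x - y)) ?normrN//; ring.
  + by rewrite subrr normr0 mulr_ge0.
- move=> c k x; rewrite /update.
  have [ik|ik] := eqVneq i k; have [jk|jk] := eqVneq j k => //.
  + by move: ij; rewrite ik jk eqxx.
  + by rewrite addrAC xyK_periodic.
  + by rewrite -(xyK_periodic z (_ - (_ + _))); congr xyK; ring.
Qed.

(** The frequencies are integers, so that the cosine of the phase is periodic in every angle. *)
Definition phase (P : I -> int) (a : R) c : R := a + \sum_i (P i)%:~R * c i.

Lemma phase_update P a c i x : phase P a (update c i x) = phase P a c + (P i)%:~R * (x - c i).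
Proof.
rewrite /phase (bigD1 i)//= [in RHS](bigD1 i)//= update_at.
rewrite (eq_bigr (fun j => (P j)%:~R * c j)); first by ring.
by move=> j ji; rewrite update_neq.
Qed.

Lemma regular_cos_phase P a : regular (fun c => cos (phase P a c)).
Proof.
split.
- apply: bmf_cos; apply: measurable_funD; first exact: measurable_cst.
  apply: (@measurable_sum _ _ _ _ _ _ (fun i (c : conf R I) => (P i)%:~R * c i)) => i.
  by apply: measurable_funM; [exact: measurable_cst|exact: measurable_coord].
- exists (\sum_i `|(P i)%:~R|) => c i x y.
  apply: le_trans (cos_lip _ _) _; rewrite !phase_update.
  rewrite (_ : _ - _ = (P i)%:~R * (x - y)); last by ring.
  by rewrite normrM ler_wpM2r// (bigD1 i)//= lerDl sumr_ge0.
- move=> c i x; rewrite !phase_update -[RHS](cosD2pi_int _ (P i)); congr (cos _); ring.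
Qed.

Lemma it_lip s F L i c x y : cbm F -> i \notin s ->
  (forall c i x y, `|F (update c i x) - F (update c i y)| <= L * `|x - y|) ->
  `|it s F (update c i x) - it s F (update c i y)| <= (2 * pi) ^+ size s * (L * `|x - y|).
Proof.
move=> bF + HL; elim: s c => [|j s IH] c /=; first by rewrite expr0 mul1r.
rewrite inE negb_or => /andP[ij si].
have b c' : bmf (fun w => it s F (update c' j w)) := cbm_section j c' (cbm_it s bF).
rewrite -tintB// exprS -mulrA -tint_cst; apply: tint_norm_le; [exact: bmfB|exact: bmf_cst|].
by move=> w; rewrite !(updateC _ _ _ ij); exact: IH.
Qed.

Lemma it_periodic s F i c x : i \notin s ->
  (forall c i x, F (update c i (x + 2 * pi)) = F (update c i x)) ->
  it s F (update c i (x + 2 * pi)) = it s F (update c i x).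
Proof.
move=> + pF; elim: s c => [|j s IH] c //=.
rewrite inE negb_or => /andP[ij si].
by apply: eq_tint => w; rewrite !(updateC _ _ _ ij); exact: IH.
Qed.

End regular.

Section path_integral.
Context (R : realType) (I : finType) (z : R) (z0 : 0 < z).
Implicit Types (s : seq I) (c : I -> R) (P : I -> int).
Local Notation it := (iterated_seq (@tint R)).

Fixpoint chain (x0 : I) s c : R :=
  if s is i :: s' then xyK z (c i - c x0) * chain i s' c else 1.

Definition collapse s (v : R) c : I -> R := fun i => if i \in s then v else c i.

(** Each site contributes the eigenvalue at the total frequency from it to the end: once the later
    sites have been collapsed onto it, this is the frequency of its own angle. *)
Fixpoint path_eigenvalue P s : R :=
  if s is i :: s' then lam z (\sum_(l <- i :: s') P l) * path_eigenvalue P s' else 1.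

Lemma phase_collapse P a s v c : uniq s ->
  phase P a (collapse s v c) = (\sum_(l <- s) P l)%:~R * v + phase P a (collapse s 0 c).
Proof.
move=> us; rewrite /phase addrCA; congr (_ + _).
rewrite [LHS](bigID [in s])/= [X in _ = _ + X](bigID [in s])/=.
rewrite [X in _ = _ + (X + _)]big1 => [|i is_]; last by rewrite /collapse is_ mulr0.
rewrite add0r; congr (_ + _); last first.
  by apply: eq_bigr => i /negPf is_; rewrite /collapse is_.
rewrite -(big_uniq _ us) raddf_sum/= mulr_suml big_seq [RHS]big_seq.
by apply: eq_bigr => i is_; rewrite /collapse is_.
Qed.

Lemma regular_chain x0 s : uniq (x0 :: s) -> regular (chain x0 s).
Proof.
elim: s x0 => [|i s IH] x0 /=; first by move=> _; exact: regular_cst.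
rewrite inE negb_or => /andP[/andP[xi xs] us].
apply: regularM; [by apply: regular_kernel; rewrite // eq_sym|exact: IH].
Qed.

(** Induction on the path: the sites after i collapse onto i, leaving a cosine of the angle at i,
    which [lam_eigen] moves to x0. *)
Lemma path_eigen P a x0 s c : uniq (x0 :: s) ->
  it s (fun c => chain x0 s c * cos (phase P a c)) c =
  path_eigenvalue P s * cos (phase P a (collapse s (c x0) c)).
Proof.
elim: s x0 c => [|i s IH] x0 c.
  move=> _ /=; rewrite !mul1r; congr (cos _); congr phase.
cbn [iterated_seq chain path_eigenvalue] => uxis.
have uis : uniq (i :: s) by move: uxis => /andP[].
move: (uxis); rewrite /= inE negb_or => /andP[/andP[xi xs] /andP[is_ us]].
have bG : cbm (fun c => chain i s c * cos (phase P a c)).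
  by have [] := regularM (regular_chain uis) (regular_cos_phase P a).
pose n : int := \sum_(l <- i :: s) P l.
have phE (v : R) : n%:~R * v + phase P a (collapse (i :: s) 0 c) = phase P a (collapse (i :: s) v c).
  by rewrite (phase_collapse P a v c uis).
have -> : \sum_(l <- i :: s) P l = n by [].
transitivity (tint (fun y => xyK z (y - c x0) * cos (n%:~R * y + phase P a (collapse (i :: s) 0 c)) * path_eigenvalue P s)).
  apply: eq_tint => y.
  transitivity (it s (fun c' => xyK z (c' i - c' x0) * (chain i s c' * cos (phase P a c'))) (update c i y)).
    by apply: eq_it => c'; rewrite mulrA.
  rewrite it_pull//; last first.
    by move=> j js c' x; rewrite !update_neq//; apply: contraTneq js => <-.
  rewrite (IH i _ uis) !update_at update_neq// phE.
  have -> : collapse s y (update c i y) = collapse (i :: s) y c.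
    apply/funext => k; rewrite /collapse inE.
    by have [->|ki] := eqVneq k i; rewrite ?update_at ?update_neq//= ?if_same.
  by rewrite -mulrA [cos _ * _]mulrC.
have b : bmf (fun y : R => xyK z (y - c x0) * cos (n%:~R * y + phase P a (collapse (i :: s) 0 c))).
  apply: bmfM; last exact: bmf_cos_affine.
  by apply: (bmf_comp (h := fun y : R => y - c x0)) (bmf_xyK z0); exact: measurable_funB.
rewrite (tintZr _ b).
by rewrite lam_eigen// phE mulrAC.
Qed.
End path_integral.

Section edge_function.
Context (R : realType) (I : finType) (kap : R) (kap0 : 0 < kap).
Context (N : nat) (N0 : (0 < N)%N) (sg : nat -> I).
Context (sg_inj : forall x y, (x <= N)%N -> (y <= N)%N -> sg x = sg y -> x = y).
Context (p q : int) (j k : nat) (jk : (j <= k)%N) (kN : (k <= N)%N).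
Local Notation it := (iterated_seq (@tint R)).
Local Notation z := (kap * N%:R).

Let z0 : 0 < z. Proof. by rewrite mulr_gt0// ltr0n. Qed.

Definition edge_sites := [seq sg x | x <- iota 1 N.-1].
Definition edge_path := [seq sg x | x <- iota 1 N].

(** n is the test frequency in the end angle; the indicators add up when some of the sites j, k, N
    coincide. *)
Definition freq (n : int) (i : I) : int :=
  p * (i == sg j) + q * (i == sg k) + n * (i == sg N).

Definition edge_fun (a : R) (c : I -> R) : R :=
  it edge_sites (fun c => chain z (sg 0) edge_path c * cos (a + p%:~R * c (sg j) + q%:~R * c (sg k))) c.

Lemma phase_freq n a (c : I -> R) :
  phase (freq n) a c = a + p%:~R * c (sg j) + q%:~R * c (sg k) + n%:~R * c (sg N).
Proof.
have S (m : int) x : \sum_i (m * (i == x)%:Z)%:~R * c i = m%:~R * c x :> R.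
  rewrite (bigD1 x)//= eqxx mulr1 big1 ?addr0// => i /negPf ->.
  by rewrite mulr0 mul0r.
rewrite /phase -!S -!addrA -!big_split/=; congr (_ + _); apply: eq_bigr => i _.
by rewrite /freq !intrD; ring.
Qed.

Lemma edge_pathE : edge_path = rcons edge_sites (sg N).
Proof.
rewrite /edge_path /edge_sites.
suff -> : iota 1 N = rcons (iota 1 N.-1) N by rewrite map_rcons.
by case: (N) N0 => // M _; have := iotaD 1 M 1; rewrite addn1 cats1 add1n.
Qed.

Lemma uniq_edge_path : uniq (sg 0 :: edge_path).
Proof.
rewrite -[_ :: _]/(map sg (iota 0 N.+1)) map_inj_in_uniq ?iota_uniq//.
by move=> x y; rewrite !mem_iota !add0n !ltnS => /andP[_ xN] /andP[_ yN]; exact: sg_inj.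
Qed.

Lemma edge_sites_last : sg N \notin edge_sites.
Proof.
by have := uniq_edge_path; rewrite edge_pathE /= rcons_uniq => /and3P[].
Qed.

Lemma sum_iota_eq (x m l : nat) : \sum_(i <- iota m l) (i == x)%:Z = (m <= x < m + l)%N%:Z.
Proof.
elim: l m => [|l IH] m; first by rewrite big_nil addn0; lia.
rewrite big_cons IH.
by have [->|mx] := eqVneq m x; lia.
Qed.

Lemma path_eigenvalue_iota P m l : path_eigenvalue z P [seq sg x | x <- iota m l] =
  \prod_(i <- iota m l) lam z (\sum_(x <- iota i (m + l - i)) P (sg x)).
Proof.
elim: l m => [|l IH] m; first by rewrite big_nil.
rewrite -[iota m l.+1]/(m :: iota m.+1 l) map_cons big_cons.
cbn [path_eigenvalue]; rewrite IH; congr (lam z _ * _).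
  by rewrite -map_cons big_map addKn.
by rewrite -addSnnS.
Qed.

Lemma freq_sum n i : (0 < i <= N)%N ->
  \sum_(x <- iota i (1 + N - i)) freq n (sg x) = p * (i <= j)%N + q * (i <= k)%N + n.
Proof.
move=> /andP[i0 iN].
transitivity (\sum_(x <- iota i (1 + N - i)) (p * (x == j)%:Z + q * (x == k)%:Z + n * (x == N)%:Z)).
  rewrite big_seq [RHS]big_seq; apply: eq_bigr => x; rewrite mem_iota => xi.
  have xN : (x <= N)%N by lia.
  have E y : (y <= N)%N -> (sg x == sg y) = (x == y).
    by move=> yN; apply/eqP/eqP => [/sg_inj->|->].
  by rewrite /freq !E// (leq_trans jk).
rewrite !big_split /= -!mulr_sumr !sum_iota_eq.
have -> : (i <= j < i + (1 + N - i))%N = (i <= j)%N by lia.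
have -> : (i <= k < i + (1 + N - i))%N = (i <= k)%N by lia.
have -> : (i <= N < i + (1 + N - i))%N = true by lia.
by rewrite mulr1.
Qed.

Lemma prod_iota_cst (f : nat -> R) m l a : (forall i, (m <= i < m + l)%N -> f i = a) ->
  \prod_(i <- iota m l) f i = a ^+ l.
Proof.
elim: l m => [|l IH] m H; first by rewrite big_nil expr0.
rewrite big_cons exprS H ?IH//; last by lia.
by move=> i mi; apply: H; lia.
Qed.

Lemma path_eigenvalue_freq n :
  path_eigenvalue z (freq n) edge_path = xy_coef kap p q N j k n.
Proof.
rewrite path_eigenvalue_iota.
transitivity (\prod_(i <- iota 1 N) lam z (p * (i <= j)%N + q * (i <= k)%N + n)).
  rewrite big_seq [RHS]big_seq; apply: eq_bigr => i; rewrite mem_iota => iN.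
  by rewrite freq_sum//; lia.
have -> : iota 1 N = iota 1 j ++ iota (1 + j) (k - j) ++ iota (1 + k) (N - k).
  have {1}-> : N = (j + ((k - j) + (N - k)))%N by lia.
  by rewrite !iotaD; congr (_ ++ (_ ++ iota _ _)); lia.
rewrite !big_cat/= /xy_coef mulrA; congr (_ * _ * _); apply: prod_iota_cst => i ij.
- have -> : (i <= j)%N by lia.
  have -> : (i <= k)%N by lia.
  by rewrite !mulr1 addrC addrA.
- have -> : (i <= j)%N = false by lia.
  have -> : (i <= k)%N by lia.
  by rewrite mulr0 mulr1 add0r addrC.
- have -> : (i <= j)%N = false by lia.
  have -> : (i <= k)%N = false by lia.
  by rewrite !mulr0 !add0r.
Qed.

Lemma regular_edge_integrand n a :
  regular (fun c => chain z (sg 0) edge_path c * cos (phase (freq n) a c)).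
Proof.
by apply: regularM; [exact/(regular_chain z0)/uniq_edge_path|exact: regular_cos_phase].
Qed.

Lemma edge_funE a c : edge_fun a c =
  it edge_sites (fun c => chain z (sg 0) edge_path c * cos (phase (freq 0) a c)) c.
Proof.
by apply: eq_it => c'; rewrite phase_freq mul0r addr0.
Qed.

Lemma edge_integral n a c :
  it edge_path (fun c => chain z (sg 0) edge_path c * cos (phase (freq n) a c)) c =
  xy_coef kap p q N j k n * cos ((n + p + q)%:~R * c (sg 0) + a).
Proof.
rewrite (path_eigen z0 _ _ _ uniq_edge_path) path_eigenvalue_freq; congr (_ * cos _).
rewrite phase_freq; have E x : (x <= N)%N -> collapse edge_path (c (sg 0)) c (sg x) = c (sg 0).
  case: x => [|x] xN; rewrite /collapse; first by case: ifP.
  by rewrite map_f// mem_iota; lia.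
by rewrite !E ?(leq_trans jk)// !intrD; ring.
Qed.

(** The test cosine is merged into the phase by the product-to-sum formula, as frequency n or - n at
    the last site; with the end angle integrated innermost, the whole path can be collapsed. *)
Lemma edge_fun_coef a c (n : nat) (x : R) :
  tint (fun y => edge_fun a (update c (sg N) y) * cos (n%:R * (y - x))) =
  2^-1 * (xy_coef kap p q N j k n * cos ((n%:Z + p + q)%:~R * c (sg 0) + (a - n%:R * x)) +
    xy_coef kap p q N j k (- n%:Z) * cos ((- n%:Z + p + q)%:~R * c (sg 0) + (a + n%:R * x))).
Proof.
pose F m b c := chain z (sg 0) edge_path c * cos (phase (freq m) b c).
have bF m b : cbm (F m b) by have [] := regular_edge_integrand m b.
have bC : cbm (fun c => cos (n%:R * (c (sg N) - x))).
  apply: bmf_cos; apply: measurable_funM; first exact: measurable_cst.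
  by apply: measurable_funB; [exact: measurable_coord|exact: measurable_cst].
transitivity (it (sg N :: edge_sites) (fun c => F 0 a c * cos (n%:R * (c (sg N) - x))) c).
  cbn [iterated_seq]; apply: eq_tint => y; rewrite edge_funE.
  rewrite [RHS](@eq_it R I _ _ (fun c => cos (n%:R * (c (sg N) - x)) * F 0 a c)); last by move=> c'; rewrite mulrC.
  rewrite it_pull//; first by rewrite update_at mulrC.
  move=> i is_ c' w; rewrite update_neq//; apply/eqP => E.
  by have := edge_sites_last; rewrite E is_.
rewrite it_rot ?edge_sites_last//; last exact: (bmfM (bF _ _) bC).
rewrite -edge_pathE.
rewrite (@eq_it R I _ _ (fun c => 2^-1 * (F n%:Z (a - n%:R * x) c + F (- n%:Z) (a + n%:R * x) c))); last first.
  move=> c'; rewrite /F !phase_freq mul0r addr0 mulrNz.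
  set A := chain _ _ _ _; set B := a + _ + _.
  have -> : a - n%:R * x + p%:~R * c' (sg j) + q%:~R * c' (sg k) + n%:~R * c' (sg N) = B + n%:R * (c' (sg N) - x).
    by rewrite /B; ring.
  have -> : a + n%:R * x + p%:~R * c' (sg j) + q%:~R * c' (sg k) + - n%:~R * c' (sg N) = B - n%:R * (c' (sg N) - x).
    by rewrite /B; ring.
  by rewrite cosD cosB; field.
rewrite itZ; last exact: (bmfD (bF _ _) (bF _ _)).
by rewrite itD// !edge_integral.
Qed.

Lemma edge_fun_regular_last a c : exists L, forall x y,
  `|edge_fun a (update c (sg N) x) - edge_fun a (update c (sg N) y)| <= L * `|x - y|.
Proof.
have [bF [L HL] _] := regular_edge_integrand 0 a.
exists ((2 * pi) ^+ size edge_sites * L) => x y; rewrite !edge_funE -mulrA.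
by apply: it_lip => //; exact: edge_sites_last.
Qed.

Lemma edge_fun_periodic_last a c x :
  edge_fun a (update c (sg N) (x + 2 * pi)) = edge_fun a (update c (sg N) x).
Proof.
have [_ _ pF] := regular_edge_integrand 0 a.
by rewrite !edge_funE; apply: it_periodic => //; exact: edge_sites_last.
Qed.

Lemma cbm_edge_fun a : cbm (edge_fun a).
Proof.
have [bF _ _] := regular_edge_integrand 0 a.
by rewrite (funext (edge_funE a)); exact: cbm_it.
Qed.

(* V is a function of the angle at the last site; fejer_bound is applied to the
   difference in that angle. *)
Lemma edge_fun_dist a c (V : R -> R) (b : int -> R) (S : R) :
  continuous V -> bmf V -> (forall y, V (y + 2 * pi) = V y) ->
  (forall (n : nat) x, tint (fun y => V y * cos (n%:R * (y - x))) =
    2^-1 * (b n * cos ((n%:Z + p + q)%:~R * c (sg 0) + (a - n%:R * x)) +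
    b (- n%:Z) * cos ((- n%:Z + p + q)%:~R * c (sg 0) + (a + n%:R * x)))) ->
  (forall M, \sum_(n < M) (`|xy_coef kap p q N j k n%:Z - b n%:Z| +
    `|xy_coef kap p q N j k (- n%:Z) - b (- n%:Z)|) <= S) ->
  `|edge_fun a c - V (c (sg N))| <= S / pi.
Proof.
move=> cV bV pV Vc HS.
pose h y := edge_fun a (update c (sg N) y) - V y.
have [L HL] := edge_fun_regular_last a c.
have bE : bmf (fun y => edge_fun a (update c (sg N) y)) := cbm_section (sg N) c (cbm_edge_fun a).
have -> : edge_fun a c - V (c (sg N)) = h (c (sg N)) by rewrite /h update_id.
apply: (@fejer_bound R h (fun n => `|xy_coef kap p q N j k n%:Z - b n%:Z| +
    `|xy_coef kap p q N j k (- n%:Z) - b (- n%:Z)|)) => //.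
- by move=> y; apply: cvgB; [exact: lip_continuous HL y|exact: cV].
- exact: bmfB.
- by move=> y; rewrite /h edge_fun_periodic_last pV.
move=> x n.
have bc : bmf (fun y : R => cos (n%:R * (y - x))).
  by apply: eq_bmf (bmf_cos_affine n%:R (- (n%:R * x))) => y; rewrite mulrBr.
have -> : tint (fun y => h y * cos (n%:R * (y - x))) =
    tint (fun y => edge_fun a (update c (sg N) y) * cos (n%:R * (y - x))) -
    tint (fun y => V y * cos (n%:R * (y - x))).
  by rewrite -tintB; [apply: eq_tint => y; rewrite /h mulrBl|exact: bmfM|exact: bmfM].
rewrite edge_fun_coef Vc.
set C1 := cos _; set C2 := cos _.
set X1 := xy_coef _ _ _ _ _ _ _; set X2 := xy_coef _ _ _ _ _ _ _.
have -> : 2^-1 * (X1 * C1 + X2 * C2) - 2^-1 * (b n * C1 + b (- n%:Z) * C2) =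
  2^-1 * C1 * (X1 - b n) + 2^-1 * C2 * (X2 - b (- n%:Z)) by ring.
have half (t : R) : `|2^-1 * cos t| <= 1.
  by rewrite ler_norml; have := cos_geN1 t; have := cos_le1 t; lra.
apply: le_trans (ler_normD _ _) _.
by apply: lerD; rewrite normrM ler_piMl//; exact: half.
Qed.

End edge_function.

(** * Gaussian expectations *)

Section line_integral.
Context (R : realType).
Local Notation mu := (@lebesgue_measure R).

(** Used twice: to discard boundary terms at infinity, and to recover the line from the finitely
    many periods covered by a partial sum over windings. *)
Lemma line_integral_cvg (f : R -> R) (u : nat -> R) :
  mu.-integrable setT (EFin \o f) -> u @ \oo --> +oo ->
  (\int[mu]_(y in `[- u n, u n]) f y) @[n --> \oo] --> \int[mu]_y f y.
Proof.
move=> fi uy; have mf : measurable_fun (setT : set (measurableTypeR R)) f.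
  by apply/measurable_EFinP; exact: (measurable_int mu).
pose fn n (y : R) := (f y * \1_`[- u n, u n]%classic y)%:E.
have fnE n : \int[mu]_(y in `[- u n, u n]) f y = fine (\int[mu]_y fn n y).
  rewrite /Rintegral integral_mkcond; congr fine; apply: eq_integral => y _.
  by rewrite patchE /fn indicE; case: (y \in _); rewrite ?mulr1 ?mulr0.
under eq_fun do rewrite fnE.
apply: fine_cvg; rewrite fineK; last exact: integrable_fin_num.
have mfn n : measurable_fun setT (fn n).
  have mi : measurable_fun (setT : set (measurableTypeR R)) (\1_`[- u n, u n]%classic : R -> R).
    exact: (@measurable_indic _ (measurableTypeR R)).
  by apply/measurable_EFinP; exact: measurable_funM.
have [] := @dominated_convergence _ _ _ mu setT measurableT fn (EFin \o f) (abse \o (EFin \o f)) mfn (measurable_int mu fi) => //.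
- apply: aeW => y _; apply: cvg_near_cst; near=> n.
  rewrite /fn indicE mem_set ?mulr1//= in_itv/= -ler_norml.
  by near: n; move/cvgryPge : uy; exact.
- exact: integrable_abse.
- apply: aeW => y n _; rewrite /fn /= lee_fin normrM ler_piMr// indicE.
  by case: (_ \in _); rewrite ?normr1 ?normr0.
Unshelve. all: by end_near. Qed.
End line_integral.

Section gaussian.
Context (R : realType) (sigma : R) (sigma0 : 0 < sigma).
Local Notation mu := (@lebesgue_measure R).
Local Notation g := (normal_pdf 0 sigma).

Let sn0 : sigma != 0. Proof. by rewrite gt_eqF. Qed.

Lemma gaussE y : g y = normal_peak sigma * expR (- (y ^+ 2 / (2 * sigma ^+ 2))).
Proof.
by rewrite normal_pdfE// /normal_fun subr0 mulNr -[_ *+ 2]mulr_natl.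
Qed.

Lemma gauss_derive (y : R) : is_derive y 1 g (- (y / sigma ^+ 2) * g y).
Proof.
rewrite (funext gaussE).
apply: der_eq (derM (der_cst y _) (der_expR (derN (derM (derM (der_id y) (der_id y)) (der_cst y (2 * sigma ^+ 2)^-1))))) _.
by rewrite -expr2; field.
Qed.

Lemma gauss_integrableM (h : R -> R) : bmf h -> mu.-integrable setT (EFin \o (fun y => g y * h y)).
Proof.
move=> [mh [B hB]].
have B0 : 0 <= B by rewrite (le_trans _ (hB 0)).
apply: (@le_integrable _ _ _ mu _ measurableT _ (fun y => (B%:E * (g y)%:E)%E)).
- by apply/measurable_EFinP; apply: measurable_funM => //; exact: measurable_normal_pdf.
- move=> y _ /=; rewrite lee_fin [leRHS]ger0_norm ?mulr_ge0 ?normal_pdf_ge0//.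
  by rewrite normrM (ger0_norm (normal_pdf_ge0 _ _ _)) mulrC ler_wpM2r ?normal_pdf_ge0.
- by apply: integrableZl => //; exact: integrable_normal_pdf.
Qed.

(** Half of the Gaussian exponent absorbs |y|; the other half is, up to the ratio of the peaks, the
    density of standard deviation sqrt 2 sigma. *)
Lemma gauss_moment_integrable :
  mu.-integrable setT (EFin \o (fun y => `|y| * g y)).
Proof.
have s2 : 0 < Num.sqrt 2 * sigma by rewrite mulr_gt0// sqrtr_gt0.
pose C := sigma * normal_peak sigma / normal_peak (Num.sqrt 2 * sigma).
have p0 : 0 < normal_peak (Num.sqrt 2 * sigma) by rewrite normal_peak_gt0 ?gt_eqF.
apply: (@le_integrable _ _ _ mu _ measurableT _ (fun y => (C%:E * (normal_pdf 0 (Num.sqrt 2 * sigma) y)%:E)%E)).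
- apply/measurable_EFinP; apply: measurable_funM; last exact: measurable_normal_pdf.
  exact: (@normr_measurable R setT).
- move=> y _ /=; rewrite lee_fin ger0_norm ?mulr_ge0 ?normal_pdf_ge0//.
  rewrite (le_trans _ (ler_norm _))// gaussE normal_pdfE ?gt_eqF// /C /normal_fun subr0.
  set E2 := expR (- y ^+ 2 / _).
  have -> : sigma * normal_peak sigma / normal_peak (Num.sqrt 2 * sigma) *
      (normal_peak (Num.sqrt 2 * sigma) * E2) = normal_peak sigma * (sigma * E2).
    by field; rewrite gt_eqF.
  rewrite mulrCA ler_wpM2l ?normal_peak_ge0// /E2.
  have -> : - y ^+ 2 / ((Num.sqrt 2 * sigma) ^+ 2 *+ 2) = - (y ^+ 2 / (4 * sigma ^+ 2)).
    by rewrite exprMn sqr_sqrtr// -[_ *+ 2]mulr_natl; field.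
  have -> : - (y ^+ 2 / (2 * sigma ^+ 2)) = - (y ^+ 2 / (4 * sigma ^+ 2)) - y ^+ 2 / (4 * sigma ^+ 2) by field.
  rewrite expRD mulrCA [leRHS]mulrC ler_wpM2l ?expR_ge0//.
  have yE : `|y| = (`|y| / sigma) * sigma by rewrite divfK.
  set x := y ^+ 2 / (4 * sigma ^+ 2).
  (* With t = |y| / sigma this is t <= 1 + t^2 / 4 <= exp (t^2 / 4). *)
  have ht : `|y| / sigma <= expR x.
    apply: le_trans (expR_ge1Dx _).
    have : 0 <= (`|y| / sigma / 2 - 1) ^+ 2 by exact: sqr_ge0.
    have -> : x = (`|y| / sigma) ^+ 2 / 4.
      by rewrite /x exprMn exprVn -normrX ger0_norm ?sqr_ge0//; field.
    by move: (`|y| / sigma) => t; lra.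
  rewrite {1}yE mulrAC ler_piMl//; first exact: ltW.
  apply: le_trans (ler_wpM2r (expR_ge0 _) ht) _.
  by rewrite expRxMexpNx_1.
- by apply: integrableZl => //; exact: integrable_normal_pdf.
Qed.

Lemma gauss_cvg0 (u : nat -> R) : (u = fun n => n%:R) \/ (u = fun n => - n%:R) ->
  g (u n) @[n --> \oo] --> 0.
Proof.
move=> uE; have gE n : g (u n) = g n%:R.
  by case: uE => ->; rewrite // !gaussE sqrrN.
under eq_fun do rewrite gE gaussE.
rewrite -(mulr0 (normal_peak sigma)); apply: cvgM; first exact: cvg_cst.
apply/cvgrPdist_le => e e0; near=> n.
rewrite sub0r normrN ger0_norm ?expR_ge0// expRN.
rewrite -[e]invrK lef_pV2 ?posrE ?invr_gt0 ?expR_gt0//.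
apply: le_trans (expR_ge1Dx _); rewrite (le_trans _ (_ : n%:R ^+ 2 / (2 * sigma ^+ 2) <= _))//; last by lra.
have s2 : 0 < 2 * sigma ^+ 2 by rewrite mulr_gt0// exprn_gt0.
rewrite ler_pdivlMr// (@le_trans _ _ n%:R)//.
  by near: n; exact: nbhs_infty_ger.
rewrite expr2; have [->|n0] := posnP n; first by rewrite mulr0.
by rewrite ler_peMl// ler1n.
Unshelve. all: by end_near. Qed.

(** Stein's identity: the derivative of g(y) sin (s y + b) integrates to 0 over the line because g
    vanishes at infinity. *)
Lemma gauss_stein (s b : R) :
  \int[mu]_y (g y * (y * sin (s * y + b))) = sigma ^+ 2 * s * \int[mu]_y (g y * cos (s * y + b)).
Proof.
pose H y := g y * sin (s * y + b).
pose h y := - (y / sigma ^+ 2) * g y * sin (s * y + b) + s * (g y * cos (s * y + b)).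
have dH (y : R) : is_derive y 1 H (h y).
  apply: der_eq (derM (gauss_derive y) (der_sin (der_affine _ _ _))) _.
  by rewrite /h; ring.
have cg : continuous g by exact: continuous_normal_pdf.
have ch : continuous h.
  move=> y; apply: cvgD.
    apply: cvgM; last exact: (continuous_sin_comp (@continuous_affine _ s b)).
    by apply: cvgM; [apply: cvgN; apply: cvgM; [exact: cvg_id|exact: cvg_cst]|exact: cg].
  apply: cvgM; first exact: cvg_cst.
  by apply: cvgM; [exact: cg|exact: (continuous_cos_comp (@continuous_affine _ s b))].
have i1 : mu.-integrable setT (EFin \o (fun y => g y * (y * sin (s * y + b)))).
  apply: le_integrable gauss_moment_integrable => //.
    apply/measurable_EFinP; apply: measurable_funM; first exact: measurable_normal_pdf.
    by apply: measurable_funM => //; exact: (bmf_sin_affine s b).1.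
  move=> y _ /=; rewrite lee_fin [leRHS]ger0_norm ?mulr_ge0 ?normal_pdf_ge0//.
  rewrite normrM ger0_norm ?normal_pdf_ge0// mulrC ler_wpM2r ?normal_pdf_ge0//.
  by rewrite normrM ler_piMr// ler_norml sin_geN1 sin_le1.
have i2 : mu.-integrable setT (EFin \o (fun y => g y * cos (s * y + b))).
  by apply: gauss_integrableM; exact: bmf_cos_affine.
have hE : h = fun y => - (sigma ^+ 2)^-1 * (g y * (y * sin (s * y + b))) + s * (g y * cos (s * y + b)).
  by apply/funext => y; rewrite /h; ring.
have iZ a f : mu.-integrable setT (EFin \o f) -> mu.-integrable setT (EFin \o (fun y : R => a * f y)).
  by move=> fi; have := integrableZl measurableT a fi.
have ih : mu.-integrable setT (EFin \o h).
  rewrite hE; exact: (integrableD measurableT (iZ _ _ i1) (iZ _ _ i2)).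
have L1 := line_integral_cvg ih (@cvgr_idn R).
have HB u : (u = fun n => n%:R) \/ (u = fun n => - n%:R) -> (fun n => H (u n)) @ \oo --> (0 : R).
  move=> hu; apply: norm_cvg0; have := gauss_cvg0 hu => gu.
  apply: (squeeze_cvgr _ (cvg_cst 0) gu); apply: nearW => n.
  rewrite normr_ge0/= /H normrM ger0_norm ?normal_pdf_ge0// ler_piMr ?normal_pdf_ge0//.
  by rewrite ler_norml sin_geN1 sin_le1.
pose v (n : nat) := \int[mu]_(y in `[- n%:R, n%:R]) h y.
have L2 : v @ \oo --> (0 : R).
  pose w (n : nat) := H n%:R - H (- n%:R).
  have Cw : w @ \oo --> (0 : R) - 0 by apply: cvgB; apply: HB; [left|right].
  (* Both sequences are shifted by one since [FTC_local] needs a nondegenerate interval, which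
     excludes n = 0. *)
  rewrite subr0 -(cvg_shiftS w) in Cw; rewrite -(cvg_shiftS v).
  suff -> : [sequence v n.+1]_n = [sequence w n.+1]_n by [].
  apply/funext => n; rewrite /v /w /=; apply: FTC_local => //.
  by rewrite -subr_gt0 opprK -natrD ltr0n addnS.
have E : \int[mu]_y h y = 0 by apply: (cvg_unique _ L1 L2).
move: E; rewrite hE RintegralD//; [|exact: iZ|exact: iZ].
rewrite !RintegralZl// => E.
have s20 : sigma ^+ 2 != 0 by rewrite expf_neq0.
set A := \int[mu]_y _ in E *; set B := \int[mu]_y _ in E *.
have -> : A = - sigma ^+ 2 * (- (sigma ^+ 2)^-1 * A) by field.
have -> : - (sigma ^+ 2)^-1 * A = - (s * B) by apply/eqP; rewrite -addr_eq0 E.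
by ring.
Qed.

(** Differentiation under the integral and [gauss_stein] give psi' = - sigma^2 s psi for the
    left-hand side psi, so psi(s) exp (sigma^2 s^2 / 2) is constant, equal to cos b. *)
Lemma gauss_char (s b : R) :
  \int[mu]_y (g y * cos (s * y + b)) = expR (- (sigma ^+ 2 * s ^+ 2 / 2)) * cos b.
Proof.
pose psi s := \int[mu]_y (g y * cos (s * y + b)).
have i2 t : mu.-integrable setT (EFin \o (fun y => g y * cos (t * y + b))).
  by apply: gauss_integrableM; exact: bmf_cos_affine.
have dpsi (t : R) : is_derive t 1 psi (- (sigma ^+ 2 * t * psi t)).
  pose f (x y : R) := g y * cos (x * y + b).
  have df (x y : R) : is_derive x 1 (f ^~ y) (- (g y * (y * sin (x * y + b)))).
    apply: der_eq (derM (der_cst x (g y)) (der_cos (derD (derM (der_id x) (der_cst x y)) (der_cst x b)))) _.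
    by ring.
  have tI : `]t - 1, t + 1[%classic t by rewrite /= in_itv/=; lra.
  have derf x y : `]t - 1, t + 1[%classic x -> setT y -> derivable (f ^~ y) x 1.
    by move=> _ _; have [] := df x y.
  have d1E x y : partial1of2 f x y = - (g y * (y * sin (x * y + b))).
    by rewrite partial1of2E; have [_ ->] := df x y.
  have G0 y : 0 <= `|y| * g y by rewrite mulr_ge0 ?normal_pdf_ge0.
  have Gub x y : `]t - 1, t + 1[%classic x -> setT y -> `|partial1of2 f x y| <= `|y| * g y.
    move=> _ _; rewrite d1E normrN normrM ger0_norm ?normal_pdf_ge0// mulrC ler_wpM2r ?normal_pdf_ge0//.
    by rewrite normrM ler_piMr// ler_norml sin_geN1 sin_le1.
  have fi x : `]t - 1, t + 1[%classic x -> mu.-integrable setT (EFin \o f x) by move=> _; exact: i2.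
  have dd := derivable_under_integral measurableT tI fi derf G0 gauss_moment_integrable Gub.
  have dE := differentiation_under_integral measurableT tI fi derf G0 gauss_moment_integrable Gub.
  apply: (DeriveDef dd); rewrite -derive1E dE.
  rewrite /psi -gauss_stein.
  rewrite -[RHS]mulN1r -RintegralZl//; last first.
    apply: le_integrable gauss_moment_integrable => //.
      apply/measurable_EFinP; apply: measurable_funM; first exact: measurable_normal_pdf.
      by apply: measurable_funM => //; exact: (bmf_sin_affine t b).1.
    move=> y _ /=; rewrite lee_fin [leRHS]ger0_norm// -[leLHS]normrN -d1E; apply: Gub => //.
  by apply: eq_Rintegral => y _; rewrite d1E mulN1r.
pose D t := psi t * expR (sigma ^+ 2 * t ^+ 2 / 2).
have dD (t : R) : is_derive t 1 D 0.
  have dq : is_derive t 1 (fun t : R => sigma ^+ 2 * t ^+ 2 / 2) (sigma ^+ 2 * t).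
    apply: der_eq (derM (derM (der_cst t (sigma ^+ 2)) (derM (der_id t) (der_id t))) (der_cst t (2^-1))) _.
    by field.
  apply: der_eq (derM (dpsi t) (der_expR dq)) _.
  by ring.
have Dcst : D s = D 0 by exact: is_derive_0_is_cst.
have D0 : D 0 = cos b.
  rewrite /D expr0n/= mulr0 mul0r expR0 mulr1 /psi.
  transitivity (\int[mu]_y (g y * cos b)).
    by apply: eq_Rintegral => y _; rewrite mul0r add0r.
  rewrite RintegralZr//; last exact: integrable_normal_pdf.
  by rewrite /Rintegral integral_normal_pdf /= mul1r.
have -> : \int[mu]_y (g y * cos (s * y + b)) = D s * expR (- (sigma ^+ 2 * s ^+ 2 / 2)).
  by rewrite /D -mulrA expRxMexpNx_1 mulr1.
by rewrite Dcst D0 mulrC.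
Qed.
End gaussian.

Lemma bmf_integrable_prob (R : realType) d (T : measurableType d) (Q : probability T R)
  (f : T -> R) : bmf f -> Q.-integrable setT (EFin \o f).
Proof.
move=> bf; have Q1 : (Q setT < +oo)%E by rewrite probability_setT ltry.
exact: (bmf_integrable measurableT Q1 bf).
Qed.

Section normal_expectation.
Context (R : realType).
Local Notation mu := (@lebesgue_measure R).

Lemma integral_normal_prob (sigma : R) (h : R -> R) : 0 < sigma -> bmf h ->
  (\int[normal_prob 0 sigma]_x (h x)%:E = \int[mu]_x ((h x)%:E * (normal_pdf 0 sigma x)%:E))%E.
Proof.
move=> s0 bh.
have bh' : @bmf R _ (measurableTypeR R) h := bh.
have nd : normal_prob 0 sigma `<< mu := normal_prob_dominates 0 sigma.
have fi : (normal_prob 0 sigma).-integrable setT (EFin \o h).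
  exact: (bmf_integrable_prob (normal_prob 0 sigma) bh').
rewrite -(Radon_Nikodym_change_of_variables nd)//=.
apply: ae_eq_integral => //.
- apply: emeasurable_funM; first by apply/measurable_EFinP; exact: bh'.1.
  by apply: (measurable_int mu); exact: Radon_Nikodym_integrable.
- apply: emeasurable_funM; first by apply/measurable_EFinP; exact: bh'.1.
  by apply/measurable_EFinP; exact: measurable_normal_pdf.
- apply: ae_eqe_mul2l => /=.
  rewrite Radon_NikodymE//=.
  case: cid => /= f [f1 f2 f3].
  apply: integral_ae_eq => //=.
    by apply/measurable_EFinP; exact: measurable_normal_pdf.
  by move=> A _ mA; rewrite -f3.
Qed.

Context (d : measure_display) (Omega : measurableType d) (P : probability Omega R).

Lemma normal_law_cos (X : {RV P >-> R}) (v s b : R) : 0 <= v ->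
  (forall A, measurable A -> P (X @^-1` A) = normal_law 0 v A) ->
  \int[P]_w cos (s * X w + b) = expR (- (v * s ^+ 2 / 2)) * cos b.
Proof.
move=> v0 lX.
have bc : bmf (fun y : R => cos (s * y + b)) := bmf_cos_affine s b.
have bX : bmf (fun w => cos (s * X w + b)).
  by apply: (bmf_comp (h := X)) bc; exact: measurable_funP.
have mX0 : measurable_fun setT (X : Omega -> R) by exact: measurable_funP.
have mX : @measurable_fun _ _ Omega (measurableTypeR R) setT X := mX0.
pose X' : {RV P >-> measurableTypeR R} := @mfun_Sub _ _ Omega (measurableTypeR R) X (mem_set mX).
have E : (\int[P]_w (cos (s * X w + b))%:E = \int[distribution P X']_y (cos (s * y + b))%:E)%E.
  rewrite integral_distribution//; first by apply/measurable_EFinP; exact: bc.1.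
  exact: bmf_integrable_prob bX.
rewrite /Rintegral E; have [ve|vn] := eqVneq v 0.
  (* The law degenerates at the end points of an edge and for two equal points, where it is a Dirac
     mass. *)
  rewrite (eq_measure_integral \d_(0 : measurableTypeR R)) => [|A mA _].
    rewrite integral_dirac//; last by apply/measurable_EFinP; exact: bc.1.
    by rewrite diracT mul1e /= mulr0 add0r ve !mul0r oppr0 expR0 mul1r.
  by have := lX A mA; rewrite /normal_law ve eqxx.
have sg0 : 0 < Num.sqrt v by rewrite sqrtr_gt0 lt0r vn.
have -> : (\int[distribution P X']_y (cos (s * y + b))%:E =
    \int[normal_prob 0 (Num.sqrt v)]_y (cos (s * y + b))%:E)%E.
  apply: eq_measure_integral => A mA _.
  by have := lX A mA; rewrite /normal_law (negPf vn).
rewrite integral_normal_prob//.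
have := gauss_char sg0 s b; rewrite sqr_sqrtr// => <-.
by rewrite /Rintegral; congr fine; apply: eq_integral => y _; rewrite -EFinM mulrC.
Qed.

(** The product rule on rectangles identifies the joint law as a product measure; X is then
    integrated for a fixed value of Y, and Y last. *)
Lemma normal_law_cos_indep (X Y : {RV P >-> R}) (v1 v2 b : R) : 0 <= v1 -> 0 <= v2 ->
  (forall A, measurable A -> P (X @^-1` A) = normal_law 0 v1 A) ->
  (forall A, measurable A -> P (Y @^-1` A) = normal_law 0 v2 A) ->
  (forall A B, measurable A -> measurable B ->
    P (X @^-1` A `&` Y @^-1` B) = (P (X @^-1` A) * P (Y @^-1` B))%E) ->
  \int[P]_w cos (X w - Y w + b) = expR (- ((v1 + v2) / 2)) * cos b.
Proof.
move=> v10 v20 lX lY XY.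
pose Z w := (X w, Y w).
have mZ : measurable_fun setT Z.
  by apply: measurable_fun_pair; exact: measurable_funP.
pose ZZ : {RV P >-> (R * R)%type} := mfun_Sub (mem_set mZ).
pose f (z : R * R) := cos (z.1 - z.2 + b).
have bf : bmf f.
  by apply: bmf_cos; apply: measurable_funD => //; apply: measurable_funB.
have E : (\int[P]_w (cos (X w - Y w + b))%:E = \int[distribution P ZZ]_z (f z)%:E)%E.
  rewrite integral_distribution//; first by apply/measurable_EFinP; exact: bf.1.
  exact: (bmf_integrable_prob P (bmf_comp mZ bf)).
have mE (A : set (R * R)) : measurable A -> distribution P ZZ A = (distribution P X \x distribution P Y)%E A.
  move=> mA; apply/esym; apply: product_measure_unique; [move=> A1 A2 mA1 mA2|exact: mA].
  exact: (XY A1 A2 mA1 mA2).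
have bfi : (distribution P X \x distribution P Y)%E.-integrable setT (EFin \o f).
  have h : ((distribution P X \x distribution P Y)%E setT < +oo)%E.
    by rewrite -mE// probability_setT ltry.
  exact: (bmf_integrable measurableT h bf).
have -> : \int[P]_w cos (X w - Y w + b) = fine (\int[distribution P X \x distribution P Y]_z (f z)%:E)%E.
  rewrite /Rintegral E; congr fine; apply: eq_measure_integral => A mA _; exact: mE.
rewrite -[X in fine X](integral21_prod_meas1 bfi).
have inner (y : R) : (\int[distribution P X]_x (f (x, y))%:E)%E = (expR (- (v1 / 2)) * cos (- 1 * y + b))%:E.
  have bX : bmf (fun w => cos (1 * X w + (- y + b))).
    by apply: (bmf_comp (h := X)) (bmf_cos_affine 1 (- y + b)); exact: measurable_funP.
  have iX : P.-integrable setT (EFin \o (fun w => cos (1 * X w + (- y + b)))).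
    exact: bmf_integrable_prob.
  transitivity (\int[P]_w (cos (1 * X w + (- y + b)))%:E)%E.
    rewrite integral_distribution.
    - by apply: eq_integral => w _; rewrite /f /= mul1r addrA.
    - apply/measurable_EFinP; apply: (eq_measurable_fun (fun x : R => cos (1 * x + (- y + b)))).
        by move=> x _; rewrite /f /= mul1r addrA.
      exact: (bmf_cos_affine 1 (- y + b)).1.
    - by apply: eq_integrable iX => // w _; rewrite /f /= mul1r addrA.
  have := normal_law_cos 1 (- y + b) v10 lX; rewrite expr1n mulr1 mulN1r => <-.
  by rewrite fineK//; exact: integrable_fin_num iX.
rewrite /fubini_G; under eq_integral do rewrite inner.
have bY : bmf (fun w => cos (- 1 * Y w + b)).
  by apply: (bmf_comp (h := Y)) (bmf_cos_affine (- 1) b); exact: measurable_funP.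
have iY : P.-integrable setT (EFin \o (fun w => cos (- 1 * Y w + b))).
  exact: bmf_integrable_prob.
have bg : bmf (fun y : R => expR (- (v1 / 2)) * cos (- 1 * y + b)) := bmfZ _ (bmf_cos_affine _ _).
rewrite integral_distribution; first last.
- exact: (bmf_integrable_prob P (bmfZ (expR (- (v1 / 2))) bY)).
- by apply/measurable_EFinP; exact: bg.1.
have := RintegralZl (expR (- (v1 / 2))) measurableT iY; rewrite /Rintegral /= => ->.
have := normal_law_cos (-1) b v20 lY; rewrite /Rintegral => ->.
rewrite sqrrN expr1n mulr1 mulrA -expRD; congr (expR _ * _); ring.
Qed.
End normal_expectation.

(** * Sums over the integers and the Villain edge weight *)

Section int_sum_theory.
Context (R : realType).
Implicit Types (a b : int -> R) (f : int -> R).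

Definition isummable a : Prop := exists S, forall M,
  \sum_(k < M) (`|a (Posz k)| + `|a (Negz k)|) <= S.

Lemma esum_int f : (forall m, 0 <= f m) ->
  (\esum_(m in [set: int]) (f m)%:E =
   \sum_(0 <= k <oo) (f (Posz k))%:E + \sum_(0 <= k <oo) (f (Negz k))%:E)%E.
Proof.
move=> f0.
rewrite (esumID [set m : int | (0 <= m)%R]) => [|m _]; last by rewrite lee_fin.
rewrite !nneseries_esumT; try by move=> k; rewrite lee_fin.
congr (_ + _)%E.
- rewrite (reindex_esum [set: nat] _ Posz)//; split.
  + by move=> k _; split.
  + by move=> k l _ _ [].
  + by move=> [k|k] []//= _ _; exists k.
- rewrite (reindex_esum [set: nat] _ Negz)//; split.
  + by move=> k _; split.
  + by move=> k l _ _ [].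
  + by move=> [k|k] []//= _ _; exists k.
Qed.

Lemma nneseries_fine (u : nat -> R) (S : R) : (forall k, 0 <= u k) ->
  (forall M, \sum_(k < M) u k <= S) ->
  (\sum_(0 <= k <oo) (u k)%:E \is a fin_num)%E /\
  (fun M => \sum_(k < M) u k) @ \oo --> fine (\sum_(0 <= k <oo) (u k)%:E)%E.
Proof.
move=> u0 uS.
have c : ((fun M => \sum_(0 <= k < M) (u k)%:E)%E @ \oo --> \sum_(0 <= k <oo) (u k)%:E)%E.
  by apply: is_cvg_ereal_nneg_natsum => k _; rewrite lee_fin.
have E : (fun M => \sum_(0 <= k < M) (u k)%:E)%E = (fun M => (\sum_(k < M) u k)%:E).
  by apply/funext => M; rewrite sumEFin big_mkord.
have le : (\sum_(0 <= k <oo) (u k)%:E <= S%:E)%E.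
  apply: lime_le; first by apply/cvg_ex; eexists; exact: c.
  by apply: nearW => M; rewrite sumEFin lee_fin big_mkord.
have ge : (0 <= \sum_(0 <= k <oo) (u k)%:E)%E.
  by apply: nneseries_ge0 => k _ _; rewrite lee_fin.
have fin : (\sum_(0 <= k <oo) (u k)%:E \is a fin_num)%E.
  by rewrite ge0_fin_numE// (le_lt_trans le)// ltry.
split => //.
have c' : ((fun M => (\sum_(k < M) u k)%:E) @ \oo --> (fine (\sum_(0 <= k <oo) (u k)%:E))%:E)%E.
  by rewrite (fineK fin) -E.
exact: (fine_cvg c').
Qed.

Lemma isummable_half a : isummable a -> exists S, forall M,
  \sum_(k < M) `|a (Posz k)| <= S /\ \sum_(k < M) `|a (Negz k)| <= S.
Proof.
move=> [S aS]; exists S => M; split; apply: le_trans (aS M); apply: ler_sum => k _.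
  by rewrite lerDl.
by rewrite lerDr.
Qed.

(** Summability makes all the extended half sums finite, so [int_sum] turns into limits of ordinary
    partial sums, where linearity is easy. *)
Lemma int_sum_cvg a : isummable a -> exists x y, [/\ int_sum a = x + y,
  (fun M => \sum_(k < M) a (Posz k)) @ \oo --> x &
  (fun M => \sum_(k < M) a (Negz k)) @ \oo --> y].
Proof.
move=> /isummable_half[S aS].
have mp m : 0 <= Num.max (a m) 0 by rewrite le_max lexx orbT.
have mn m : 0 <= Num.max (- a m) 0 by rewrite le_max lexx orbT.
have mpa m : Num.max (a m) 0 <= `|a m| by rewrite ge_max ler_norm normr_ge0.
have mna m : Num.max (- a m) 0 <= `|a m| by rewrite ge_max -normrN ler_norm normr_ge0.
have mE m : a m = Num.max (a m) 0 - Num.max (- a m) 0.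
  by case: (leP (a m) 0) => h; case: (leP (- a m) 0) => h'; lra.
have Sb (u : nat -> R) (v : nat -> R) : (forall k, u k <= v k) ->
    (forall M, \sum_(k < M) v k <= S) -> forall M, \sum_(k < M) u k <= S.
  by move=> uv vS M; apply: le_trans (vS M); apply: ler_sum.
have [f1 c1] := @nneseries_fine (fun k => Num.max (a (Posz k)) 0) S (fun k => mp _)
  (Sb _ _ (fun k => mpa (Posz k)) (fun M => (aS M).1)).
have [f2 c2] := @nneseries_fine (fun k => Num.max (a (Negz k)) 0) S (fun k => mp _)
  (Sb _ _ (fun k => mpa (Negz k)) (fun M => (aS M).2)).
have [f3 c3] := @nneseries_fine (fun k => Num.max (- a (Posz k)) 0) S (fun k => mn _)
  (Sb _ _ (fun k => mna (Posz k)) (fun M => (aS M).1)).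
have [f4 c4] := @nneseries_fine (fun k => Num.max (- a (Negz k)) 0) S (fun k => mn _)
  (Sb _ _ (fun k => mna (Negz k)) (fun M => (aS M).2)).
have c13 := cvgB c1 c3; have c24 := cvgB c2 c4.
eexists; eexists; split; last 2 first.
- rewrite (_ : (fun M => _) = (fun M => \sum_(k < M) Num.max (a (Posz k)) 0) -
     (fun M => \sum_(k < M) Num.max (- a (Posz k)) 0)); first exact: c13.
  by apply/funext => M; rewrite fctE -sumrB; apply: eq_bigr => k _; rewrite -mE.
- rewrite (_ : (fun M => _) = (fun M => \sum_(k < M) Num.max (a (Negz k)) 0) -
     (fun M => \sum_(k < M) Num.max (- a (Negz k)) 0)); first exact: c24.
  by apply/funext => M; rewrite fctE -sumrB; apply: eq_bigr => k _; rewrite -mE.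
rewrite /int_sum (esum_int mp) (esum_int mn) !fineD//; ring.
Qed.

(** [Negz k] is - (k + 1), so the M + 1 nonnegative and the M negative indices fill the window from
    - M to M. *)
Definition sym_sum a (M : nat) : R :=
  \sum_(k < M.+1) a (Posz k) + \sum_(k < M) a (Negz k).

Lemma sym_sum_cvg a : isummable a -> sym_sum a @ \oo --> int_sum a.
Proof.
move=> /int_sum_cvg[x [y [-> cx cy]]]; apply: cvgD => //.
by rewrite -(cvg_shiftS (fun M => \sum_(k < M) a (Posz k))) in cx.
Qed.

Lemma eq_int_sum a b : a =1 b -> int_sum a = int_sum b.
Proof. by move=> /funext ->. Qed.

Lemma isummableD a b : isummable a -> isummable b -> isummable (fun m => a m + b m).
Proof.
move=> [S aS] [T bT]; exists (S + T) => M; apply: le_trans (lerD (aS M) (bT M)).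
rewrite -big_split/=; apply: ler_sum => k _; rewrite addrACA.
by apply: lerD; exact: ler_normD.
Qed.

Lemma isummableZ k a : isummable a -> isummable (fun m => k * a m).
Proof.
move=> [S aS]; exists (`|k| * S) => M.
apply: le_trans (ler_wpM2l (normr_ge0 k) (aS M)).
by rewrite mulr_sumr; apply: ler_sum => i _; rewrite !normrM mulrDr.
Qed.

Lemma int_sumD a b : isummable a -> isummable b ->
  int_sum (fun m => a m + b m) = int_sum a + int_sum b.
Proof.
move=> sa sb; apply: (cvg_unique _ (sym_sum_cvg (isummableD sa sb))) => //.
rewrite (_ : sym_sum _ = sym_sum a + sym_sum b).
  by apply: cvgD; exact: sym_sum_cvg.
by apply/funext => M; rewrite fctE /sym_sum !big_split/= addrACA.
Qed.

Lemma int_sumZ k a : isummable a -> int_sum (fun m => k * a m) = k * int_sum a.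
Proof.
move=> sa; apply: (cvg_unique _ (sym_sum_cvg (isummableZ k sa))) => //.
rewrite (_ : sym_sum _ = fun M => k * sym_sum a M).
  by apply: cvgM; [exact: cvg_cst|exact: sym_sum_cvg].
by apply/funext => M; rewrite /sym_sum -!mulr_sumr -mulrDr.
Qed.

Lemma int_sum_ge_term a m : isummable a -> (forall m, 0 <= a m) -> a m <= int_sum a.
Proof.
move=> sa a0; have H M : (`|m| < M)%N -> a m <= sym_sum a M.
  rewrite /sym_sum; case: m => k /= kM.
    have kM' : (k < M.+1)%N by rewrite ltnW.
    by rewrite (bigD1 (Ordinal kM'))//= -addrA lerDl addr_ge0//; exact: sumr_ge0.
  have kM' : (k < M)%N by rewrite ltnW.
  by rewrite [X in _ + X](bigD1 (Ordinal kM'))//= addrCA lerDl addr_ge0//; exact: sumr_ge0.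
apply: (cvgr_to_ge (sym_sum_cvg sa)).
by near=> M; apply: H; near: M; exact: nbhs_infty_gt.
Unshelve. all: by end_near. Qed.

Lemma int_sum_shift a (k : int) : int_sum (fun m => a (m + k)) = int_sum a.
Proof.
have bij : set_bij [set: int] [set: int] (fun m => m + k).
  split => //; first by move=> m n _ _ /addIr.
  by move=> m _; exists (m - k) => //; rewrite subrK.
by rewrite /int_sum; congr (fine _ - fine _); rewrite [RHS](reindex_esum _ _ _ _ bij).
Qed.

(** The tail bound depends on C and r alone, which makes convergence uniform over families with the
    same majorant. *)
Lemma int_sum_geom a (C r : R) : 0 <= r < 1 -> (forall m, `|a m| <= C * r ^+ `|m|) ->
  isummable a /\ forall M, `|int_sum a - sym_sum a M| <= 2 * C / (1 - r) * r ^+ M.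
Proof.
move=> /andP[r0 r1] aC.
have C0 : 0 <= C by have := aC 0; rewrite expr0 mulr1 => /(le_trans (normr_ge0 _)).
have r10 : 0 < 1 - r by lra.
have geo m K : \sum_(k < K) r ^+ (m + k) <= r ^+ m / (1 - r).
  rewrite ler_pdivlMr//.
  have -> : (\sum_(k < K) r ^+ (m + k)) * (1 - r) = r ^+ m * (1 - r ^+ K).
    elim: K => [|K IH]; first by rewrite big_ord0 mul0r expr0 subrr mulr0.
    by rewrite big_ord_recr/= mulrDl IH exprS exprD; ring.
  by rewrite ler_piMr ?exprn_ge0// gerBl exprn_ge0.
have sa : isummable a.
  exists (2 * C / (1 - r)) => M.
  apply: (@le_trans _ _ (\sum_(k < M) (2 * C * r ^+ (0 + k)))).
    apply: ler_sum => k _; rewrite add0n; have := aC (Posz k); have := aC (Negz k) => /= h1 h2.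
    have : C * r ^+ k.+1 <= C * r ^+ k by rewrite ler_wpM2l// exprS ler_piMl ?exprn_ge0// ltW.
    lra.
  rewrite -mulr_sumr ler_wpM2l ?mulr_ge0//.
  by rewrite (le_trans (geo _ _))// expr0 mul1r.
split=> // M.
have c := sym_sum_cvg sa.
have cc : (fun K => `|sym_sum a K - sym_sum a M|) @ \oo --> `|int_sum a - sym_sum a M|.
  by apply: cvg_norm; apply: cvgB => //; exact: cvg_cst.
apply: (cvgr_to_le cc).
near=> K; have MK : (M <= K)%N by near: K; exact: nbhs_infty_ge.
rewrite /sym_sum.
rewrite -!(big_mkord xpredT (fun k => a (Posz k))) -!(big_mkord xpredT (fun k => a (Negz k))).
have MK1 : (M.+1 <= K.+1)%N by [].
rewrite (big_cat_nat (leq0n _) MK1)/= (big_cat_nat (leq0n _) MK)/=.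
set A := \sum_(0 <= k < M.+1) _; set B := \sum_(0 <= k < M) _.
rewrite (_ : A + _ + (B + _) - (A + B) = \sum_(M.+1 <= k < K.+1) a (Posz k) + \sum_(M <= k < K) a (Negz k)); last by ring.
rewrite big_add1/= -big_split/=.
rewrite -{1}(add0n M) big_addn big_mkord.
apply: le_trans (ler_norm_sum _ _ _) _.
apply: (@le_trans _ _ (\sum_(k < K - M) 2 * C * r ^+ (M + k))).
  apply: ler_sum => k _; apply: le_trans (ler_normD _ _) _.
  have := aC (Posz (k + M).+1); have := aC (Negz (k + M)) => /= h1 h2.
  have : C * r ^+ (k + M).+1 <= C * r ^+ (M + k).
    by rewrite [(M + k)%N]addnC ler_wpM2l// exprS ler_piMl ?exprn_ge0// ltW.
  lra.
rewrite -mulr_sumr -[leRHS]mulrA ler_wpM2l ?mulr_ge0// [leRHS]mulrC.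
exact: geo.
Unshelve. all: by end_near. Qed.
End int_sum_theory.

(** * The periodized Gaussian and its Fourier coefficients *)

Section villain_series.
Context (R : realType) (kap : R) (kap0 : 0 < kap).
Local Notation mu := (@lebesgue_measure R).

(** The Villain term exp (- kap y^2 / 2) is an unnormalized Gaussian density of variance 1 / kap. *)
Definition edge_sd : R := Num.sqrt kap^-1.
Local Notation g := (normal_pdf 0 edge_sd).

Lemma edge_sd_gt0 : 0 < edge_sd.
Proof. by rewrite sqrtr_gt0 invr_gt0. Qed.

Lemma edge_sd_sqr : edge_sd ^+ 2 = kap^-1.
Proof. by rewrite sqr_sqrtr// invr_ge0 ltW. Qed.

Lemma edge_gaussE y : g y = normal_peak edge_sd * expR (- (kap / 2 * y ^+ 2)).
Proof.
rewrite gaussE ?edge_sd_gt0// edge_sd_sqr; congr (_ * expR (- _)).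
by field; rewrite gt_eqF.
Qed.

Definition vterm (tau b x : R) (m : int) : R :=
  g (x + 2 * pi * m%:~R) * cos (tau * (x + 2 * pi * m%:~R) + b).

Definition vser (tau b x : R) : R := int_sum (vterm tau b x).

Lemma vterm_norm tau b x m : `|vterm tau b x m| <= g (x + 2 * pi * m%:~R).
Proof.
rewrite normrM ger0_norm ?normal_pdf_ge0// ler_piMr ?normal_pdf_ge0//.
by rewrite ler_norml cos_geN1 cos_le1.
Qed.

Definition vrate : R := expR (- (2 * pi * kap)).

Lemma vrate_bounds : 0 <= vrate < 1.
Proof.
rewrite expR_ge0 -expR0 ltr_expR oppr_lt0 !mulr_gt0//.
exact: pi_gt0.
Qed.

Definition vcst (A : R) : R := normal_peak edge_sd * expR (kap / 2 + kap * A).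

(** With y = x + 2 pi m, the constants come from y^2 >= 2 |y| - 1 and |y| >= 2 pi |m| - A,
    multiplied by kap / 2. *)
Lemma edge_gauss_le (A x : R) m : `|x| <= A -> g (x + 2 * pi * m%:~R) <= vcst A * vrate ^+ `|m|.
Proof.
move=> xA; rewrite edge_gaussE /vcst -[leRHS]mulrA ler_wpM2l ?normal_peak_ge0//.
rewrite /vrate -expRM_natl -expRD ler_expR.
set y := x + 2 * pi * m%:~R.
have h1 : 2 * pi * `|m|%:R - A <= `|y|.
  rewrite lerBlDr; apply: (@le_trans _ _ (`|y| + `|x|)); last by rewrite lerD2l.
  have -> : 2 * pi * `|m|%:R = `|y - x|.
    rewrite /y addrAC subrr add0r normrM ger0_norm ?mulr_ge0 ?pi_ge0//.
    by rewrite natr_absz intr_norm.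
  exact: ler_normB.
have h2 : 2 * `|y| - 1 <= y ^+ 2.
  have : 0 <= (`|y| - 1) ^+ 2 by exact: sqr_ge0.
  have -> : y ^+ 2 = `|y| ^+ 2 by rewrite -normrX ger0_norm// sqr_ge0.
  by move: `|y| => t; lra.
have h3 : kap / 2 * (2 * (2 * pi * `|m|%:R - A) - 1) <= kap / 2 * y ^+ 2.
  by rewrite ler_pM2l ?divr_gt0//; lra.
by move: h3; lra.
Qed.

Lemma vterm_geom A tau b x : `|x| <= A -> forall m, `|vterm tau b x m| <= vcst A * vrate ^+ `|m|.
Proof. by move=> xA m; apply: le_trans (vterm_norm _ _ _ _) (edge_gauss_le _ xA). Qed.

Lemma vterm_summable tau b x : isummable (vterm tau b x).
Proof. by have [] := int_sum_geom vrate_bounds (vterm_geom tau b (lexx `|x|)). Qed.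

Lemma vser_tail A tau b x M : `|x| <= A ->
  `|vser tau b x - sym_sum (vterm tau b x) M| <= 2 * vcst A / (1 - vrate) * vrate ^+ M.
Proof. by move=> xA; have [_] := int_sum_geom vrate_bounds (vterm_geom tau b xA). Qed.

Lemma vser_periodic_int tau b x (k : int) : vser tau b (x + 2 * pi * k%:~R) = vser tau b x.
Proof.
rewrite -[RHS](int_sum_shift _ k); apply: eq_int_sum => m.
rewrite /vterm (_ : x + 2 * pi * k%:~R + 2 * pi * m%:~R = x + 2 * pi * (m + k)%:~R)//.
by rewrite intrD; ring.
Qed.

Lemma vser_periodic tau b x : vser tau b (x + 2 * pi) = vser tau b x.
Proof. by rewrite -(vser_periodic_int tau b x 1) mulr1. Qed.

Lemma vrate_cvg0 (C e : R) : 0 < e -> exists M0 : nat, forall M, (M0 <= M)%N -> C * vrate ^+ M <= e.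
Proof.
move=> e0; have [r0 r1] := andP vrate_bounds.
have c : (fun M => C * vrate ^+ M) @ \oo --> C * 0.
  apply: cvgM; first exact: cvg_cst.
  by apply: cvg_expr; rewrite ger0_norm.
rewrite mulr0 in c; move/cvgr_le : c => /(_ _ e0) [M0 _ H].
by exists M0 => M MM; exact: H.
Qed.

Lemma continuous_vterm tau b m : continuous (fun x => vterm tau b x m).
Proof.
have ca : continuous (fun x : R => x + 2 * pi * m%:~R).
  by move=> x; apply: cvgD; [exact: cvg_id|exact: cvg_cst].
move=> x; apply: cvgM.
  apply: (@continuous_comp _ _ _ (fun x => x + 2 * pi * m%:~R) g); first exact: ca.
  by apply: continuous_normal_pdf; rewrite gt_eqF// edge_sd_gt0.
apply: (continuous_cos_comp (f := fun x => tau * (x + 2 * pi * m%:~R) + b)) => {}x.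
apply: cvgD; last exact: cvg_cst.
by apply: cvgM; [exact: cvg_cst|exact: ca].
Qed.

Lemma continuous_sym_sum_vterm tau b M : continuous (fun x => sym_sum (vterm tau b x) M).
Proof.
move=> x; apply: cvgD.
  by apply: (@continuous_sum _ _ _ (fun k x => vterm tau b x (Posz (nat_of_ord k)))) => k; exact: continuous_vterm.
by apply: (@continuous_sum _ _ _ (fun k x => vterm tau b x (Negz (nat_of_ord k)))) => k; exact: continuous_vterm.
Qed.

Lemma continuous_vser tau b : continuous (vser tau b).
Proof.
move=> x; apply/cvgrPdist_le => e e0.
have e3 : 0 < e / 3 by lra.
have [M HM] := vrate_cvg0 (2 * vcst (`|x| + 1) / (1 - vrate)) e3.
have tl y : `|y| <= `|x| + 1 -> `|vser tau b y - sym_sum (vterm tau b y) M| <= e / 3.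
  by move=> yx; apply: le_trans (vser_tail _ _ _ yx) (HM M _).
have := @continuous_sym_sum_vterm tau b M x => /cvgrPdist_le/(_ _ e3) H.
near=> y.
have yx : `|y| <= `|x| + 1.
  have : `|x - y| <= 1 by near: y; apply: cvgr_dist_le; [exact: cvg_id|].
  have : `|y| <= `|x| + `|x - y| by rewrite -{1}(subKr x y); exact: ler_normB.
  lra.
have t1 := tl x _; have t2 := tl y yx.
have {}t1 : `|vser tau b x - sym_sum (vterm tau b x) M| <= e / 3 by apply: t1; rewrite lerDl.
have t3 : `|sym_sum (vterm tau b x) M - sym_sum (vterm tau b y) M| <= e / 3 by near: y; exact: H.
have -> : vser tau b x - vser tau b y = (vser tau b x - sym_sum (vterm tau b x) M) +
  (sym_sum (vterm tau b x) M - sym_sum (vterm tau b y) M) - (vser tau b y - sym_sum (vterm tau b y) M) by ring.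
apply: le_trans (ler_normB _ _) _; have := ler_normD (vser tau b x - sym_sum (vterm tau b x) M) (sym_sum (vterm tau b x) M - sym_sum (vterm tau b y) M).
by lra.
Unshelve. all: by end_near. Qed.

Lemma short_arcE (x : R) : - pi <= short_arc x <= pi.
Proof.
have pi0 := pi_gt0 R; rewrite /short_arc.
set c := Num.ceil _; have := Num.Theory.ceil_itv ((x - pi) / (2 * pi)).
rewrite -/c => /andP[h1 h2].
have p2 : 0 < 2 * pi :> R by lra.
have h3 : 2 * pi * (c - 1)%:~R < x - pi by rewrite mulrC -ltr_pdivlMr.
have h4 : x - pi <= 2 * pi * c%:~R by rewrite mulrC -ler_pdivrMr.
by rewrite intrB in h3; apply/andP; split; lra.
Qed.

Lemma vser_short_arc tau b x : vser tau b x = vser tau b (short_arc x).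
Proof. by rewrite /short_arc -mulrN -mulrNz vser_periodic_int. Qed.

(** After reduction of x to [- pi, pi], the first summand bounds the term m = 0 and the second the
    tail beyond it; neither depends on tau or b. *)
Definition vbound : R := vcst pi + 2 * vcst pi / (1 - vrate).

Lemma vser_bounded tau b x : `|vser tau b x| <= vbound.
Proof.
rewrite vser_short_arc; have := short_arcE x; rewrite -ler_norml => xpi.
have := vser_tail tau b 0 xpi; rewrite expr0 mulr1 /sym_sum big_ord_recl !big_ord0 !addr0 => h.
rewrite -(subrK (vterm tau b (short_arc x) 0) (vser tau b (short_arc x))).
apply: le_trans (ler_normD _ _) _; rewrite /vbound addrC lerD//.
by have := vterm_geom tau b xpi 0; rewrite expr0 mulr1.
Qed.

Lemma bmf_vser tau b : bmf (vser tau b).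
Proof. exact: continuous_bmf (@continuous_vser tau b) (vser_bounded tau b). Qed.

(* Poisson summation in disguise. *)
Lemma vser_unfold tau b (n : int) c M :
  tint (fun x => sym_sum (vterm tau b x) M * cos (n%:~R * x + c)) =
  \int[mu]_(y in `[- (pi * (M.*2.+1)%:R), pi * (M.*2.+1)%:R])
    (g y * (cos (tau * y + b) * cos (n%:~R * y + c))).
Proof.
have pi0 := pi_gt0 R.
pose h y := g y * (cos (tau * y + b) * cos (n%:~R * y + c)).
have cg : continuous g by apply: continuous_normal_pdf; rewrite gt_eqF// edge_sd_gt0.
have ch : continuous h.
  move=> y; apply: cvgM; first exact: cg.
  by apply: cvgM; exact: (continuous_cos_comp (@continuous_affine _ _ _)).
have [H dH] := antiderivative_local (pi * (M.*2.+2)%:R) ch.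
have tS (m : int) : (`|m| <= M)%N ->
    tint (fun x => h (x + 2 * pi * m%:~R)) = H (pi + 2 * pi * m%:~R) - H (- pi + 2 * pi * m%:~R).
  move=> mM; have pie : - pi < pi :> R by lra.
  have mM' : `|m%:~R| <= M%:R :> R.
    by rewrite -intr_norm -natr_absz ler_nat.
  apply: (FTC_local (F := fun x => H (x + 2 * pi * m%:~R)) pie).
    move=> x; apply: (@continuous_comp _ _ _ (fun x => x + 2 * pi * m%:~R) h); last exact: ch.
    by apply: cvgD; [exact: cvg_id|exact: cvg_cst].
  move=> x xpi; apply: der_eq (der_comp (dH _ _) (derD (der_id x) (der_cst x _))) _; last by rewrite addr0 mulr1.
  rewrite -ltr_norml; apply: le_lt_trans (ler_normD _ _) _.
  have xp : `|x| <= pi by rewrite ler_norml.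
  rewrite normrM (ger0_norm (_ : 0 <= 2 * pi)) ?mulr_ge0 ?pi_ge0//.
  have : 2 * pi * `|m%:~R| <= 2 * pi * M%:R :> R by rewrite ler_pM2l// mulr_gt0.
  have -> : (M.*2.+2)%:R = M%:R * 2 + 2 :> R by rewrite -[M.*2.+2]addn2 -muln2 natrD natrM.
  by move: xp; lra.
have bt (m : int) : bmf (fun x : R => h (x + 2 * pi * m%:~R)).
  apply: (continuous_bmf (B := normal_peak edge_sd)).
    move=> x; apply: (@continuous_comp _ _ _ (fun x => x + 2 * pi * m%:~R) h); last exact: ch.
    by apply: cvgD; [exact: cvg_id|exact: cvg_cst].
  move=> x; rewrite /h normrM ger0_norm ?normal_pdf_ge0//.
  apply: le_trans (normal_pdf_ub 0 (x + 2 * pi * m%:~R) (lt0r_neq0 edge_sd_gt0)).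
  rewrite ler_piMr ?normal_pdf_ge0// normrM.
  by apply: mulr_ile1 => //; rewrite ler_norml cos_geN1 cos_le1.
have tE (x : R) m : vterm tau b x m * cos (n%:~R * x + c) = h (x + 2 * pi * m%:~R).
  rewrite /vterm /h -[LHS]mulrA; congr (_ * (_ * _)).
  rewrite -(cosD2pi_int (n%:~R * x + c) (n * m)); congr (cos _).
  by rewrite intrM; ring.
have -> : tint (fun x => sym_sum (vterm tau b x) M * cos (n%:~R * x + c)) =
    sym_sum (fun m => tint (fun x => h (x + 2 * pi * m%:~R))) M.
  rewrite /sym_sum -!tint_sum// -tintD; try by apply: bmf_sum.
  apply: eq_tint => x; rewrite mulrDl !mulr_suml.
  by congr (_ + _); apply: eq_bigr => k _; exact: tE.
(* The windows of length 2 pi centred at 2 pi m, for |m| <= K, tile a symmetric interval, so the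
   increments of [H] telescope. *)
have tel K : (K <= M)%N -> sym_sum (fun m => tint (fun x => h (x + 2 * pi * m%:~R))) K =
    H (pi * (K.*2.+1)%:R) - H (- (pi * (K.*2.+1)%:R)).
  elim: K => [|K IH] KM.
    rewrite /sym_sum big_ord_recl !big_ord0 !addr0 tS//= mulr0 !addr0.
    by rewrite mulr1.
  rewrite /sym_sum in IH *.
  rewrite big_ord_recr/= [X in _ + X]big_ord_recr/= addrACA IH ?(ltnW KM)// !tS//=.
  have -> : pi + 2 * pi * (Posz K.+1)%:~R = pi * (K.+1.*2.+1)%:R :> R.
    by rewrite -[(K.+1.*2.+1)%N]addn1 -muln2 natrD natrM; ring.
  have -> : - pi + 2 * pi * (Posz K.+1)%:~R = pi * (K.*2.+1)%:R :> R.
    by rewrite -[(K.*2.+1)%N]addn1 -muln2 natrD natrM -[(Posz K.+1)%:~R]/(K.+1%:R) -(natr1 K); ring.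
  have -> : pi + 2 * pi * (Negz K)%:~R = - (pi * (K.*2.+1)%:R) :> R.
    by rewrite NegzE mulrNz -[(K.*2.+1)%N]addn1 -muln2 natrD natrM -[(Posz K.+1)%:~R]/(K.+1%:R) -(natr1 K); ring.
  have -> : - pi + 2 * pi * (Negz K)%:~R = - (pi * (K.+1.*2.+1)%:R) :> R.
    by rewrite NegzE mulrNz -[(K.+1.*2.+1)%N]addn1 -muln2 natrD natrM; ring.
  ring.
rewrite tel//; apply/esym; apply: FTC_local => //.
  by rewrite -subr_gt0 opprK addr_gt0// mulr_gt0.
move=> x /andP[x1 x2]; apply: dH.
have : pi * (M.*2.+1)%:R < pi * (M.*2.+2)%:R :> R by rewrite ltr_pM2l// ltr_nat.
lra.
Qed.

(** Both sides of [vser_unfold] pass to the limit; the product of cosines then splits into Gaussian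
    characteristic functions at tau + n and tau - n. *)
Lemma vser_fourier tau b (n : int) c :
  tint (fun x => vser tau b x * cos (n%:~R * x + c)) =
  2^-1 * (expR (- ((tau + n%:~R) ^+ 2 / (2 * kap))) * cos (b + c) +
          expR (- ((tau - n%:~R) ^+ 2 / (2 * kap))) * cos (b - c)).
Proof.
have pi0 := pi_gt0 R.
pose h y := g y * (cos (tau * y + b) * cos (n%:~R * y + c)).
pose u (M : nat) := tint (fun x => sym_sum (vterm tau b x) M * cos (n%:~R * x + c)).
have bc : bmf (fun x : R => cos (n%:~R * x + c)) := bmf_cos_affine _ _.
have hi : mu.-integrable setT (EFin \o h).
  by apply: gauss_integrableM; apply: bmfM; exact: bmf_cos_affine.
have L1 : u @ \oo --> \int[mu]_y h y.
  have -> : u = fun M => \int[mu]_(y in `[- (pi * (M.*2.+1)%:R), pi * (M.*2.+1)%:R]) h y.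
    by apply/funext => M; exact: vser_unfold.
  apply: (line_integral_cvg hi (u := fun M => pi * (M.*2.+1)%:R)).
  apply/cvgryPge => A; near=> M.
  have : A / pi <= M%:R by near: M; exact: nbhs_infty_ger.
  rewrite ler_pdivrMr// => h1; apply: le_trans h1 _; rewrite mulrC ler_pM2l// ler_nat.
  by rewrite -addnn; lia.
have L2 : u @ \oo --> tint (fun x => vser tau b x * cos (n%:~R * x + c)).
  apply/cvgrPdist_le => e e0.
  have e2 : 0 < e / (2 * pi) by rewrite divr_gt0// mulr_gt0.
  have [M0 HM] := vrate_cvg0 (2 * vcst pi / (1 - vrate)) e2.
  near=> M; have MM : (M0 <= M)%N by near: M; exact: nbhs_infty_ge.
  (* The tail bound holds for |x| <= pi only; the indicator of the period makes it global without
     changing the integrals. *)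
  have bS : bmf (fun x => \1_`[- pi, pi]%classic x * (vser tau b x - sym_sum (vterm tau b x) M)).
    split.
      apply: measurable_funM; first exact: measurable_indic.
      by apply: continuous_measurable_fun => x; apply: cvgB; [exact: continuous_vser|exact: continuous_sym_sum_vterm].
    exists (e / (2 * pi)) => x; rewrite indicE; case: (boolP (x \in _)) => [|_]; last by rewrite mul0r normr0 ltW.
    rewrite mul1r.
    move=> /set_mem; rewrite /= in_itv/= -ler_norml => xpi.
    by apply: le_trans (vser_tail _ _ _ xpi) (HM M MM).
  have loc (f : R -> R) : tint f = tint (fun x => \1_`[- pi, pi]%classic x * f x).
    by apply: eq_Rintegral => x xpi; rewrite indicE xpi mul1r.
  have bSS : bmf (fun x => \1_`[- pi, pi]%classic x * sym_sum (vterm tau b x) M).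
    apply: eq_bmf (bmfB (bmfM (_ : bmf (\1_`[- pi, pi]%classic : R -> R)) (bmf_vser tau b)) bS).
      by move=> x /=; ring.
    split; first exact: measurable_indic.
    by exists 1 => x; rewrite indicE; case: (_ \in _); rewrite ?normr1 ?normr0.
  have bI : bmf (fun x => \1_`[- pi, pi]%classic x * vser tau b x).
    by apply: eq_bmf (bmfD bS bSS) => x; ring.
  rewrite /u loc [X in _ - X]loc -tintB; last 2 first.
  - by apply: eq_bmf (bmfM bI bc) => x; rewrite mulrA.
  - by apply: eq_bmf (bmfM bSS bc) => x; rewrite mulrA.
  apply: (@le_trans _ _ (tint (fun _ : R => e / (2 * pi)))); last first.
    rewrite tint_cst; suff -> : 2 * pi * (e / (2 * pi)) = e by [].
    by field; lra.
  rewrite (eq_tint (g := fun x => \1_`[- pi, pi]%classic x * (vser tau b x - sym_sum (vterm tau b x) M) * cos (n%:~R * x + c))); last by move=> x; ring.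
  apply: tint_norm_le; [exact: bmfM|exact: bmf_cst|move=> x].
  rewrite normrM; apply: (@le_trans _ _ (e / (2 * pi) * 1)); last by rewrite mulr1.
  apply: ler_pM => //; last by rewrite ler_norml cos_geN1 cos_le1.
  rewrite indicE; case: (boolP (x \in _)) => [|_]; last by rewrite mul0r normr0 ltW.
    rewrite mul1r.
  move=> /set_mem; rewrite /= in_itv/= -ler_norml => xpi.
  by apply: le_trans (vser_tail _ _ _ xpi) (HM M MM).
rewrite (cvg_unique _ L2 L1)//.
have i2 s d : mu.-integrable setT (EFin \o (fun y => g y * cos (s * y + d))).
  by apply: gauss_integrableM; exact: bmf_cos_affine.
transitivity (\int[mu]_y (2^-1 * (g y * cos ((tau + n%:~R) * y + (b + c)) + g y * cos ((tau - n%:~R) * y + (b - c))))).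
  apply: eq_Rintegral => y _; rewrite /h.
  have -> : (tau + n%:~R) * y + (b + c) = (tau * y + b) + (n%:~R * y + c) by ring.
  have -> : (tau - n%:~R) * y + (b - c) = (tau * y + b) - (n%:~R * y + c) by ring.
  move: (tau * y + b) (n%:~R * y + c) => A B.
  by rewrite cosD cosB; field.
have iD := integrableD measurableT (i2 (tau + n%:~R) (b + c)) (i2 (tau - n%:~R) (b - c)).
rewrite RintegralZl//; congr (_ * _); rewrite RintegralD//.
rewrite !gauss_char ?edge_sd_gt0// edge_sd_sqr.
by congr (expR (- _) * _ + expR (- _) * _); field; rewrite gt_eqF.
Unshelve. all: by end_near. Qed.
End villain_series.

(** * Convergence of the weight of one edge with an observable *)

Section villain_edge.
Context (R : realType).

(* A linear observable p x_j + q x_k + a of the angles along an edge; sd_t and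
   sd_s are the positions on the metric edge of the sites j and k. *)
Record edge_obs := EdgeObs { eo_p : int; eo_q : int; eo_site : site_data R; eo_a : R }.

(** The three pairs stand for no observed point on the edge, one, or two whose angles are
    subtracted. As they are finitely many, a rank depending on (p, q) can be made uniform. *)
Definition obs_valid (N : nat) (o : edge_obs) : Prop :=
  site_valid N (eo_site o) /\
  ((eo_p o, eo_q o) \in ([:: (0, 0); (1, 0); (1, - 1)] : seq (int * int))).

(** kap times the variance of p W_t + q W_s for the bridge W of the edge with t <= s, where min (t,
    s) - t s = t (1 - s). *)
Definition obs_var (o : edge_obs) : R :=
  let p := (eo_p o)%:~R in let q := (eo_q o)%:~R in
  let t := sd_t (eo_site o) in let s := sd_s (eo_site o) in
  p ^+ 2 * (t * (1 - t)) + q ^+ 2 * (s * (1 - s)) + 2 * p * q * (t * (1 - s)).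

(** The coefficient of the lifted increment of the angle along the edge in the mean of the
    observable. *)
Definition obs_tau (o : edge_obs) : R :=
  (eo_p o)%:~R * sd_t (eo_site o) + (eo_q o)%:~R * sd_s (eo_site o).

(** The Villain weight times the bridge expectation of the cosine, summed over windings, for end
    angles u and y. It carries the peak of the normal density, a factor that cancels in the final
    quotient. *)
Definition vil_edge (kap : R) (o : edge_obs) (u y : R) : R :=
  expR (- (obs_var o / (2 * kap))) *
  vser kap (obs_tau o) ((eo_p o + eo_q o)%:~R * u + eo_a o) (y - u).

Definition xy_edge (kap : R) (N : nat) (I : finType) (sg : nat -> I) (o : edge_obs) : (I -> R) -> R :=
  edge_fun kap N sg (eo_p o) (eo_q o) (sd_j (eo_site o)) (sd_k (eo_site o)) (eo_a o).

Lemma obs_var_ge0 N o : obs_valid N o -> 0 <= obs_var o.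
Proof.
case: o => p q [j k t s] a [[/= _ _ [/andP[t0 ts] s1] _ _]].
have t1 : t <= 1 by exact: le_trans s1.
have h1 : 0 <= t * (1 - t) by rewrite mulr_ge0//; lra.
(* This is the value of [obs_var] for (p, q) = (1, - 1). *)
have h2 : 0 <= (s - t) * (1 - (s - t)) by rewrite mulr_ge0//; lra.
rewrite !inE => /or3P[] /eqP[-> ->]; rewrite /obs_var /=; lra.
Qed.

Context (kap : R) (kap0 : 0 < kap).

(** [bmf_vser] gives measurability in the increment for a fixed phase; splitting the phase off
    extends it to phases that depend on the angles. *)
Lemma vser_split tau b x : vser kap tau b x =
  cos b * vser kap tau 0 x - sin b * vser kap tau (- (pi / 2)) x.
Proof.
have s1 := vterm_summable kap0 tau 0 x; have s2 := vterm_summable kap0 tau (- (pi / 2)) x.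
rewrite /vser -mulNr -!int_sumZ// -int_sumD; [|exact: isummableZ|exact: isummableZ].
apply: eq_int_sum => m; rewrite /vterm addr0 cosBpihalf cosD; ring.
Qed.

Lemma vil_edge_le N o u y : obs_valid N o -> `|vil_edge kap o u y| <= vbound kap.
Proof.
move=> vo; rewrite /vil_edge normrM ger0_norm ?expR_ge0//.
apply: (le_trans _ (vser_bounded kap0 (obs_tau o) ((eo_p o + eo_q o)%:~R * u + eo_a o) (y - u))).
rewrite ler_piMl//.
by rewrite -expR0 ler_expR oppr_le0 divr_ge0 ?(obs_var_ge0 vo)// mulr_ge0// ltW.
Qed.

Lemma cbm_vil_edge N o (V : finType) (v w : V) : obs_valid N o ->
  cbm (fun th : V -> R => vil_edge kap o (th v) (th w)).
Proof.
move=> vo; split; last by exists (vbound kap) => th; exact: vil_edge_le vo.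
have mv (x : V) : measurable_fun setT (fun th : conf R V => th x) := measurable_coord x.
have md : measurable_fun setT (fun th : conf R V => th w - th v) by exact: measurable_funB.
have mb : measurable_fun setT (fun th : conf R V => (eo_p o + eo_q o)%:~R * th v + eo_a o).
  by apply: measurable_funD => //; apply: measurable_funM.
have ms b : measurable_fun setT (fun th : conf R V => vser kap (obs_tau o) b (th w - th v)).
  exact: (measurableT_comp (bmf_vser kap0 _ b).1 md).
rewrite /vil_edge; apply: measurable_funM => //.
apply: (eq_measurable_fun (fun th : conf R V =>
  cos ((eo_p o + eo_q o)%:~R * th v + eo_a o) * vser kap (obs_tau o) 0 (th w - th v) -
  sin ((eo_p o + eo_q o)%:~R * th v + eo_a o) * vser kap (obs_tau o) (- (pi / 2)) (th w - th v))).
  by move=> th _; rewrite [RHS]vser_split.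
apply: measurable_funB; apply: measurable_funM => //.
- exact: (bmf_cos mb).1.
- exact: (bmf_sin mb).1.
Qed.

Lemma vil_edge_fourier o u (n : nat) x :
  tint (fun y => vil_edge kap o u y * cos (n%:R * (y - x))) =
  2^-1 * (vil_coef kap (eo_p o) (eo_q o) (sd_t (eo_site o)) (sd_s (eo_site o)) n *
    cos ((n%:Z + eo_p o + eo_q o)%:~R * u + (eo_a o - n%:R * x)) +
  vil_coef kap (eo_p o) (eo_q o) (sd_t (eo_site o)) (sd_s (eo_site o)) (- n%:Z) *
    cos ((- n%:Z + eo_p o + eo_q o)%:~R * u + (eo_a o + n%:R * x))).
Proof.
case: o => p q [j k t s] a; rewrite /vil_edge /=.
set tau := obs_tau _; set v := obs_var _; set b := _ * u + a.
have bc : bmf (fun y : R => vser kap tau b y * cos (n%:Z%:~R * y + (n%:R * u - n%:R * x))).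
  by apply: bmfM; [exact: bmf_vser|exact: bmf_cos_affine].
transitivity (tint (fun y => expR (- (v / (2 * kap))) * (vser kap tau b y * cos (n%:Z%:~R * y + (n%:R * u - n%:R * x))))).
  rewrite -(@tint_shift _ (fun y => expR (- (v / (2 * kap))) * vser kap tau b (y - u) * cos (n%:R * (y - x))) u); first last.
  - move=> y; rewrite addrAC vser_periodic; congr (_ * _).
    have -> : n%:R * (y + 2 * pi - x) = n%:R * (y - x) + 2 * pi * n%:Z%:~R :> R by ring.
    by rewrite cosD2pi_int.
  - move=> y; apply: cvgM.
      apply: cvgM; first exact: cvg_cst.
      apply: (@continuous_comp _ _ _ (fun y => y - u) (vser kap tau b)); last exact: continuous_vser.
      by apply: cvgB; [exact: cvg_id|exact: cvg_cst].
    apply: (continuous_cos_comp (f := fun y => n%:R * (y - x))) => {}y.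
    by apply: cvgM; [exact: cvg_cst|apply: cvgB; [exact: cvg_id|exact: cvg_cst]].
  apply: eq_tint => y; rewrite addrK mulrA; congr (_ * cos _).
  by rewrite -[n%:Z%:~R]/(n%:R); ring.
rewrite tintZ// vser_fourier// mulrCA; congr (_ * _); rewrite mulrDr !mulrA -!expRD.
(* For a variable equal to m + p + q, m + q, m with probabilities t, s - t, 1 - s, the mean is m +
   tau and the variance is [obs_var]; the right-hand side contains its second moment. *)
have E (m : R) : expR (- (v / (2 * kap)) + - ((tau + m) ^+ 2 / (2 * kap))) =
   expR (- (((m + p%:~R + q%:~R) ^+ 2 * t + (m + q%:~R) ^+ 2 * (s - t) + m ^+ 2 * (1 - s)) / (2 * kap))).
  by congr expR; rewrite /v /tau /obs_var /obs_tau /=; field; rewrite gt_eqF.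
rewrite E; have -> : tau - n%:Z%:~R = tau + (- n%:Z)%:~R by rewrite mulrNz.
rewrite E /vil_coef !intrD; congr (_ * cos _ + _ * cos _); rewrite /b !intrD.
- by rewrite -[n%:Z%:~R]/(n%:R); ring.
- by rewrite mulrNz -[n%:Z%:~R]/(n%:R); ring.
Qed.

Lemma vil_edge_periodic o u y : vil_edge kap o u (y + 2 * pi) = vil_edge kap o u y.
Proof. by rewrite /vil_edge addrAC vser_periodic. Qed.

Lemma continuous_vil_edge o u : continuous (vil_edge kap o u).
Proof.
move=> y; apply: cvgM; first exact: cvg_cst.
apply: (@continuous_comp _ _ _ (fun y => y - u)); last exact: continuous_vser.
by apply: cvgB; [exact: cvg_id|exact: cvg_cst].
Qed.

(** The rank is fixed before the type of sites and their labelling, since the sites themselves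
    depend on N. The three possible pairs (p, q) give three ranks, and the factor pi cancels the one
    in [edge_fun_dist]. *)
Lemma edge_cvg (e : R) : 0 < e -> exists N0, forall N, (N0 <= N)%N ->
  forall (I : finType) (sg : nat -> I),
  (forall x y, (x <= N)%N -> (y <= N)%N -> sg x = sg y -> x = y) ->
  forall o, obs_valid N o -> forall c,
  `|xy_edge kap N sg o c - vil_edge kap o (c (sg 0%N)) (c (sg N))| <= e.
Proof.
move=> e0; have e1 : 0 < e * pi by rewrite mulr_gt0// pi_gt0.
have [N1 H1] := coef_sum_cvg kap0 0 0 e1.
have [N2 H2] := coef_sum_cvg kap0 1 0 e1.
have [N3 H3] := coef_sum_cvg kap0 1 (- 1) e1.
exists (maxn N1 (maxn N2 N3)) => N; rewrite !geq_max => /and3P[h1 h2 h3] I sg sg_inj.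
move=> [p q x a] vo c; have [[N0 /andP[jk kN] _ _ _] pq] := vo.
have HS : forall M, \sum_(n < M) (`|xy_coef kap p q N (sd_j x) (sd_k x) n%:Z - vil_coef kap p q (sd_t x) (sd_s x) n%:Z| +
    `|xy_coef kap p q N (sd_j x) (sd_k x) (- n%:Z) - vil_coef kap p q (sd_t x) (sd_s x) (- n%:Z)|) <= e * pi.
  have vx : site_valid N x := vo.1.
  by move: pq; rewrite !inE => /or3P[] /eqP[-> ->]; [exact: H1|exact: H2|exact: H3].
rewrite (_ : e = e * pi / pi); last by rewrite mulfK// gt_eqF// pi_gt0.
apply: (edge_fun_dist kap0 N0 sg_inj jk kN (V := vil_edge kap (EdgeObs p q x a) (c (sg 0%N)))
  (b := vil_coef kap p q (sd_t x) (sd_s x))) => //.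
- exact: continuous_vil_edge.
- apply: (continuous_bmf (B := vbound kap)); first exact: continuous_vil_edge.
  by move=> y; exact: vil_edge_le vo.
- by move=> y; exact: vil_edge_periodic.
- by move=> n y; exact: vil_edge_fourier.
Qed.
End villain_edge.

(** * The extended XY model *)

Section factorization.
Context (R : realType) (I : finType).
Implicit Types (F G : (I -> R) -> R) (s : seq I) (c : I -> R).
Local Notation it := (iterated_seq (@tint R)).

Lemma big_enumT (E : finType) (f : E -> R) : \prod_(e <- enum E) f e = \prod_e f e.
Proof. by rewrite big_enum. Qed.

Lemma cbm_prod (E : Type) (es : seq E) (F : E -> (I -> R) -> R) :
  (forall e, cbm (F e)) -> cbm (fun c => \prod_(e <- es) F e c).
Proof.
by move=> bF; apply: (@bmf_prod R _ (conf R I) E es xpredT F) => e _; exact: bF.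
Qed.

(** The variables of a block enter its own factor only, so the other factors are pulled out of the
    integral over that block. *)
Lemma it_prod (E : eqType) (es : seq E) (bl : E -> seq I) (F : E -> (I -> R) -> R) c :
  uniq es -> (forall e, cbm (F e)) ->
  (forall e e' i, e != e' -> i \in bl e -> indep i (F e')) ->
  it (flatten [seq bl e | e <- es]) (fun c => \prod_(e <- es) F e c) c =
  \prod_(e <- es) it (bl e) (F e) c.
Proof.
move=> + bF iF; elim: es c => [|e es IH] c /=; first by rewrite !big_nil.
move=> /andP[ees ues]; rewrite it_cat big_cons.
have bP := cbm_prod es bF.
have E1 : it (flatten [seq bl e | e <- es]) (fun c => \prod_(e <- e :: es) F e c) =1
    (fun c => it (flatten [seq bl e | e <- es]) (fun c => \prod_(e <- es) F e c) c * F e c).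
  move=> c'; rewrite mulrC -it_pull//; first by apply: eq_it => c2; rewrite big_cons.
  move=> i /flatten_mapP[e' e'es ie']; apply: (iF e') => //.
  by apply: contraNneq ees => <-.
rewrite (eq_it _ E1) it_pull//; first by rewrite IH// mulrC.
move=> i ie; apply: it_indep; right => c' x; apply: eq_big_seq => e' e'es.
apply: (iF e) => //.
by apply: contraNneq ees => ->.
Qed.

End factorization.

Section site_enumeration.
Context (R : realType) (V : finType) (adj : rel V) (N : nat).
Local Notation S := (site adj N).
Local Notation it := (iterated_seq (@tint R)).

Lemma it_vertices (s : seq V) (H : (V -> R) -> R) (c : S -> R) :
  it [seq (inl v : S) | v <- s] (fun c => H (fun v => c (inl v))) c =
  it s H (fun v => c (inl v)).
Proof.
elim: s c => //= v s IH c; apply: eq_tint => x; rewrite IH; congr (it s H _).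
Qed.

Lemma src_neq_tgt (e : edge adj) : esrc e != etgt e.
Proof.
case: e => [[u v] /= h]; rewrite /esrc /etgt /=.
by case/andP: h => _; apply: contraTneq => ->; rewrite ltnn.
Qed.

(** The indices 0 and N give the two end points, which differ because they are strictly ordered in
    the enumeration of the vertices. *)
Lemma site_at_inj (e : edge adj) x y : (x <= N)%N -> (y <= N)%N ->
  site_at N e x = site_at N e y -> x = y.
Proof.
have st := src_neq_tgt e.
case: x y => [|x] [|y] //= xN yN.
- by case: insubP => // _ [] /eqP; rewrite (negbTE st).
- by case: insubP => // _ [] /esym/eqP; rewrite (negbTE st).
- case: insubP => [i xl ix|xl]; case: insubP => [i' yl iy|yl] //.
    by case=> ii; rewrite -ix -iy ii.
  by move=> _; lia.
Qed.

Lemma site_at_last (e : edge adj) : (0 < N)%N -> site_at N e N = inl (etgt e).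
Proof.
suff H M : M = N -> (0 < N)%N -> site_at N e M = inl (etgt e) by exact: H.
by case: M => [|m] /= MN; [rewrite -MN|case: insubP => //= i; lia].
Qed.

Lemma edge_sites_enum (e : edge adj) :
  edge_sites N (site_at N e) = [seq inr (e, i) | i <- enum 'I_N.-1].
Proof.
rewrite /edge_sites -[X in iota X]addn0 iotaDl -val_enum_ord -!map_comp.
by apply: eq_map => i /=; rewrite valK.
Qed.

(** The enumeration already lists the vertices first and then the edges block by block, so the torus
    integral needs no reordering to factorize. *)
Lemma enum_site : enum (site adj N) = [seq (inl v : S) | v <- enum V] ++
  flatten [seq edge_sites N (site_at N e) | e <- enum (edge adj)].
Proof.
rewrite /site enumT [in LHS]unlock /= /sum_enum -!enumT; congr (_ ++ _).
rewrite [enum _](_ : _ = [seq (e, i) | e <- enum (edge adj), i <- enum 'I_N.-1]).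
  by rewrite map_allpairs; congr flatten; apply: eq_map => e; rewrite edge_sites_enum.
by rewrite [LHS]enumT [in LHS]unlock.
Qed.

Lemma edge_path_disjoint (e e' : edge adj) i x : e != e' -> i \in edge_sites N (site_at N e) ->
  (x <= N)%N -> i != site_at N e' x.
Proof.
move=> ee; rewrite edge_sites_enum => /mapP[j _ ->] xN.
case: x xN => [|x] //= xN; case: insubP => //= y _ _.
by apply: contra ee => /eqP[->].
Qed.

End site_enumeration.

Section extended_XY_factor.
Context (R : realType) (V : finType) (adj : rel V) (J : V -> V -> R) (beta : R).
Context (J_gt0 : forall u v, adj u v -> 0 < J u v) (beta_gt0 : 0 < beta).

Definition edge_coupling (e : edge adj) : R := beta * J (esrc e) (etgt e).
Local Notation kap := edge_coupling.
Local Notation it := (iterated_seq (@tint R)).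

Lemma edge_coupling_gt0 e : 0 < kap e.
Proof. by rewrite mulr_gt0// J_gt0//; case/andP: (valP e). Qed.
Hint Resolve edge_coupling_gt0 : core.

Section fixed_N.
Context (N : nat) (N0 : (0 < N)%N).
Local Notation S := (site adj N).
Local Notation sg := (site_at N).
Implicit Types (c : S -> R) (o : edge adj -> edge_obs R).

Lemma kapN_gt0 e : 0 < kap e * N%:R.
Proof. by rewrite mulr_gt0// ltr0n. Qed.
Hint Resolve kapN_gt0 : core.

Definition edge_chain (e : edge adj) c : R :=
  chain (kap e * N%:R) (sg e 0%N) (edge_path N (sg e)) c.

Definition obs_phase (e : edge adj) (o : edge_obs R) c : R :=
  eo_a o + (eo_p o)%:~R * c (sg e (sd_j (eo_site o))) + (eo_q o)%:~R * c (sg e (sd_k (eo_site o))).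

Definition xy_density c : R := \prod_e edge_chain e c.

Definition xy_integral o : R :=
  it (enum S) (fun c => \prod_e (edge_chain e c * cos (obs_phase e (o e) c))) (fun=> 0).

Lemma edge_chainE e c : edge_chain e c =
  \prod_(j < N) xyK (kap e * N%:R) (c (sg e j.+1) - c (sg e j)).
Proof.
rewrite /edge_chain /edge_path -(big_mkord xpredT (fun j => xyK (kap e * N%:R) (c (sg e j.+1) - c (sg e j)))).
suff H l m : chain (kap e * N%:R) (sg e m) [seq sg e x | x <- iota m.+1 l] c =
    \prod_(m <= j < m + l) xyK (kap e * N%:R) (c (sg e j.+1) - c (sg e j)).
  by rewrite H add0n.
elim: l m => [|l IH] m; first by rewrite addn0 big_geq.
by rewrite addnS big_ltn ?ltnS ?leq_addr// -addSn -IH.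
Qed.

Lemma chord_sqE (a b : R) : chord_sq a b = 2 * (1 - cos (a - b)).
Proof.
rewrite /chord_sq cosB.
transitivity ((cos a ^+ 2 + sin a ^+ 2) + (cos b ^+ 2 + sin b ^+ 2) - 2 * (cos a * cos b + sin a * sin b)); first by ring.
by rewrite !cos2Dsin2; ring.
Qed.

(** The squared chord is 2 (1 - cos), hence each step has the kernel with z = kap N; the masses form
    a constant that cancels in the expectation. *)
Lemma xy_weightE c : xy_weight J beta c = (\prod_e xymass (kap e * N%:R) ^+ N) * xy_density c.
Proof.
rewrite /xy_weight /xy_density -big_split/=; apply: eq_bigr => e _.
rewrite edge_chainE -[X in _ ^+ X](card_ord N) -prodr_const -big_split/=.
rewrite mulr_sumr -sumrN expR_sum; apply: eq_bigr => j _.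
rewrite [RHS]mulrC /xyK divfK ?gt_eqF ?xymass_gt0// /xyk chord_sqE; congr expR.
by rewrite /edge_coupling; field.
Qed.

Lemma edge_chain_ge0 e c : 0 <= edge_chain e c.
Proof. by rewrite edge_chainE; apply: prodr_ge0 => j _; rewrite xyK_ge0. Qed.

Lemma xy_density_ge0 c : 0 <= xy_density c.
Proof. by apply: prodr_ge0 => e _; exact: edge_chain_ge0. Qed.

Lemma cbm_edge_chain e : cbm (edge_chain e).
Proof.
have [b _ _] := regular_chain (kapN_gt0 e) (uniq_edge_path (@site_at_inj _ _ N e)).
exact: b.
Qed.

Lemma cbm_xy_density : cbm xy_density.
Proof. by apply: cbm_prod => e; exact: cbm_edge_chain. Qed.

Lemma measurable_obs_phase e (o : edge_obs R) : measurable_fun setT (obs_phase e o : conf R S -> R).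
Proof.
have mv (x : S) : measurable_fun setT (fun c : conf R S => c x) := measurable_coord x.
by apply: measurable_funD; [apply: measurable_funD => //|]; apply: measurable_funM.
Qed.

(** For fixed vertex angles the interiors of distinct edges do not interact, so the inner integral
    is a product over the edges. *)
Lemma xy_integralE o : (forall e, obs_valid N (o e)) -> xy_integral o =
  it [seq (inl v : S) | v <- enum V] (fun c => \prod_e xy_edge (kap e) N (sg e) (o e) c) (fun=> 0).
Proof.
move=> vo; rewrite /xy_integral enum_site it_cat; apply: eq_it => c.
rewrite (eq_it _ (fun c => esym (big_enumT (fun e => edge_chain e c * cos (obs_phase e (o e) c))))).
rewrite -(big_enumT (fun e => xy_edge (kap e) N (sg e) (o e) c)).
rewrite -(@it_prod R S _ (enum (edge adj)) (fun e => edge_sites N (sg e)) (fun e c => edge_chain e c * cos (obs_phase e (o e) c))).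
- by [].
- exact: enum_uniq.
- move=> e; apply: bmfM; first exact: cbm_edge_chain.
  by apply: bmf_cos; exact: measurable_obs_phase.
- move=> e e' i ee ie c' x.
  have nx y : (y <= N)%N -> update c' i x (sg e' y) = c' (sg e' y).
    by move=> yN; rewrite update_neq// eq_sym (edge_path_disjoint ee).
  have [[_ /andP[jk kN] _ _ _] _] := vo e'.
  rewrite /obs_phase !nx//; last exact: leq_trans kN.
  congr (_ * _); rewrite !edge_chainE; apply: eq_bigr => y _.
  by rewrite !nx// ltnW.
Qed.
End fixed_N.
End extended_XY_factor.

Section short_arc.
Context (R : realType).

Lemma cos_short_arc (d : R) : cos (short_arc d) = cos d.
Proof.
rewrite /short_arc -mulrN -mulrNz.
exact: cosD2pi_int.
Qed.

Lemma cos_normr (x : R) : cos `|x| = cos x.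
Proof. by case: (ger0P x) => // _; rewrite cosN. Qed.

Lemma measurable_short_arc : measurable_fun setT (@short_arc R).
Proof.
apply: measurable_funB; first exact: measurable_id.
apply: measurable_funM; first exact: measurable_cst.
apply: nondecreasing_measurable => // x y xy.
rewrite ler_int; apply: le_ceil; rewrite ler_pM2r ?invr_gt0 ?mulr_gt0 ?pi_gt0//.
by rewrite lerB.
Qed.

(** An arc longer than e has 1 - cos d >= 1 - cos e, so C = pi / (1 - cos e) covers it. This trades
    the arc for a cosine, whose expectation is an [xy_integral]. *)
Lemma short_arc_le (e : R) : 0 < e -> exists2 C, 0 <= C &
  forall d, `|short_arc d| <= e + C * (1 - cos d).
Proof.
move=> e0; have pi0 := pi_gt0 R.
have [epi|pie] := ltP e pi; last first.
  exists 0 => // d; rewrite mul0r addr0 (le_trans _ pie)// ler_norml; exact: short_arcE.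
have ce : cos e < 1.
  by rewrite -(@cos0 R) ltr_cos ?in_itv/= ?lexx ?ltW.
have c1 : 0 < 1 - cos e by rewrite subr_gt0.
exists (pi / (1 - cos e)); first by rewrite divr_ge0// ltW.
move=> d; rewrite -(cos_short_arc d) -[cos (short_arc d)]cos_normr.
have := short_arcE d; rewrite -ler_norml; move: (short_arc d) => s spi.
have [se|es] := leP `|s| e.
  rewrite (le_trans se)// lerDl; apply: mulr_ge0; last by rewrite subr_ge0 cos_le1.
  by rewrite divr_ge0 ?(ltW pi0) ?(ltW c1).
rewrite -[leLHS]add0r lerD ?(ltW e0)// (le_trans spi)// -mulrA ler_peMr ?(ltW pi0)//.
rewrite mulrC ler_pdivlMr// mul1r lerD2l lerN2 ltW//.
by rewrite ltr_cos ?in_itv/= ?normr_ge0 ?spi ?ltW.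
Qed.
End short_arc.

(** K is fixed before a, b and eps, so one constant serves all vertex angles and observables; eps <=
    1 gives |a e| <= B e + 1, whence the recursion for K. *)
Lemma prod_dist (R : realType) (E : Type) (s : seq E) (B : E -> R) :
  (forall e, 0 <= B e) -> exists2 K, 0 <= K & forall (a b : E -> R) (eps : R),
  0 <= eps <= 1 -> (forall e, `|b e| <= B e) -> (forall e, `|a e - b e| <= eps) ->
  `|\prod_(e <- s) a e - \prod_(e <- s) b e| <= eps * K.
Proof.
move=> B0; elim: s => [|e s [K K0 IH]].
  by exists 0 => // a b eps _ _ _; rewrite !big_nil subrr normr0 mulr0.
exists ((B e + 1) * K + \prod_(i <- s) B i).
  by rewrite addr_ge0 ?prodr_ge0// mulr_ge0// addr_ge0.
move=> a b eps /andP[e0 e1] bB ab; rewrite !big_cons.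
have -> : a e * \prod_(i <- s) a i - b e * \prod_(i <- s) b i =
   a e * (\prod_(i <- s) a i - \prod_(i <- s) b i) + (a e - b e) * \prod_(i <- s) b i by ring.
rewrite (le_trans (ler_normD _ _))// [leRHS]mulrDr; apply: lerD; rewrite normrM.
  rewrite mulrCA; apply: ler_pM => //; last by apply: IH; rewrite ?e0.
  have -> : a e = b e + (a e - b e) by ring.
  apply: (le_trans (ler_normD _ _)); apply: lerD; first exact: bB.
  exact: le_trans (ab e) e1.
rewrite ler_pM// normr_prod; elim: s {K K0 IH} => [|i s IH]; first by rewrite !big_nil.
by rewrite !big_cons ler_pM// prodr_ge0.
Qed.

Section XY_limit.
Context (R : realType) (V : finType) (adj : rel V) (J : V -> V -> R) (beta : R).
Context (J_gt0 : forall u v, adj u v -> 0 < J u v) (beta_gt0 : 0 < beta).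
Local Notation it := (iterated_seq (@tint R)).
Local Notation kap := (@edge_coupling R V adj J beta).
Local Notation S N := (site adj N).
Implicit Types (o : edge adj -> edge_obs R) (x y : edge adj * R).

Definition villain_integral o : R :=
  torus_integral (fun th : V -> R => \prod_e vil_edge (kap e) (o e) (th (esrc e)) (th (etgt e))).

Let kap0 e : 0 < kap e := edge_coupling_gt0 J_gt0 beta_gt0 e.

(** Uniform in the observables: [edge_cvg] on each edge, [prod_dist] for the product over edges,
    then integration over a vertex torus of finite volume. *)
Lemma xy_integral_cvg (eps : R) : 0 < eps -> exists N0, forall N, (N0 <= N)%N ->
  forall o, (forall e, obs_valid N (o e)) ->
  `|xy_integral J beta N o - villain_integral o| <= eps.
Proof.
move=> e0; have pi0 : 0 < 2 * pi :> R by rewrite mulr_gt0// pi_gt0.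
have [K K0 HK] := @prod_dist R _ (index_enum (edge adj)) (fun e => vbound (kap e))
  (fun e => le_trans (normr_ge0 _) (vser_bounded (kap0 e) 0 0 0)).
pose C := (2 * pi) ^+ #|V| * K + 1 : R.
have C0 : 0 < C by rewrite ltr_wpDl// mulr_ge0// exprn_ge0 ?ltW.
(* The bound 1 is required by [prod_dist]; C exceeds the volume of the vertex torus times K. *)
pose d := Num.min 1 (eps / C); have d0 : 0 < d by rewrite lt_min ltr01 divr_gt0.
have [N1 HN] := fin_all_exists (fun e => edge_cvg (kap0 e) d0).
exists (maxn 1 (\max_e N1 e)) => N; rewrite geq_max => /andP[N0 NN] o vo.
rewrite (xy_integralE J_gt0 beta_gt0 N0)//.
have -> : villain_integral o = it [seq (inl v : S N) | v <- enum V]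
   (fun c => \prod_e vil_edge (kap e) (o e) (c (inl (esrc e))) (c (inl (etgt e)))) (fun=> 0).
  by rewrite (@it_vertices R V adj N _ (fun th : V -> R => \prod_e vil_edge (kap e) (o e) (th (esrc e)) (th (etgt e)))).
have b1 : cbm (fun c : S N -> R => \prod_e xy_edge (kap e) N (site_at N e) (o e) c).
  by apply: cbm_prod => e; apply: cbm_edge_fun => //; exact: site_at_inj.
have b2 : cbm (fun c : S N -> R => \prod_e vil_edge (kap e) (o e) (c (inl (esrc e))) (c (inl (etgt e)))).
  by apply: cbm_prod => e; exact: (cbm_vil_edge (kap0 e) (inl (esrc e)) (inl (etgt e)) (vo e)).
rewrite -itB//; apply: le_trans (it_norm_le (G := fun=> d * K) _ _ (bmfB b1 b2) (bmf_cst _) _) _.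
  move=> c; apply: HK => [|e|e].
  - by rewrite ltW//= ge_min lexx.
  - exact: (vil_edge_le (kap0 e) _ _ (vo e)).
  - have := HN e N (leq_trans (leq_bigmax e) NN) _ _ (@site_at_inj _ _ N e) _ (vo e) c.
    by rewrite site_at_last.
rewrite it_cst size_map -cardE mulrCA (@le_trans _ _ (d * C))//.
  by rewrite ler_wpM2l ?(ltW d0)// /C lerDl.
by rewrite -ler_pdivlMr// ge_min lexx orbT.
Qed.

Definition trivial_obs : edge_obs R := EdgeObs 0 0 (SiteData 0 0 0 0) 0.

Lemma trivial_obs_valid N : (0 < N)%N -> obs_valid N trivial_obs.
Proof. by move=> N0; split => //=; split; rewrite ?lexx ?ler01 ?mul0r ?subrr ?normr0//=. Qed.

Definition point_obs x (j : nat) (a : R) : edge_obs R := EdgeObs 1 0 (SiteData j j x.2 x.2) a.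

(** The two points are sorted so that the first position is at most the second; the cosine of their
    difference is even, so the exchange is harmless. *)
Definition arc_obs (j k : nat) (t s : R) : edge_obs R :=
  EdgeObs 1 (- 1) (if t <= s then SiteData j k t s else SiteData k j s t) 0.

Definition single_obs e0 (b : edge_obs R) : edge adj -> edge_obs R :=
  fun e => if e == e0 then b else trivial_obs.

(* The product formula cos (a - b) = cos a cos b + cos (a - pi/2) cos (b - pi/2)
   separates two distinct edges; on a common edge the terms for the two values
   of h coincide, whence the factor 1/2 in pair_scale. *)
Definition pair_obs x y (j k : nat) (h : bool) : edge adj -> edge_obs R :=
  if x.1 == y.1 then single_obs x.1 (arc_obs j k x.2 y.2)
  else let a := if h then 0 else - (pi / 2) in
    fun e => if e == x.1 then point_obs x j a else single_obs y.1 (point_obs y k a) e.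

Definition pair_scale x y : R := if x.1 == y.1 then 2^-1 else 1.

(** The Villain integral reads the positions and not the site indices, which are therefore set to
    0. *)
Definition pair_villain x y : R :=
  pair_scale x y * \sum_h villain_integral (pair_obs x y 0 0 h).

(** The left end of the small segment containing x, as in [xy_angle]; the cap at N - 1 keeps the
    right end on the edge when x is its last point. *)
Definition site_index (N : nat) x : nat := minn (Num.truncn (x.2 * N%:R)) N.-1.

Lemma site_indexP N x : (0 < N)%N -> metric_graph x ->
  [/\ (site_index N x < N)%N, 0 <= x.2 * N%:R - (site_index N x)%:R &
   x.2 * N%:R - (site_index N x)%:R <= 1].
Proof.
move=> N0 /andP[x0 x1]; rewrite /site_index.
have NR : 0 < N%:R :> R by rewrite ltr0n.
have n0 : 0 <= x.2 * N%:R by rewrite mulr_ge0.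
have nN : x.2 * N%:R <= N%:R by rewrite ler_piMl.
have /andP[t1 t2] := truncn_itv n0.
split; first by rewrite gtn_min ltn_predL N0 orbT.
- by rewrite subr_ge0 (le_trans _ t1)// ler_nat geq_minl.
- rewrite lerBlDr; have [h|h] := leqP (Num.truncn (x.2 * N%:R)) N.-1.
    by rewrite nat1r ltW.
  by rewrite nat1r prednK.
Qed.

Lemma le_site_index N x y : x.2 <= y.2 -> (site_index N x <= site_index N y)%N.
Proof.
move=> xy; rewrite /site_index leq_min geq_minr andbT (leq_trans (geq_minl _ _))//.
by apply: le_truncn; rewrite ler_wpM2r.
Qed.

Lemma site_index_valid N x y : (0 < N)%N -> metric_graph x -> metric_graph y -> x.2 <= y.2 ->
  site_valid N (SiteData (site_index N x) (site_index N y) x.2 y.2).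
Proof.
move=> N0 mx my xy; have [jx x0 x1] := site_indexP N0 mx; have [jy y0 y1] := site_indexP N0 my.
move: mx my => /andP[mx0 mx1] /andP[my0 my1].
by split => //=; rewrite ?mx0 ?my1 ?xy ?le_site_index ?(ltnW jy) ?ger0_norm.
Qed.

Lemma arc_obs_valid N x y : (0 < N)%N -> metric_graph x -> metric_graph y ->
  obs_valid N (arc_obs (site_index N x) (site_index N y) x.2 y.2).
Proof.
move=> N0 mx my; split; rewrite /arc_obs /=; last by rewrite !inE eqxx !orbT.
by case: (leP x.2 y.2) => [|/ltW] xy; apply: site_index_valid.
Qed.

Lemma point_obs_valid N x a : (0 < N)%N -> metric_graph x ->
  obs_valid N (point_obs x (site_index N x) a).
Proof. by move=> N0 mx; split => //=; exact: site_index_valid. Qed.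

Lemma single_obs_valid N e0 b : (0 < N)%N -> obs_valid N b ->
  forall e, obs_valid N (single_obs e0 b e).
Proof. by move=> N0 vb e; rewrite /single_obs; case: eqP => // _; exact: trivial_obs_valid. Qed.

Lemma pair_obs_valid N x y h : (0 < N)%N -> metric_graph x -> metric_graph y ->
  forall e, obs_valid N (pair_obs x y (site_index N x) (site_index N y) h e).
Proof.
move=> N0 mx my e; rewrite /pair_obs; case: eqP => _.
  by apply: single_obs_valid => //; exact: arc_obs_valid.
by case: eqP => _; [|apply: single_obs_valid => //]; exact: point_obs_valid.
Qed.

Lemma villain_integral_pair x y j k h :
  villain_integral (pair_obs x y j k h) = villain_integral (pair_obs x y 0 0 h).
Proof.
rewrite /villain_integral /torus_integral /iterated; apply: eq_it => th.
apply: eq_bigr => e _; rewrite /pair_obs /single_obs /arc_obs.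
by case: (x.1 == y.1); case: (e == x.1); case: (e == y.1); case: (x.2 <= y.2).
Qed.

End XY_limit.

Section XY_expectation.
Context (R : realType) (V : finType) (adj : rel V) (J : V -> V -> R) (beta : R).
Context (J_gt0 : forall u v, adj u v -> 0 < J u v) (beta_gt0 : 0 < beta).
Local Notation it := (iterated_seq (@tint R)).
Local Notation kap := (@edge_coupling R V adj J beta).
Local Notation S N := (site adj N).
Local Notation VI := (@villain_integral R V adj J beta).
Implicit Types (o : edge adj -> edge_obs R) (x y : edge adj * R).

Let kap0 e : 0 < kap e := edge_coupling_gt0 J_gt0 beta_gt0 e.

Definition vacuum : edge adj -> edge_obs R := fun=> trivial_obs R.

(** Two consecutive sites share the limit position t, so the variance and the mean of their
    difference vanish; hence the mean of 1 - cos of one step tends to 0. *)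
Lemma villain_integral_step e0 j k t : VI (single_obs e0 (arc_obs j k t t)) = VI vacuum.
Proof.
rewrite /villain_integral /torus_integral /iterated; apply: eq_it => th.
apply: eq_bigr => e _; rewrite /single_obs /vacuum; case: eqP => // _.
rewrite /arc_obs lexx /vil_edge /obs_var /obs_tau /=.
congr (expR _ * vser _ _ (_ + _) _); first by field; rewrite gt_eqF.
  by ring.
Qed.

Section fixed_N.
Context (N : nat) (N0 : (0 < N)%N).
Local Notation sg := (site_at N).
Local Notation dens := (@xy_density R V adj J beta N).
Local Notation XI := (@xy_integral R V adj J beta N).
Implicit Types (c : S N -> R).
Local Notation T F := (it (enum (S N)) F (fun=> 0)).

Let bdens : cbm dens := cbm_xy_density J_gt0 beta_gt0 N0.

Lemma obs_phase_trivial (e : edge adj) c : obs_phase e (trivial_obs R) c = 0.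
Proof. by rewrite /obs_phase /= !mul0r !addr0. Qed.

Lemma prod_cos_single e0 b c :
  \prod_e cos (obs_phase e (single_obs e0 b e) c) = cos (obs_phase e0 b c).
Proof.
rewrite (bigD1 e0)//= big1 ?mulr1 /single_obs ?eqxx// => e /negbTE ->.
by rewrite obs_phase_trivial cos0.
Qed.

Lemma cos_arc e0 j k t s c : cos (obs_phase e0 (arc_obs j k t s) c) =
  cos (c (sg e0 j) - c (sg e0 k)).
Proof.
rewrite /obs_phase /arc_obs /=; case: (t <= s) => /=; last rewrite -[RHS]cosN;
  by congr (cos _); rewrite mulr1z mulrN1z; ring.
Qed.

Lemma cos_pairE x y j k c : cos (c (sg x.1 j) - c (sg y.1 k)) =
  pair_scale x y * \sum_h \prod_e cos (obs_phase e (pair_obs x y j k h e) c).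
Proof.
rewrite big_bool /pair_scale /pair_obs; case: eqP => [<-|/eqP xy] /=.
  by rewrite !prod_cos_single cos_arc; field.
have H h : \prod_e cos (obs_phase e (if e == x.1 then point_obs x j h else single_obs y.1 (point_obs y k h) e) c) =
    cos (h + c (sg x.1 j)) * cos (h + c (sg y.1 k)).
  have yx : y.1 != x.1 by rewrite eq_sym.
  rewrite (bigD1 x.1)//= eqxx (bigD1 y.1)//= (negbTE yx).
  rewrite {1}/single_obs eqxx big1 => [|e /andP[/negbTE ex /negbTE ey]].
    by rewrite mulr1 /obs_phase /= !mul1r !mul0r !addr0.
  by rewrite ex /single_obs ey obs_phase_trivial cos0.
rewrite mul1r !H !add0r ![- (pi / 2) + _]addrC !cosBpihalf cosB.
by [].
Qed.

Lemma dens_obsE o c : \prod_e (edge_chain J beta e c * cos (obs_phase e (o e) c)) =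
  dens c * \prod_e cos (obs_phase e (o e) c).
Proof. by rewrite big_split. Qed.

Lemma xy_integral_density o : XI o = T (fun c => dens c * \prod_e cos (obs_phase e (o e) c)).
Proof. by apply: eq_it => c; rewrite dens_obsE. Qed.

Lemma cbm_obs o : cbm (fun c => dens c * \prod_e cos (obs_phase e (o e) c)).
Proof.
apply: bmfM bdens _; apply: cbm_prod => e; apply: bmf_cos; exact: measurable_obs_phase.
Qed.

Lemma xy_integral_pair x y j k :
  T (fun c => dens c * cos (c (sg x.1 j) - c (sg y.1 k))) =
  pair_scale x y * \sum_h XI (pair_obs x y j k h).
Proof.
rewrite big_bool/= !xy_integral_density -itD; [|exact: cbm_obs|exact: cbm_obs].
rewrite -itZ; last by apply: bmfD; exact: cbm_obs.
apply: eq_it => c; rewrite cos_pairE big_bool/=; ring.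
Qed.

Lemma xy_integral_vacuum : XI vacuum = T dens.
Proof.
rewrite xy_integral_density; apply: eq_it => c.
by rewrite big1 ?mulr1// => e _; rewrite obs_phase_trivial cos0.
Qed.

Lemma cbm_site_cos (i i' : S N) : cbm (fun c => dens c * (1 - cos (c i - c i'))).
Proof.
apply: bmfM bdens _; apply: bmfB; first exact: bmf_cst.
by apply: bmf_cos; apply: measurable_funB; exact: measurable_coord.
Qed.

Lemma xy_integral_step e0 j t : T (fun c => dens c * (1 - cos (c (sg e0 j.+1) - c (sg e0 j)))) =
  XI vacuum - XI (single_obs e0 (arc_obs j j.+1 t t)).
Proof.
rewrite xy_integral_vacuum xy_integral_density -itB//; last exact: cbm_obs.
apply: eq_it => c; rewrite prod_cos_single cos_arc -cosN opprB; ring.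
Qed.

Lemma measurable_xy_angle x : measurable_fun setT (fun c : conf R (S N) => xy_angle c x).
Proof.
have mv (i : S N) : measurable_fun setT (fun c : conf R (S N) => c i) := measurable_coord i.
rewrite /xy_angle; apply: measurable_funD => //; apply: measurable_funM => //.
apply: (measurableT_comp (@measurable_short_arc R)); exact: measurable_funB.
Qed.

Lemma cbm_spin_dot x y : cbm (fun c => dens c * spin_dot x y (xy_angle c)).
Proof.
apply: bmfM bdens _; apply: bmf_cos; apply: measurable_funB; exact: measurable_xy_angle.
Qed.

Lemma xy_expectE x y : xy_expect J beta N (spin_dot x y) =
  T (fun c => dens c * spin_dot x y (xy_angle c)) / T dens.
Proof.
rewrite /xy_expect /torus_integral /iterated.
set M := \prod_e xymass (kap e * N%:R) ^+ N.
have M0 : M != 0.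
  by apply/prodf_neq0 => e _; rewrite expf_neq0// gt_eqF// xymass_gt0// kapN_gt0.
have -> : it (enum (S N)) (xy_weight J beta (N := N)) (fun=> 0) = M * T dens.
  by rewrite -itZ//; apply: eq_it => c; exact: (xy_weightE J_gt0 beta_gt0 N0).
have -> : it (enum (S N)) (fun c => xy_weight J beta c * spin_dot x y (xy_angle c)) (fun=> 0) =
    M * T (fun c => dens c * spin_dot x y (xy_angle c)).
  rewrite -itZ; last exact: cbm_spin_dot.
  by apply: eq_it => c; rewrite (xy_weightE J_gt0 beta_gt0 N0) mulrA.
by rewrite -mulf_div divff// mul1r.
Qed.

(** The interpolation weight lies in [0, 1], so moving a point to its left site changes the angle by
    at most one short arc; [C] and [e] are those of [short_arc_le]. *)
Lemma spin_dot_dist c x y (e C : R) : metric_graph x -> metric_graph y ->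
  (forall d, `|short_arc d| <= e + C * (1 - cos d)) ->
  let dc x := c (sg x.1 (site_index N x).+1) - c (sg x.1 (site_index N x)) in
  `|spin_dot x y (xy_angle c) - cos (c (sg x.1 (site_index N x)) - c (sg y.1 (site_index N y)))|
  <= 2 * e + C * (1 - cos (dc x)) + C * (1 - cos (dc y)).
Proof.
move=> mx my HC; cbv zeta; set dc := (fun x => c (sg x.1 (site_index N x).+1) - c (sg x.1 (site_index N x))); rewrite -!/(dc _); apply: (le_trans (cos_lip _ _)).
have D (z : edge adj * R) : metric_graph z -> `|xy_angle c z - c (sg z.1 (site_index N z))| <= e + C * (1 - cos (dc z)).
  move=> mz; have [_ z0 z1] := site_indexP N0 mz.
  rewrite /xy_angle -/(site_index N z) addrAC subrr add0r normrM ger0_norm//.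
  by apply: le_trans (HC _); rewrite ler_piMl.
have -> : xy_angle c x - xy_angle c y - (c (sg x.1 (site_index N x)) - c (sg y.1 (site_index N y))) =
  (xy_angle c x - c (sg x.1 (site_index N x))) - (xy_angle c y - c (sg y.1 (site_index N y))) by ring.
apply: (le_trans (ler_normB _ _)); have := lerD (D _ mx) (D _ my); lra.
Qed.

Lemma step_obs_valid x : metric_graph x ->
  obs_valid N (arc_obs (site_index N x) (site_index N x).+1 x.2 x.2).
Proof.
move=> mx; have [jx x0 x1] := site_indexP N0 mx; case/andP: (mx) => t0 t1.
split; rewrite /arc_obs lexx /=; last by rewrite !inE eqxx !orbT.
split => //=; rewrite ?leqnSn ?jx ?t0 ?lexx// ler_norml -?natr1; lra.
Qed.

(** The integral of 1 - cos of a step is at most 2 eta, the step and the vacuum having the same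
    limit; the two points thus contribute 4 C eta. The final 2 eta comes from the two terms of the
    pair observable. *)
Lemma xy_spin_dot_dist x y (e C eta : R) : metric_graph x -> metric_graph y -> 0 <= C ->
  (forall d, `|short_arc d| <= e + C * (1 - cos d)) ->
  (forall o, (forall e, obs_valid N (o e)) -> `|XI o - VI o| <= eta) ->
  `|T (fun c => dens c * spin_dot x y (xy_angle c)) - pair_villain J beta x y| <=
  2 * e * XI vacuum + 4 * C * eta + 2 * eta.
Proof.
move=> mx my C0 HC Heta.
pose jx := site_index N x; pose jy := site_index N y.
have hp h : `|XI (pair_obs x y jx jy h) - VI (pair_obs x y 0 0 h)| <= eta.
  by rewrite -(villain_integral_pair J beta x y jx jy); apply: Heta => e'; exact: pair_obs_valid.
have h1 : `|pair_scale x y * \sum_h XI (pair_obs x y jx jy h) - pair_villain J beta x y| <= 2 * eta.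
  rewrite /pair_villain -mulrBr !big_bool/= normrM.
  have e0 : 0 <= eta := le_trans (normr_ge0 _) (hp true).
  have s1 : `|pair_scale x y| <= 1.
    by rewrite /pair_scale; case: ifP => _; rewrite ger0_norm// invf_le1// ler1n.
  apply: (@le_trans _ _ (1 * (eta + eta))); last lra.
  apply: ler_pM => //; rewrite opprD addrACA.
  exact: le_trans (ler_normD _ _) (lerD (hp true) (hp false)).
have hv : forall e', obs_valid N (vacuum e') by move=> e'; exact: trivial_obs_valid.
have hs (z : edge adj * R) : metric_graph z -> T (fun c => dens c *
    (1 - cos (c (sg z.1 (site_index N z).+1) - c (sg z.1 (site_index N z))))) <= 2 * eta.
  move=> mz; rewrite (xy_integral_step _ _ z.2).
  have vs := single_obs_valid z.1 N0 (step_obs_valid mz).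
  have := Heta (single_obs _ _) vs; have := Heta vacuum hv; rewrite villain_integral_step !ler_norml; lra.
rewrite -xy_integral_pair in h1.
have bs : cbm (fun c => dens c * cos (c (sg x.1 jx) - c (sg y.1 jy))).
  by apply: bmfM bdens _; apply: bmf_cos; apply: measurable_funB; exact: measurable_coord.
have h2 : `|T (fun c => dens c * spin_dot x y (xy_angle c)) -
   T (fun c => dens c * cos (c (sg x.1 jx) - c (sg y.1 jy)))| <= 2 * e * XI vacuum + C * (2 * eta) + C * (2 * eta).
  rewrite -itB//; last exact: cbm_spin_dot.
  pose G c := 2 * e * dens c + C * (dens c * (1 - cos (c (sg x.1 jx.+1) - c (sg x.1 jx)))) +
     C * (dens c * (1 - cos (c (sg y.1 jy.+1) - c (sg y.1 jy)))).
  have bG1 : cbm (fun c => 2 * e * dens c) by exact: bmfZ.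
  have bG2 z j : cbm (fun c => C * (dens c * (1 - cos (c (sg z j.+1) - c (sg z j))))).
    by apply: bmfZ; exact: cbm_site_cos.
  have bG12 := bmfD bG1 (bG2 x.1 jx); have bG : cbm G := bmfD bG12 (bG2 y.1 jy).
  have bd := bmfB (cbm_spin_dot x y) bs.
  apply: (le_trans (it_norm_le (G := G) _ _ bd bG _)).
    move=> c; rewrite -mulrBr normrM ger0_norm ?xy_density_ge0//.
    have := @spin_dot_dist c x y e C mx my HC; cbv zeta => /(ler_wpM2l (@xy_density_ge0 _ _ _ _ _ J_gt0 beta_gt0 _ N0 c)).
    move/le_trans; apply.
    by rewrite /G le_eqVlt; apply/orP; left; apply/eqP; ring.
  rewrite /G itD// itD// !itZ//; try exact: cbm_site_cos.
  by rewrite xy_integral_vacuum !lerD// ler_wpM2l// hs.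
rewrite -(subrKA (T (fun c => dens c * cos (c (sg x.1 jx) - c (sg y.1 jy))))).
apply: (le_trans (ler_normD _ _)); have := lerD h2 h1; lra.
Qed.

Lemma xy_ratio_le1 x y : `|xy_expect J beta N (spin_dot x y)| <= 1.
Proof.
rewrite xy_expectE; have T0 : 0 <= T dens by apply: it_ge0 => c; exact: xy_density_ge0.
rewrite normrM normfV [`|T dens|]ger0_norm//; have := T0; rewrite le_eqVlt => /predU1P[<-|Tp].
  by rewrite invr0 mulr0.
rewrite ler_pdivrMr// mul1r; apply: (it_norm_le _ _ (cbm_spin_dot x y) bdens).
move=> c; rewrite normrM ger0_norm ?xy_density_ge0// ler_piMr ?xy_density_ge0//.
by rewrite ler_norml cos_geN1 cos_le1.
Qed.

(** In the case of zero mass the numerator, dominated by the mass, vanishes as well, so the identity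
    holds with the convention 0^-1 = 0. *)
Lemma xy_ratio_mul x y : xy_expect J beta N (spin_dot x y) * XI vacuum =
  T (fun c => dens c * spin_dot x y (xy_angle c)).
Proof.
rewrite xy_expectE xy_integral_vacuum; have [T0|T0] := eqVneq (T dens) 0; last by rewrite divfK.
rewrite T0 mulr0; apply/esym/eqP; rewrite -normr_le0 -[leRHS]T0.
apply: (it_norm_le _ _ (cbm_spin_dot x y) bdens).
move=> c; rewrite normrM ger0_norm ?xy_density_ge0// ler_piMr ?xy_density_ge0//.
by rewrite ler_norml cos_geN1 cos_le1.
Qed.
End fixed_N.

Lemma xy_expect_cvg (eps : R) : 0 < VI vacuum -> 0 < eps -> exists N0, forall N, (N0 <= N)%N ->
  forall x y, metric_graph x -> metric_graph y ->
  `|xy_expect J beta N (spin_dot x y) - pair_villain J beta x y / VI vacuum| < eps.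
Proof.
move=> D0 eps0; set D := VI vacuum in D0 *.
(* The XY mass is at most D + 1 once eta <= 1, so the interpolation error 2 e times the mass is at
   most eps D / 4. *)
pose e := eps * D / (8 * (D + 1)).
have D1 : 0 < D + 1 by rewrite addr_gt0.
have e0 : 0 < e by rewrite divr_gt0 ?mulr_gt0.
have [C C0 HC] := short_arc_le e0.
(* In 3 + 4 C, one eta pays for the normalization and the other 2 + 4 C for [xy_spin_dot_dist]. *)
pose eta := Num.min 1 (eps * D / (8 * (3 + 4 * C))).
have C1 : 0 < 3 + 4 * C by lra.
have eta0 : 0 < eta by rewrite lt_min ltr01 divr_gt0 ?mulr_gt0.
have eta1 : eta <= 1 by rewrite ge_min lexx.
have eta2 : eta * (3 + 4 * C) <= eps * D / 8.
  have : eta <= eps * D / (8 * (3 + 4 * C)) by rewrite ge_min lexx orbT.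
  rewrite -(ler_pM2r C1); move/le_trans; apply; rewrite le_eqVlt; apply/orP; left; apply/eqP.
  by field; rewrite gt_eqF.
have [N1 H1] := xy_integral_cvg J_gt0 beta_gt0 eta0.
exists (maxn 1 N1) => N; rewrite geq_max => /andP[N0 NN] x y mx my.
have := xy_spin_dot_dist N0 mx my C0 HC (H1 N NN).
rewrite -(xy_ratio_mul N0); have := xy_ratio_le1 N0 x y.
move: (xy_expect _ _ _ _) => q q1 h.
have hD := H1 N NN vacuum (fun=> trivial_obs_valid R N0); rewrite -/D in hD.
move: (xy_integral _ _ _ _) hD h => DN hD h; set a := pair_villain _ _ _ _ in h *.
(* Only the limit D is divided by; the change of denominator costs |q| |D - DN|, with |q| <= 1. *)
have -> : q - a / D = (q * (D - DN) + (q * DN - a)) / D by field; rewrite gt_eqF.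
rewrite normrM normfV (gtr0_norm D0) ltr_pdivrMr//.
apply: (le_lt_trans (ler_normD _ _)); rewrite normrM distrC.
have h3 : `|q| * `|DN - D| <= 1 * eta by exact: ler_pM.
have h4 : DN <= D + 1 by have : DN - D <= eta := le_trans (ler_norm _) hD; lra.
have h5 : 2 * e * DN <= eps * D / 4.
  apply: (@le_trans _ _ (2 * e * (D + 1))); first by rewrite ler_pM2l// mulr_gt0.
  by rewrite le_eqVlt; apply/orP; left; apply/eqP; rewrite /e; field; rewrite gt_eqF.
have epsD : 0 < eps * D by rewrite mulr_gt0.
have -> : eps * D = eps * D / 4 + eps * D / 8 + 5 / 8 * (eps * D) by field.
lra.
Qed.

End XY_expectation.

(** * The Villain model on the metric graph *)

Section multi_sum.
Context (R : realType) (I : finType).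
Implicit Types (a b : I -> int -> R) (A B : (I -> int) -> R).
Local Notation sm := (iterated_seq (@int_sum R)).

(** A and B accumulate the factors of the coordinates already fixed; the two products are carried
    together because the observable is a sum of two products over the edges. *)
Lemma sum_prod_seq s A B a b c : uniq s ->
  (forall i, isummable (a i)) -> (forall i, isummable (b i)) ->
  (forall c i x, i \in s -> A (update c i x) = A c) ->
  (forall c i x, i \in s -> B (update c i x) = B c) ->
  sm s (fun m => A m * \prod_(i <- s) a i (m i) + B m * \prod_(i <- s) b i (m i)) c =
  A c * \prod_(i <- s) int_sum (a i) + B c * \prod_(i <- s) int_sum (b i).
Proof.
move=> + sa sb; elim: s A B c => [|i s IH] A B c /=; first by rewrite !big_nil.
move=> /andP[is_ us] iA iB.
have E x : sm s (fun m => A m * \prod_(j <- i :: s) a j (m j) + B m * \prod_(j <- i :: s) b j (m j))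
    (update c i x) =
    (A c * \prod_(j <- s) int_sum (a j)) * a i x + (B c * \prod_(j <- s) int_sum (b j)) * b i x.
  under [X in sm s X]funext do rewrite !big_cons !mulrA.
  rewrite (IH (fun m => A m * a i (m i)) (fun m => B m * b i (m i)))//.
  - by rewrite iA ?iB ?mem_head// /update eqxx; ring.
  - move=> c' j y js; rewrite iA ?inE ?js ?orbT// /update ifN//.
    by apply: contraNneq is_ => ->.
  - move=> c' j y js; rewrite iB ?inE ?js ?orbT// /update ifN//.
    by apply: contraNneq is_ => ->.
rewrite (eq_int_sum E) int_sumD; [|exact: isummableZ|exact: isummableZ].
by rewrite !int_sumZ// !big_cons; ring.
Qed.

Lemma multi_int_sum_prod (k : R) a b :
  (forall i, isummable (a i)) -> (forall i, isummable (b i)) ->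
  multi_int_sum (fun m => k * (\prod_i a i (m i) + \prod_i b i (m i))) =
  k * (\prod_i int_sum (a i) + \prod_i int_sum (b i)).
Proof.
move=> sa sb; rewrite /multi_int_sum /iterated mulrDr.
rewrite -(big_enumT (fun i => int_sum (a i))) -(big_enumT (fun i => int_sum (b i))).
rewrite -(@sum_prod_seq (enum I) (fun=> k) (fun=> k) a b (fun=> 0)) ?enum_uniq//.
congr (sm _ _ _); apply/funext => m.
by rewrite (big_enumT (fun i => a i (m i))) (big_enumT (fun i => b i (m i))) mulrDr.
Qed.
End multi_sum.

Lemma expR_cos_eq (R : realType) (a b c d k : R) : a = b -> c = d ->
  expR (- (a / k)) * cos c = expR (- (b / k)) * cos d.
Proof. by move=> -> ->. Qed.

(** * Averaging over the bridges and the windings *)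

Section villain_bridge_expectation.
Context (R : realType) (V : finType) (adj : rel V) (J : V -> V -> R) (beta : R).
Context (J_gt0 : forall u v, adj u v -> 0 < J u v) (beta_gt0 : 0 < beta).
Context (d : measure_display) (Omega : measurableType d) (P : probability Omega R).
Context (W : edge adj -> R -> {RV P >-> R}) (bridgesW : villain_bridges J beta W).
Local Notation kap := (@edge_coupling R V adj J beta).
Local Notation VI := (@villain_integral R V adj J beta).
Implicit Types (o : edge adj -> edge_obs R) (x y : edge adj * R) (e : edge adj) (th : V -> R).

Let kap0 e : 0 < kap e := edge_coupling_gt0 J_gt0 beta_gt0 e.

Lemma bridge_law e t A : 0 <= t <= 1 -> measurable A ->
  P (W e t @^-1` A) = normal_law 0 (t * (1 - t) / kap e) A.
Proof.
move=> t01 mA; have [_ H] := bridgesW.1 e.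
have := H 1%N (fun=> t) (fun=> 1) (fun=> t01) A mA.
rewrite !big_ord1 minxx.
under [X in X @^-1` A]funext do rewrite big_ord1 mul1r.
move=> ->; congr normal_law; rewrite -/(kap e).
by rewrite !mul1r mulrC mulrBr mulr1.
Qed.

Lemma bridge_diff_law e t s A : 0 <= t <= 1 -> 0 <= s <= 1 -> measurable A ->
  P ((fun w => W e t w - W e s w) @^-1` A) =
  normal_law 0 ((t * (1 - t) + s * (1 - s) - 2 * (Num.min t s - t * s)) / kap e) A.
Proof.
move=> t01 s01 mA; have [_ H] := bridgesW.1 e.
pose tt (i : 'I_2) := if i == ord0 then t else s.
pose cc (i : 'I_2) : R := if i == ord0 then 1 else -1.
have tt01 i : 0 <= tt i <= 1 by rewrite /tt; case: ifP.
have := H 2%N tt cc tt01 A mA.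
have -> : (fun w => \sum_i cc i * W e (tt i) w) = (fun w => W e t w - W e s w).
  by apply/funext => w; rewrite !big_ord_recl big_ord0 /cc /tt /= mul1r mulN1r addr0.
move=> ->; congr (normal_law 0 _ A); rewrite !big_ord_recl !big_ord0 /cc /tt /= !addr0 !minxx.
by rewrite (minC s t) -/(kap e); field; rewrite gt_eqF.
Qed.

Lemma bridge_indep e e' t s A B : e != e' -> 0 <= t <= 1 -> 0 <= s <= 1 ->
  measurable A -> measurable B ->
  P (W e t @^-1` A `&` W e' s @^-1` B) = (P (W e t @^-1` A) * P (W e' s @^-1` B))%E.
Proof.
move=> ee t01 s01 mA mB.
(* Independence concerns families indexed by all edges, so the remaining edges receive the whole
   space, the preimage of [setT]. *)
pose C i : set Omega := if i == e then W e t @^-1` A else if i == e' then W e' s @^-1` B else setT.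
have pC i : process_sigma (W i) (C i).
  apply: sub_sigma_algebra; rewrite /C; case: eqP => [->|_]; first by exists t, A.
  case: eqP => [->|_]; first by exists s, B.
  by exists 0, setT; rewrite lexx ler01 preimage_setT.
have ee' : (e' == e) = false by rewrite eq_sym (negbTE ee).
have := bridgesW.2 C pC.
have -> : \bigcap_i C i = W e t @^-1` A `&` W e' s @^-1` B.
  apply/seteqP; split=> w.
    by move=> H; have := H e I; have := H e' I; rewrite /C eqxx ee' eqxx => hb ha; split.
  move=> [ha hb] i _; rewrite /C; case: eqP => // _; by case: eqP.
rewrite (bigD1 e)//= (bigD1 e')//= ?ee'// big1 ?mulr1; last first.
  by move=> i /andP[/negbTE ie /negbTE ie']; rewrite /C ie ie' probability_setT.
rewrite /C eqxx ee' eqxx => H.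
have mp i r D : measurable D -> measurable (W i r @^-1` D).
  by move=> mD; rewrite -[X in measurable X]setTI; exact: (measurable_funP (W i r)).
have mA' := mp e t A mA; have mB' := mp e' s B mB.
rewrite -[LHS]fineK ?fin_num_measure//; last exact: measurableI.
by rewrite H -fineM ?fin_num_measure// fineK// fin_numM ?fin_num_measure.
Qed.

Lemma bridge_cos_same e t s b r : 0 <= t -> t <= s -> s <= 1 ->
  \int[P]_w cos (r + (W e t w - W e s w) + b) =
  expR (- ((t * (1 - t) + s * (1 - s) - 2 * (t * (1 - s))) / (2 * kap e))) * cos (r + b).
Proof.
move=> t0 ts s1; set v := t * (1 - t) + s * (1 - s) - 2 * (t * (1 - s)).
have mX : measurable_fun setT (fun w => W e t w - W e s w).
  by apply: measurable_funB; exact: measurable_funP.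
have v0 : 0 <= v.
  have -> : v = (s - t) * (1 - (s - t)) by rewrite /v; ring.
  by rewrite mulr_ge0//; lra.
have t01 : 0 <= t <= 1 by rewrite t0 (le_trans ts s1).
have s01 : 0 <= s <= 1 by rewrite s1 (le_trans t0 ts).
have H := @normal_law_cos R _ _ P (mfun_Sub (mem_set mX)) (v / kap e) 1 (r + b).
transitivity (\int[P]_w cos (1 * (W e t w - W e s w) + (r + b))).
  by apply: eq_Rintegral => w _; congr (cos _); ring.
rewrite H ?divr_ge0 ?(ltW (kap0 e))//.
  by congr (expR _ * _); field; rewrite gt_eqF.
have -> : v = t * (1 - t) + s * (1 - s) - 2 * (Num.min t s - t * s).
  by rewrite min_l// /v; ring.
move=> A mA; exact: (bridge_diff_law e t01 s01 mA).
Qed.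

Lemma bridge_cos_distinct e e' t s b : e != e' -> 0 <= t <= 1 -> 0 <= s <= 1 ->
  \int[P]_w cos (W e t w - W e' s w + b) =
  expR (- (t * (1 - t) / (2 * kap e))) * expR (- (s * (1 - s) / (2 * kap e'))) * cos b.
Proof.
move=> ee t01 s01.
have v0 r i : 0 <= r <= 1 -> 0 <= r * (1 - r) / kap i.
  by move=> /andP[r0 r1]; rewrite divr_ge0 ?(ltW (kap0 i))// mulr_ge0// subr_ge0.
rewrite (normal_law_cos_indep b (v0 t e t01) (v0 s e' s01)).
- by rewrite -expRD; congr (expR _ * _); field; rewrite !gt_eqF.
- by move=> A mA; exact: bridge_law.
- by move=> A mA; exact: bridge_law.
- by move=> A B mA mB; exact: bridge_indep.
Qed.

Section fixed_vertices.
Context (th : V -> R).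

Definition lift_incr e (m : int) : R := th (etgt e) - th (esrc e) + 2 * pi * m%:~R.

(** The closed form of the bridge expectation of the cosine of an observable, given the vertex
    angles and the winding m: Gaussian damping times the cosine of the mean. *)
Definition obs_mean (b : edge_obs R) e (m : int) : R :=
  expR (- (obs_var b / (2 * kap e))) *
  cos (obs_tau b * lift_incr e m + ((eo_p b + eo_q b)%:~R * th (esrc e) + eo_a b)).

Lemma obs_mean_trivial e m : obs_mean (trivial_obs R) e m = 1.
Proof.
have v0 : obs_var (trivial_obs R) = 0 by rewrite /obs_var /=; ring.
have t0 : obs_tau (trivial_obs R) = 0 by rewrite /obs_tau /=; ring.
by rewrite /obs_mean v0 t0 /= !(mul0r, addr0, oppr0) expR0 cos0 mulr1.
Qed.

Lemma prod_obs_mean_single e0 b (m : edge adj -> int) :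
  \prod_e obs_mean (single_obs e0 b e) e (m e) = obs_mean b e0 (m e0).
Proof.
rewrite (bigD1 e0)//= big1 ?mulr1 /single_obs ?eqxx// => e /negbTE ->.
by rewrite obs_mean_trivial.
Qed.

(** On one edge the difference of the bridge at the two points is Gaussian; on distinct edges
    independence splits the damping and cos (A - B) splits into two products. This is the
    decomposition used on the XY side. *)
Lemma villain_spin_dot_mean x y (m : edge adj -> int) : metric_graph x -> metric_graph y ->
  \int[P]_w spin_dot x y (villain_angle W th m w) =
  pair_scale x y * (\prod_e obs_mean (pair_obs x y 0 0 true e) e (m e) +
                    \prod_e obs_mean (pair_obs x y 0 0 false e) e (m e)).
Proof.
case: x y => [e t] [e' s]; rewrite /metric_graph/= => /andP[t0 t1] /andP[s0 s1].
rewrite /pair_scale /pair_obs /=; case: eqP => [<-|/eqP ee] /=.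
  rewrite !prod_obs_mean_single.
  have -> : forall X : R, 2^-1 * (X + X) = X by move=> X; field.
  rewrite /arc_obs /obs_mean /obs_var /obs_tau /=; case: (leP t s) => [ts|/ltW st] /=.
    transitivity (\int[P]_w cos (0 + (W e t w - W e s w) + (t - s) * lift_incr e (m e))).
      by apply: eq_Rintegral => w _; rewrite /spin_dot /villain_angle /= -/(lift_incr e (m e)); congr (cos _); ring.
    apply: (etrans (bridge_cos_same e ((t - s) * lift_incr e (m e)) 0 t0 ts s1)).
    by apply: expR_cos_eq; ring.
  transitivity (\int[P]_w cos (0 + (W e s w - W e t w) + (s - t) * lift_incr e (m e))).
    apply: eq_Rintegral => w _; rewrite /spin_dot /villain_angle /= -/(lift_incr e (m e)) -[LHS]cosN.
    by congr (cos _); ring.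
  apply: (etrans (bridge_cos_same e ((s - t) * lift_incr e (m e)) 0 s0 st t1)).
  by apply: expR_cos_eq; ring.
have H h : \prod_i obs_mean (if i == e then point_obs (e, t) 0 h else single_obs e' (point_obs (e', s) 0 h) i) i (m i) =
   obs_mean (point_obs (e, t) 0 h) e (m e) * obs_mean (point_obs (e', s) 0 h) e' (m e').
  have ee' : e' != e by rewrite eq_sym.
  rewrite (bigD1 e)//= eqxx (bigD1 e')//= (negbTE ee').
  rewrite {1}/single_obs eqxx big1 ?mulr1// => i /andP[/negbTE ie /negbTE ie'].
  by rewrite ie /single_obs ie' obs_mean_trivial.
rewrite mul1r !H.
set A := th (esrc e) + t * lift_incr e (m e); set B := th (esrc e') + s * lift_incr e' (m e').
transitivity (\int[P]_w cos (W e t w - W e' s w + (A - B))).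
  by apply: eq_Rintegral => w _; rewrite /spin_dot /villain_angle /= -/(lift_incr e (m e)) -/(lift_incr e' (m e')) /A /B; congr (cos _); ring.
rewrite (bridge_cos_distinct (A - B) ee (introT andP (conj t0 t1)) (introT andP (conj s0 s1))).
have E i r h j : obs_mean (point_obs (i, r) 0 h) i j =
   expR (- (r * (1 - r) / (2 * kap i))) * cos (th (esrc i) + r * lift_incr i j + h).
  rewrite /obs_mean /obs_var /obs_tau /=; by apply: expR_cos_eq; ring.
rewrite !E -/A -/B !addr0 !cosBpihalf cosB; ring.
Qed.

Let pk e := normal_peak (edge_sd (kap e)).

Lemma pk_gt0 e : 0 < pk e.
Proof. by apply: normal_peak_gt0; rewrite gt_eqF// edge_sd_gt0. Qed.

Lemma villain_term_obs_mean b e m : villain_term J beta e th m * obs_mean b e m =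
  ((pk e)^-1 * expR (- (obs_var b / (2 * kap e)))) *
  vterm (kap e) (obs_tau b) ((eo_p b + eo_q b)%:~R * th (esrc e) + eo_a b) (th (etgt e) - th (esrc e)) m.
Proof.
rewrite /vterm edge_gaussE// /obs_mean -/(lift_incr e m) -/(pk e).
rewrite /villain_term -/(lift_incr e m) -/(kap e); field.
by rewrite gt_eqF// pk_gt0.
Qed.

Lemma villain_term_summable b e : isummable (fun m => villain_term J beta e th m * obs_mean b e m).
Proof.
rewrite (funext (villain_term_obs_mean b e)); apply: isummableZ; exact: vterm_summable.
Qed.

Lemma int_sum_villain_term b e : int_sum (fun m => villain_term J beta e th m * obs_mean b e m) =
  (pk e)^-1 * vil_edge (kap e) b (th (esrc e)) (th (etgt e)).
Proof.
rewrite (eq_int_sum (villain_term_obs_mean b e)) int_sumZ; last exact: vterm_summable.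
by rewrite -mulrA.
Qed.

Lemma villain_edge_weightE e : villain_edge_weight J beta e th =
  (pk e)^-1 * vil_edge (kap e) (trivial_obs R) (th (esrc e)) (th (etgt e)).
Proof.
by rewrite -int_sum_villain_term; apply: eq_int_sum => m; rewrite obs_mean_trivial mulr1.
Qed.

Lemma villain_weightE : villain_weight adj J beta th =
  (\prod_e (pk e)^-1) * \prod_e vil_edge (kap e) (trivial_obs R) (th (esrc e)) (th (etgt e)).
Proof. by rewrite -big_split/=; apply: eq_bigr => e _; exact: villain_edge_weightE. Qed.

Lemma vil_edge_trivial e (u v : R) : vil_edge (kap e) (trivial_obs R) u v = vser (kap e) 0 0 (v - u).
Proof.
have v0 : obs_var (trivial_obs R) = 0 by rewrite /obs_var /=; ring.
have t0 : obs_tau (trivial_obs R) = 0 by rewrite /obs_tau /=; ring.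
by rewrite /vil_edge v0 t0 /= !(mul0r, addr0, oppr0) expR0 mul1r.
Qed.

(** The term m = 0 at the largest reduced increment, pi; it bounds the whole positive series from
    below. *)
Definition vser_min e : R := pk e * expR (- (kap e / 2 * pi ^+ 2)).

Lemma vser_min_gt0 e : 0 < vser_min e.
Proof. by rewrite mulr_gt0 ?pk_gt0 ?expR_gt0. Qed.

Lemma vser_min_le e (x : R) : vser_min e <= vser (kap e) 0 0 x.
Proof.
rewrite vser_short_arc; have := short_arcE x; rewrite -ler_norml; move: (short_arc x) => s spi.
have t0 m : vterm (kap e) 0 0 s m = normal_pdf 0 (edge_sd (kap e)) (s + 2 * pi * m%:~R).
  by rewrite /vterm mul0r addr0 cos0 mulr1.
apply: le_trans (int_sum_ge_term 0 (vterm_summable (kap0 e) 0 0 s) _); last first.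
  by move=> m; rewrite t0 normal_pdf_ge0.
rewrite t0 mulr0 addr0 edge_gaussE// ler_wpM2l ?(ltW (pk_gt0 e))//.
rewrite ler_expR lerN2 ler_wpM2l ?divr_ge0 ?(ltW (kap0 e))//.
by rewrite -[leLHS]real_normK ?num_real// ler_sqr ?nnegrE// ltW// pi_gt0.
Qed.

Lemma villain_edge_weight_gt0 e : 0 < villain_edge_weight J beta e th.
Proof.
rewrite villain_edge_weightE vil_edge_trivial; apply: mulr_gt0.
  by rewrite invr_gt0; exact: pk_gt0.
exact: lt_le_trans (vser_min_gt0 e) (vser_min_le e _).
Qed.

(** The Villain weight cancels the denominators of [winding_prob], which are positive, and leaves
    the unnormalized winding sums [vil_edge], up to the peaks. *)
Lemma villain_integrand x y : metric_graph x -> metric_graph y ->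
  villain_weight adj J beta th * multi_int_sum (fun m => winding_prob J beta th m *
    \int[P]_w spin_dot x y (villain_angle W th m w)) =
  (\prod_e (pk e)^-1) * (pair_scale x y *
   (\prod_e vil_edge (kap e) (pair_obs x y 0 0 true e) (th (esrc e)) (th (etgt e)) +
    \prod_e vil_edge (kap e) (pair_obs x y 0 0 false e) (th (esrc e)) (th (etgt e)))).
Proof.
move=> mx my; pose w e := (villain_edge_weight J beta e th)^-1.
pose a h e m := w e * (villain_term J beta e th m * obs_mean (pair_obs x y 0 0 h e) e m).
have sa h e : isummable (a h e) by apply: isummableZ; exact: villain_term_summable.
rewrite (_ : (fun m => _ * _) = fun m => pair_scale x y * (\prod_e a true e (m e) + \prod_e a false e (m e))).
  rewrite multi_int_sum_prod// mulrCA -[RHS]mulrCA; congr (_ * _).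
  rewrite !mulrDr -!big_split/=; congr (_ + _); apply: eq_bigr => e _;
  rewrite /a int_sumZ ?int_sum_villain_term ?mulVKf//; try exact: villain_term_summable;
  by rewrite gt_eqF ?villain_edge_weight_gt0.
apply/funext => m; rewrite villain_spin_dot_mean// mulrCA; congr (_ * _).
rewrite mulrDr -!big_split/=; congr (_ + _); apply: eq_bigr => e _; rewrite /a /w; ring.
Qed.
End fixed_vertices.

Lemma cbm_prod_vil_edge N o : (forall e, obs_valid N (o e)) ->
  cbm (fun th => \prod_e vil_edge (kap e) (o e) (th (esrc e)) (th (etgt e))).
Proof.
by move=> vo; apply: cbm_prod => e; exact: (cbm_vil_edge (kap0 e) (esrc e) (etgt e) (vo e)).
Qed.

(** For N = 1 the capped site index is 0, which certifies as valid the observables with indices 0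
    used on the Villain side. *)
Lemma pair_obs_valid1 x y h e : metric_graph x -> metric_graph y ->
  obs_valid 1 (pair_obs x y 0 0 h e).
Proof.
by move=> mx my; have := pair_obs_valid h (ltn0Sn 0) mx my e; rewrite /site_index !minn0.
Qed.

(** The edge factors are bounded below by constants independent of the angles, and the vertex torus
    has positive volume. *)
Lemma villain_integral_vacuum_gt0 : 0 < VI (@vacuum R V adj).
Proof.
pose m : R := \prod_e vser_min e.
have m0 : 0 < m by apply: prodr_gt0 => e _; exact: vser_min_gt0.
apply: (@lt_le_trans _ _ (iterated_seq (@tint R) (enum V) (fun=> m) (fun=> 0))).
  by rewrite it_cst mulr_gt0// exprn_gt0// mulr_gt0// pi_gt0.
apply: le_it; first exact: bmf_cst.
  by apply: (cbm_prod_vil_edge (N := 1%N)) => e; exact: trivial_obs_valid.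
move=> th; apply: ler_prod => e _; rewrite (ltW (vser_min_gt0 e))/= vil_edge_trivial.
exact: vser_min_le.
Qed.

Lemma villain_expectE x y : metric_graph x -> metric_graph y ->
  villain_expect J beta W (spin_dot x y) = pair_villain J beta x y / VI (@vacuum R V adj).
Proof.
move=> mx my; rewrite /villain_expect /torus_integral /iterated.
set M := \prod_e (normal_peak (edge_sd (kap e)))^-1.
have M0 : M != 0.
  by apply/prodf_neq0 => e _; rewrite invr_neq0// gt_eqF// pk_gt0.
have bp h := cbm_prod_vil_edge (fun e => pair_obs_valid1 h e mx my).
rewrite (_ : iterated_seq _ _ _ _ / _ = (M * pair_villain J beta x y) / (M * VI (@vacuum R V adj))).
  by rewrite -mulf_div divff// mul1r.
congr (_ / _).
- rewrite /pair_villain big_bool/= -itD// -itZ; last exact: (bmfD (bp true) (bp false)).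
  rewrite -itZ; last exact: (bmfZ _ (bmfD (bp true) (bp false))).
  by apply: eq_it => th; exact: villain_integrand.
- rewrite -itZ; first by apply: eq_it => th; exact: villain_weightE.
  by apply: (cbm_prod_vil_edge (N := 1%N)) => e; exact: trivial_obs_valid.
Qed.
End villain_bridge_expectation.

Theorem theoremA2 (R : realType) (V : finType) (adj : rel V)
  (adj_irr : irreflexive adj) (adj_sym : symmetric adj)
  (J : V -> V -> R) (J_sym : forall u v, J u v = J v u)
  (J_gt0 : forall u v, adj u v -> 0 < J u v)
  (beta : R) (beta_gt0 : 0 < beta)
  (d : measure_display) (Omega : measurableType d) (P : probability Omega R)
  (W : edge adj -> R -> {RV P >-> R}) (bridgesW : villain_bridges J beta W) :
  forall eps : R, 0 < eps ->
    \forall N \near \oo, forall x y : edge adj * R,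
      metric_graph x -> metric_graph y ->
      `|xy_expect J beta N (spin_dot x y) -
        villain_expect J beta W (spin_dot x y)| < eps.
Proof.
move=> eps eps0.
have [N0 H] := xy_expect_cvg J_gt0 beta_gt0 (villain_integral_vacuum_gt0 J_gt0 beta_gt0) eps0.
exists N0 => // N NN x y mx my.
by rewrite (villain_expectE J_gt0 beta_gt0 bridgesW mx my); exact: H.
Qed.
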